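(* Let $d\ge2$ be an integer, $\kappa\in\mathbb R\setminus\{0\}$, and let $P=[-\tau_1^-,\tau_1^+]\times\cdots\times[-\tau_d^-,\tau_d^+]$ for some $\tau_1^-,\ldots,\tau_d^->0$ and $\tau_1^+,\ldots,\tau_d^+>0$. Assume that $P\subseteq\bar{\mathbb B}^d(\kappa)$. For $1\le p\le d$, let $$F=\{x\in P:x_1=\tau_1^+,\ldots,x_p=\tau_p^+\},$$ and suppose that, when $\kappa<0$, the face $F$ is not an ideal vertex (i.e. not a vertex lying on $\partial\mathbb B^d(\kappa)$). Let $x\in\operatorname{relint}(F)\cap\mathbb B^d(\kappa)$. Then the following assertions hold. (a) The normal cone $N_x(F,P)\subseteq(T_x\mathbb B^d(\kappa),g_x)$ is isometric to the orthocentric cone $$C_p\left(\tfrac1\kappa;(\tau_1^+)^2,\ldots,(\tau_p^+)^2;1,\ldots,1\right).$$ (b) The external angle at $F$ is $$\alpha_x(N_x(F,P))=\mathbf g_p\left(-\tfrac1\kappa-(\tau_1^+)^2-\cdots-(\tau_p^+)^2;(\tau_1^+)^2,\ldots,(\tau_p^+)^2;1,\ldots,1\right)$$ $$=\frac1{\sqrt{2\pi}}\int_{-\infty}^\infty\prod_{j=1}^p\Phi\left(\frac{\tau_j^+z}{\sqrt{-\frac1\kappa-(\tau_1^+)^2-\cdots-(\tau_p^+)^2}}\right)e^{-z^2/2}\,dz.$$ (c) The tangent cone $T_x(F,P)\subseteq(T_x\mathbb B^d(\kappa),g_x)$ is isometric to the direct orthogonal sum of $\mathbb R^{d-p}$ and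 the orthocentric cone $$C_p\left(-\tfrac1\kappa-(\tau_1^+)^2-\cdots-(\tau_p^+)^2;(\tau_1^+)^2,\ldots,(\tau_p^+)^2;1,\ldots,1\right).$$ (d) The internal angle at $F$ is $$\alpha_x(T_x(F,P))=\mathbf g_p\left(\tfrac1\kappa;(\tau_1^+)^2,\ldots,(\tau_p^+)^2;1,\ldots,1\right)=\frac1{\sqrt{2\pi}}\int_{-\infty}^\infty\prod_{j=1}^p\Phi\left(\tau_j^+\sqrt\kappa\,z\right)e^{-z^2/2}\,dz.$$
   Context: Klein model. $\mathbb B^d(\kappa):=\mathbb R^d$ if $\kappa\ge0$ and $\mathbb B^d(\kappa):=\{x\in\mathbb R^d:\|x\|<1/\sqrt{-\kappa}\}$ if $\kappa<0$; $\bar{\mathbb B}^d(\kappa)$ is its Euclidean closure. The tangent space $T_x\mathbb B^d(\kappa)$ at $x\in\mathbb B^d(\kappa)$ is identified with $\mathbb R^d$ and carries the inner product $$g_x(u,v)=\frac{\langle u,v\rangle}{1+\kappa\|x\|^2}-\frac{\kappa\langle x,u\rangle\langle x,v\rangle}{(1+\kappa\|x\|^2)^2}.$$ Polytopes, cones, angles. Let $P=\{y\in\mathbb R^d:\langle a_r,y\rangle\le b_r,\ r=1,\ldots,m\}\subseteq\bar{\mathbb B}^d(\kappa)$ be a full-dimensional polytope with irredundant inequalities ($a_r\neq 0$), $F\ne P$ a (nonempty) face, $I(F)=\{r:\langle a_r,y\rangle=b_r\ \forall y\in F\}$. For $x\in\operatorname{relint}(F)\cap\mathbb B^d(\kappa)$: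 $T_x(F,P)=\{u\in\mathbb R^d:\langle a_r,u\rangle\le0\ \forall r\in I(F)\}$ and $N_x(F,P)=\{v\in\mathbb R^d: g_x(v,u)\le0\ \forall u\in T_x(F,P)\}$, both regarded as cones in $(\mathbb R^d,g_x)$. For a polyhedral cone $K$ in a finite-dimensional inner product space with linear hull $L$, its solid angle is the ratio of the $(\dim L)$-dimensional volumes of $K\cap B$ and $L\cap B$, $B$ the unit ball; $\alpha_x$ is the solid angle with respect to $g_x$. The internal and external angles at $F$ are $\alpha_x(T_x(F,P))$ and $\alpha_x(N_x(F,P))$. Two cones in inner product spaces are isometric if a linear isometry between their linear hulls maps one onto the other. Orthocentric cones. For $m\in\mathbb N$, $\lambda_0,\ldots,\lambda_m\in\mathbb R\setminus\{0\}$ and $\varepsilon_1,\ldots,\varepsilon_m\in\{\pm1\}$, $C_m(\lambda_0;\lambda_1,\ldots,\lambda_m;\varepsilon_1,\ldots,\varepsilon_m)$ denotes any cone $\operatorname{pos}\{\varepsilon_1v_1,\ldots,\varepsilon_mv_m\}$ (the set of nonnegative linear combinations) with linearly independent $v_1,\ldots,v_m\in\mathbb R^N$, $N\ge m$, satisfying $\langle v_i,v_j\rangle=\frac1{\lambda_0}+\frac{\delta_{ij}}{\lambda_i}$; it is unique up to isometry. For $\lambda_1,\ldots,\lambda_m>0$ and either $\lambda_0>0$ or $\lambda_0<-(\lambda_1+\cdots+\lambda_m)$, $$\mathbf g_m(\lambda_0;\lambda_1,\ldots,\lambda_m;\varepsilon_1,\ldots,\varepsilon_m)=\frac1{\sqrt{2\pi}}\int_{-\infty}^\infty\prod_{j=1}^m\Phi\left(\varepsilon_j\sqrt{\tfrac{\lambda_j}{\lambda_0}}\,x\right)e^{-x^2/2}\,dx.$$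 $\Phi$ is the entire function $\Phi(z)=\frac12+\frac1{\sqrt{2\pi}}\int_0^z e^{-t^2/2}\,dt$. Convention: $\sqrt{-a}:=\mathrm i\sqrt a$ for $a>0$. *)

(* Defs.v *)
From HB Require Import structures.
From mathcomp Require Import all_boot all_order all_algebra.
From mathcomp Require Import complex.
From mathcomp Require Import all_classical all_reals all_analysis.

Set Implicit Arguments.
Unset Strict Implicit.
Unset Printing Implicit Defensive.

Import Order.TTheory GRing.Theory Num.Theory.
Import numFieldNormedType.Exports.

Local Open Scope classical_set_scope.
Local Open Scope ring_scope.
Local Open Scope complex_scope.

Definition dot (R : realType) (n : nat) (u v : 'rV[R]_n) : R :=
  \sum_i u 0 i * v 0 i.

(* The Euclidean norm; the library norm on matrices is the sup norm (it induces
   the same topology, so [closure] and [interior] are the Euclidean ones). *)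
Definition enorm (R : realType) (n : nat) (u : 'rV[R]_n) : R :=
  Num.sqrt (dot u u).

Definition klein_ball (R : realType) (d : nat) (kappa : R) : set 'rV[R]_d :=
  if 0 <= kappa then setT
  else [set x : 'rV[R]_d | enorm x < 1 / Num.sqrt (- kappa)].

Definition klein_boundary (R : realType) (d : nat) (kappa : R) :
    set 'rV[R]_d :=
  closure (@klein_ball R d kappa) `\` interior (@klein_ball R d kappa).

Definition klein_metric (R : realType) (d : nat) (kappa : R)
    (x u v : 'rV[R]_d) : R :=
  dot u v / (1 + kappa * enorm x ^+ 2)
  - kappa * dot x u * dot x v / (1 + kappa * enorm x ^+ 2) ^+ 2.

Definition aff_hull (R : realType) (n : nat) (A : set 'rV[R]_n) :
    set 'rV[R]_n :=
  [set y | exists k (z : 'I_k -> 'rV[R]_n) (c : 'I_k -> R),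
    [/\ forall i, A (z i), \sum_i c i = 1 & y = \sum_i c i *: z i]].

Definition relint (R : realType) (n : nat) (A : set 'rV[R]_n) : set 'rV[R]_n :=
  [set x | A x /\ exists2 e : R, 0 < e &
    forall y, aff_hull A y -> enorm (y - x) < e -> A y].

(* [P] is given by the inequalities [dot (a r) y <= b r], none of which can be
   dropped without enlarging the solution set. *)
Definition irredundant_representation (R : realType) (d m : nat)
    (a : 'I_m -> 'rV[R]_d) (b : 'I_m -> R) (P : set 'rV[R]_d) : Prop :=
  [/\ forall r, a r != 0,
      P = [set y | forall r, dot (a r) y <= b r] &
      forall r, P `<` [set y | forall s, s != r -> dot (a s) y <= b s]].

Definition active (R : realType) (d m : nat) (a : 'I_m -> 'rV[R]_d)
    (b : 'I_m -> R) (F : set 'rV[R]_d) : set 'I_m :=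
  [set r | forall y, F y -> dot (a r) y = b r].

(* The tangent cone of the face [F]; with tangent spaces identified with R^d it
   is the same set at all points of the relative interior of [F]. *)
Definition tangent_cone (R : realType) (d m : nat) (a : 'I_m -> 'rV[R]_d)
    (b : 'I_m -> R) (F : set 'rV[R]_d) : set 'rV[R]_d :=
  [set u | forall r, active a b F r -> dot (a r) u <= 0].

Definition normal_cone (R : realType) (d m : nat) (kappa : R)
    (a : 'I_m -> 'rV[R]_d) (b : 'I_m -> R) (F : set 'rV[R]_d) (x : 'rV[R]_d) :
    set 'rV[R]_d :=
  [set v | forall u, tangent_cone a b F u -> klein_metric kappa x v u <= 0].

Definition is_lin_hull (R : realType) (V : vectType R) (K : set V)
    (L : {vspace V}) : Prop :=
  K `<=` [set` L] /\ forall U : {vspace V}, K `<=` [set` U] -> (L <= U)%VS.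

Definition lin_hull (R : realType) (V : vectType R) (K : set V) : {vspace V} :=
  xget 0%VS [set L | is_lin_hull K L].

Lemma lin_hullP (R : realType) (V : vectType R) (K : set V) :
  is_lin_hull K (lin_hull K).
Proof.
rewrite /lin_hull; case: xgetP => [//|noL]; exfalso.
pose S (L : {vspace V}) :=
  forall U : {vspace V}, K `<=` [set` U] -> (L <= U)%VS.
pose D n := `[< exists2 L, S L & \dim L = n >].
have D0 : exists n, D n.
  by exists 0%N; apply/asboolP; exists 0%VS; [move=> U _; exact: sub0v|
    rewrite dimv0].
have Db n : D n -> (n <= \dim {:V})%N.
  by move=> /asboolP[L _ <-]; exact: dimvS (subvf L).
case: (ex_maxnP D0 Db) => n /asboolP[L SL dL] nmax.
apply: (noL L); split=> // u Ku /=.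
have SLu : S (L + <[u]>)%VS.
  move=> U KU; rewrite subv_add SL //=.
  by rewrite -memvE; exact: KU.
have /nmax : D (\dim (L + <[u]>)%VS) by apply/asboolP; exists (L + <[u]>)%VS.
rewrite -dL => dle.
have /eqP-> : L == (L + <[u]>)%VS by rewrite eqEdim addvSl.
by apply: subvP (addvSr L <[u]>%VS) _ (memv_line u).
Qed.

(* A linear map restricting to an isometry between the linear hulls and mapping
   one set onto the other. *)
Definition isometric (R : realType) (V W : vectType R)
    (g : V -> V -> R) (K : set V) (h : W -> W -> R) (C : set W) : Prop :=
  exists f : 'Hom(V, W),
    [/\ forall u v, u \in lin_hull K -> v \in lin_hull K ->
          h (f u) (f v) = g u v,
        (f @: lin_hull K)%VS = lin_hull C &
        [set f u | u in K] = C].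

(* n-dimensional Lebesgue measure (of Borel sets) as the iterated product of
   one-dimensional ones, by slicing along the first coordinate. *)
Fixpoint lebesgue_vol (R : realType) (n : nat) : set 'rV[R]_n -> \bar R :=
  match n with
  | 0 => fun A => (\1_A 0)%:E
  | n'.+1 => fun A => (\int[@lebesgue_measure R]_t
      @lebesgue_vol R n'
        [set y : 'rV[R]_n' | A (row_mx (t%:M : 'rV[R]_1) y)])%E
  end.

(* The (\dim L)-dimensional volume of the intersection of [A] and [L] with
   respect to the inner product [g]: Lebesgue measure in the coordinates of a
   basis of [L], times the square root of the Gram determinant. *)
Definition subspace_vol (R : realType) (V : vectType R) (g : V -> V -> R)
    (L : {vspace V}) (A : set V) : \bar R :=
  let e := vbasis L in
  ((Num.sqrt (\det (\matrix_(i < \dim L, j < \dim L) g e`_i e`_j)))%:E *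
   lebesgue_vol [set c : 'rV[R]_(\dim L) | A (\sum_i c 0 i *: e`_i)%R])%E.

Definition solid_angle (R : realType) (V : vectType R) (g : V -> V -> R)
    (K : set V) : R :=
  let L := lin_hull K in
  let B := [set u | g u u <= 1] in
  fine (subspace_vol g L (K `&` B)) / fine (subspace_vol g L ([set` L] `&` B)).

Definition pos_hull (R : realType) (V : vectType R) (m : nat) (v : 'I_m -> V) :
    set V :=
  [set u | exists2 c : 'I_m -> R, (forall i, 0 <= c i) &
    u = \sum_i c i *: v i].

(* [C] is a cone C_m(lambda0; lambda; eps) in R^N. *)
Definition orthocentric_cone (R : realType) (m : nat) (lambda0 : R)
    (lambda eps : 'I_m -> R) (N : nat) (C : set 'rV[R]_N) : Prop :=
  [/\ lambda0 != 0, forall i, lambda i != 0,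
      forall i, eps i = 1 \/ eps i = -1 &
      exists v : 'I_m -> 'rV[R]_N,
        [/\ row_free (\matrix_i v i),
            forall i j,
              dot (v i) (v j) = 1 / lambda0 + (i == j)%:R / lambda i &
            C = pos_hull (fun i => eps i *: v i)]].

(* The direct orthogonal sum, inside R^k x R^N with its standard inner
   product. *)
Definition orthogonal_sum (R : realType) (k N : nat) (A : set 'rV[R]_k)
    (C : set 'rV[R]_N) : set 'rV[R]_(k + N) :=
  [set row_mx u w | u in A & w in C].

Definition cexp (R : realType) (z : R[i]) : R[i] :=
  (expR (complex.Re z))%:C * (cos (complex.Im z) +i* sin (complex.Im z)).

Definition csqrt (R : realType) (a : R) : R[i] :=
  if 0 <= a then (Num.sqrt a)%:C else 0 +i* Num.sqrt (- a).

Definition cintegral (R : realType) (D : set R) (f : R -> R[i]) : R[i] :=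
  (\int[@lebesgue_measure R]_(t in D) complex.Re (f t)) +i*
  (\int[@lebesgue_measure R]_(t in D) complex.Im (f t)).

(* The integral from 0 to [z] is taken along the segment t |-> t * z; the
   integrand being entire, it does not depend on the path. *)
Definition Phi (R : realType) (z : R[i]) : R[i] :=
  1 / 2 + ((Num.sqrt (2 * pi))^-1)%:C *
    cintegral `[0, 1] (fun t => z * cexp (- (t%:C * z) ^+ 2 / 2)).

Definition gaussian_mean (R : realType) (f : R -> R[i]) : R[i] :=
  ((Num.sqrt (2 * pi))^-1)%:C *
    cintegral setT (fun x => f x * (expR (- x ^+ 2 / 2))%:C).

Definition g_fun (R : realType) (m : nat) (lambda0 : R)
    (lambda eps : 'I_m -> R) : R[i] :=
  gaussian_mean (fun x =>
    \prod_j Phi ((eps j)%:C * csqrt (lambda j / lambda0) * x%:C)).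

Definition box (R : realType) (d : nat) (taum taup : 'I_d -> R) :
    set 'rV[R]_d :=
  [set x | forall i, - taum i <= x 0 i <= taup i].

Definition box_face (R : realType) (d : nat) (taum taup : 'I_d -> R) (p : nat) :
    set 'rV[R]_d :=
  [set x | box taum taup x /\ forall i : 'I_d, (i < p)%N -> x 0 i = taup i].

(* For a face [F], being a vertex means being a single point. *)
Definition ideal_vertex (R : realType) (d : nat) (kappa : R)
    (F : set 'rV[R]_d) : Prop :=
  exists v, F = [set v] /\ klein_boundary kappa v.

(* Main.v *)
Require Import Defs.
From HB Require Import structures.
From mathcomp Require Import all_boot all_order all_algebra.
From mathcomp Require Import complex.
From mathcomp Require Import all_classical all_reals all_analysis.
From mathcomp Require Import measurable_realfun.
From mathcomp Require Import ring lra.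

Set Implicit Arguments.
Unset Strict Implicit.
Unset Printing Implicit Defensive.

Import Order.TTheory GRing.Theory Num.Theory.
Import numFieldNormedType.Exports.

Local Open Scope classical_set_scope.
Local Open Scope ring_scope.
Local Open Scope complex_scope.

(** Both angles are computed by one mechanism, and the two isometries come out
of the same Gram matrices.

Geometry.  Write s = 1 + kappa |x|^2.  The Klein metric at x is the rank-one
perturbation <u, v> / s - kappa <x, u> <x, v> / s^2 of a multiple of the
Euclidean product.  At a relative interior point of the face, the tangent cone
is { u : u_i <= 0 for i < p }, whatever inequalities describe the box
([tangent_cone_box_face]).  The vectors nu_i = e_i + kappa x_i x satisfy
g_x(nu_i, u) = u_i / s, so they are dual to the coordinates and the normal cone
is spanned by sqrt(s) nu_i with i < p, whose Gram matrix is
delta_ij + kappa tau_i tau_j; dividing the i-th vector by tau_i gives the Gram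
matrix of an orthocentric cone with lambda_0 = 1 / kappa.  For the tangent cone
one corrects e_i (i < p) by an element of the lineality space, so as to make it
orthogonal to that space; the Gram matrix becomes
(delta_ij - kappa tau_i tau_j / sigma) / s, where
sigma = 1 + kappa (tau_1^2 + ... + tau_p^2), and - kappa / sigma is the inverse
of - 1 / kappa - (tau_1^2 + ... + tau_p^2).  A linear map that carries one
spanning basis to another with the same Gram matrix is an isometry of the cones
([isometric_cone_param]).

Angles.  Each cone is the image of an orthant, possibly with some coordinates
left free, under a basis with Gram matrix delta_ij - (c / Q) a_i a_j, where
Q = 1 + c (a_1^2 + ... + a_n^2) > 0.  For the tangent cone, c = kappa and a = x;
for the normal cone, c is the inverse of
- 1 / kappa - (tau_1^2 + ... + tau_p^2) and a = tau up to a sign.  The solid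
angle is then the Gaussian mean of the product of Phi (a_j sqrt(c) z) over the
constrained coordinates j ([solid_angle_cone_param]), for three reasons.

- In a cone, the volume of the unit ball of the quadratic form
  q(t) = |t|^2 - (c / Q) <a, t>^2 is proportional to the integral of
  exp (- q / 2), with a factor independent of the cone ([cone_gauss_volume]).

- exp (- q / 2) is the standard Gaussian weight times
  exp (c <a, t>^2 / (2 Q)), and this last factor is itself a Gaussian integral
  in one more variable z, of exp (sqrt(c) <a, t> z) against exp (- Q z^2 / 2).
  The integrand then splits into factors that contain a single t_j each, and
  Fubini leaves an integral over z of a product of one-dimensional integrals.
  When c < 0 the exponential is oscillating: it becomes a Fourier kernel
  ([integral_prod_laplace_weight], [integral_prod_fourier_weight]).

- The Gaussian integral of exp (t y) over the half line t >= 0 is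
  sqrt(2 pi) exp (y^2 / 2) Phi (y), for y real and for y imaginary
  ([Phi_real], [Phi_imag]); over the whole line Phi disappears, which is why
  the free coordinates contribute nothing.  The factors exp (y^2 / 2) turn
  exp (- Q z^2 / 2) into exp (- z^2 / 2). *)

(** * Iterated integrals over row vectors *)

Section iterated_integral.
Context {R : realType}.
Local Notation mu := (@lebesgue_measure R).
Local Open Scope ereal_scope.

(** Integration in the order in which [lebesgue_vol] slices its argument. *)
Fixpoint iint (n : nat) : ('rV[R]_n -> \bar R) -> \bar R :=
  match n with
  | 0 => fun f => f 0%R
  | n'.+1 => fun f =>
      \int[mu]_t @iint n' (fun y => f (row_mx (t%:M : 'rV[R]_1) y))
  end.

Lemma iintS n (f : 'rV[R]_n.+1 -> \bar R) :
  iint f = \int[mu]_t iint (fun y => f (row_mx (t%:M : 'rV[R]_1) y)).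
Proof. by []. Qed.

Lemma row_cons0 n (t : R) (y : 'rV[R]_n) :
  (row_mx (t%:M : 'rV[R]_1) y : 'rV[R]_n.+1) 0%R ord0 = t.
Proof.
rewrite (_ : ord0 = lshift n (ord0 : 'I_1)); last exact: val_inj.
apply: (etrans (row_mxEl (t%:M : 'rV[R]_1) y 0%R ord0)).
by rewrite mxE eqxx mulr1n.
Qed.

Lemma row_consS n (t : R) (y : 'rV[R]_n) (j : 'I_n) :
  (row_mx (t%:M : 'rV[R]_1) y : 'rV[R]_n.+1) 0%R (lift ord0 j) = y 0%R j.
Proof.
rewrite (_ : lift ord0 j = rshift 1 j); last exact: val_inj.
exact: (row_mxEr (t%:M : 'rV[R]_1) y 0%R j).
Qed.

Lemma lebesgue_vol_iint n (A : set 'rV[R]_n) :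
  lebesgue_vol A = iint (fun y => (\1_A y)%:E).
Proof.
elim: n A => [//|n IH] A /=; apply: eq_integral => t _; rewrite IH.
by congr iint; apply/funext => y; rewrite !indicE.
Qed.

(** Measurability on row vectors is tested along all maps from measurable spaces
with measurable coordinates; a sigma-algebra on ['rV_n] is thereby avoided, and
the notion is stable under slicing and under linear maps. *)
Definition coord_measurable d (T : measurableType d) n (X : T -> 'rV[R]_n) :=
  forall i, measurable_fun setT (fun w => X w 0%R i).

(** Joint measurability of a function of a parameter and of a row vector, tested
in the same way. *)
Definition measurable_param d (T : measurableType d) n
    (F : T -> 'rV[R]_n -> \bar R) :=
  forall d' (T' : measurableType d') (h : T' -> T) (X : T' -> 'rV[R]_n),
    measurable_fun setT h -> coord_measurable X ->
    measurable_fun setT (fun w => F (h w) (X w)).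

Definition measurable_row n (f : 'rV[R]_n -> \bar R) :=
  forall d (T : measurableType d) (X : T -> 'rV[R]_n),
    coord_measurable X -> measurable_fun setT (f \o X).

Definition measurable_row2 m n (f : 'rV[R]_m -> 'rV[R]_n -> \bar R) :=
  forall d (T : measurableType d) (X : T -> 'rV[R]_m) (Y : T -> 'rV[R]_n),
    coord_measurable X -> coord_measurable Y ->
    measurable_fun setT (fun w => f (X w) (Y w)).

Lemma coord_measurable_comp d d' (T : measurableType d) (T' : measurableType d')
    n (X : T -> 'rV[R]_n) (h : T' -> T) :
  measurable_fun setT h -> coord_measurable X -> coord_measurable (X \o h).
Proof. by move=> mh mX i; exact: measurableT_comp (mX i) mh. Qed.

Lemma coord_measurable_cst d (T : measurableType d) n (v : 'rV[R]_n) :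
  coord_measurable (fun _ : T => v).
Proof. by move=> i; exact: measurable_cst. Qed.

Lemma coord_measurable_cons d (T : measurableType d) n (t : T -> R)
    (X : T -> 'rV[R]_n) :
  measurable_fun setT t -> coord_measurable X ->
  coord_measurable (fun w => row_mx ((t w)%:M : 'rV[R]_1) (X w)).
Proof.
move=> mt mX i; rewrite -(splitK i).
case: (fintype.split i) => j /=.
  under eq_fun do rewrite row_mxEl mxE (ord1 j) eqxx mulr1n.
  exact: mt.
under eq_fun do rewrite row_mxEr.
exact: mX.
Qed.

Lemma iint_ge0 n (f : 'rV[R]_n -> \bar R) : (forall y, 0 <= f y) -> 0 <= iint f.
Proof.
elim: n f => [|n IH] f f0 /=; first exact: f0.
by apply: integral_ge0 => t _; exact: IH.
Qed.

(** The parameter space is general because the induction enlarges it by the first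
coordinate. *)
Lemma measurable_iint d (T : measurableType d) n (F : T -> 'rV[R]_n -> \bar R) :
  measurable_param F -> (forall w y, 0 <= F w y) ->
  measurable_fun setT (fun w => iint (F w)).
Proof.
elim: n d T F => [|n IH] d T F mF F0 /=.
  by apply: (mF _ _ id (fun=> 0%R)) => //; exact: coord_measurable_cst.
apply: (measurable_fun_fubini_tonelli_F (m2 := mu)
  (fun wt : T * R => iint (fun y => F wt.1 (row_mx (wt.2%:M : 'rV[R]_1) y)))).
  apply: (IH _ _ (fun (wt : T * R) y => F wt.1 (row_mx (wt.2%:M : 'rV[R]_1) y)))
    => // d' T' h X mh mX.
  apply: (mF _ _ (fst \o h)).
    exact: measurableT_comp.
  by apply: coord_measurable_cons => //; exact: measurableT_comp.
by move=> wt; exact: iint_ge0.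
Qed.

Lemma measurable_param_slice n (f : 'rV[R]_n.+1 -> \bar R) : measurable_row f ->
  measurable_param (fun t : R => fun y => f (row_mx (t%:M : 'rV[R]_1) y)).
Proof. by move=> mf d T h X mh mX; apply: mf; exact: coord_measurable_cons. Qed.

Lemma measurable_row_slice n (f : 'rV[R]_n.+1 -> \bar R) (t : R) :
  measurable_row f -> measurable_row (fun y => f (row_mx (t%:M : 'rV[R]_1) y)).
Proof.
by move=> mf d T X mX; apply: mf; apply: coord_measurable_cons => //.
Qed.

Lemma measurable_iint_slice n (f : 'rV[R]_n.+1 -> \bar R) : measurable_row f ->
  (forall y, 0 <= f y) ->
  measurable_fun setT
    (fun t : R => iint (fun y => f (row_mx (t%:M : 'rV[R]_1) y))).
Proof.
by move=> mf f0; apply: measurable_iint => //; exact: measurable_param_slice.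
Qed.

Lemma ge0_iintZl n (f : 'rV[R]_n -> \bar R) (c : \bar R) : measurable_row f ->
  (forall y, 0 <= f y) -> 0 <= c ->
  iint (fun y => c * f y) = c * iint f.
Proof.
elim: n f => [//|n IH] f mf f0 c0 /=.
have mfs t := measurable_row_slice t mf.
under eq_integral do rewrite (IH _ (mfs _))//.
by rewrite ge0_integralZl//; [exact: measurable_iint_slice|
  move=> t _; exact: iint_ge0].
Qed.

Lemma le_iint n (f g : 'rV[R]_n -> \bar R) : measurable_row f -> measurable_row g ->
  (forall y, 0 <= f y) -> (forall y, f y <= g y) -> iint f <= iint g.
Proof.
elim: n f g => [|n IH] f g mf mg f0 fg /=; first exact: fg.
have g0 y : 0 <= g y by exact: le_trans (f0 y) (fg y).
apply: ge0_le_integral => //.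
- by move=> t _; exact: iint_ge0.
- exact: measurable_iint_slice.
- exact: measurable_iint_slice.
- by move=> t _; apply: IH => //; exact: measurable_row_slice.
Qed.

Lemma integral_iint_swap n (F : R -> 'rV[R]_n -> \bar R) :
  measurable_param F -> (forall x y, 0 <= F x y) ->
  \int[mu]_x iint (F x) = iint (fun y => \int[mu]_x F x y).
Proof.
elim: n F => [//|n IH] F mF F0 /=.
pose G (xt : R * R) y := F xt.1 (row_mx (xt.2%:M : 'rV[R]_1) y).
have mG : measurable_fun setT (fun xt => iint (G xt)).
  apply: measurable_iint => [d T h X mh mX|xt y]; last exact: F0.
  apply: (mF _ _ (fst \o h)).
    exact: measurableT_comp.
  by apply: coord_measurable_cons => //; exact: measurableT_comp.
have G0 xt : 0 <= iint (G xt) by apply: iint_ge0 => y; exact: F0.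
transitivity (\int[mu]_t \int[mu]_x iint (G (x, t))).
  exact: (fubini_tonelli (m1 := mu) (m2 := mu) _ mG G0).
apply: eq_integral => t _; rewrite -(IH (fun x => G (x, t)))// => [d T h X mh mX|x y].
  by apply: (mF _ _ h) => //; exact: coord_measurable_cons.
exact: F0.
Qed.

Lemma iint_swap m n (f : 'rV[R]_m -> 'rV[R]_n -> \bar R) :
  measurable_row2 f -> (forall x y, 0 <= f x y) ->
  iint (fun x => iint (f x)) = iint (fun y => iint (f ^~ y)).
Proof.
elim: m f => [//|m IH] f mf f0 /=.
transitivity (\int[mu]_t iint (fun y =>
    iint (fun x => f (row_mx (t%:M : 'rV[R]_1) x) y))).
  apply: eq_integral => t _; rewrite IH// => d T X Y mX mY.
  by apply: mf => //; exact: coord_measurable_cons.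
rewrite integral_iint_swap//.
  move=> d T h Y mh mY; apply: measurable_iint => //.
  move=> d' T' h' X mh' mX; apply: mf.
    by apply: coord_measurable_cons => //; exact: (measurableT_comp mh mh').
  exact: (coord_measurable_comp mh' mY).
by move=> t y; exact: iint_ge0.
Qed.

Lemma lebesgue_measureD (c : R) (A : set R) : measurable A ->
  pushforward mu ((+%R^~ c) : _ -> measurableTypeR R) A = mu A.
Proof.
move=> mA; apply/esym; apply: lebesgue_measure_unique => //=.
  exact: measurable_funD.
move=> mD _ [[a b]] _ <-.
rewrite /pushforward (_ : _ @^-1` _ = `](a - c)%R, (b - c)%R]%classic); last first.
  by apply/seteqP; split=> x /=; rewrite !in_itv/= ltrBlDr lerBrDr.
rewrite !lebesgue_measure_itv/= !lte_fin ltrBlDr subrK.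
by case: ifP => // _; rewrite -!EFinD; congr EFin; ring.
Qed.

Lemma ge0_integral_translate (f : R -> \bar R) (c : R) : measurable_fun setT f ->
  (forall t, 0 <= f t) -> \int[mu]_t f (t + c)%R = \int[mu]_t f t.
Proof.
move=> mf f0.
have mc : measurable_fun [set: measurableTypeR R]
  ((+%R^~ c) : measurableTypeR R -> measurableTypeR R).
  exact: measurable_funD.
transitivity (\int[pushforward mu
    ((+%R^~ c) : measurableTypeR R -> measurableTypeR R)]_t f t).
  exact/esym/(ge0_integral_pushforward mc mu).
by apply: eq_measure_integral => A mA _; exact: lebesgue_measureD.
Qed.

Lemma iint_translate n (f : 'rV[R]_n -> \bar R) (v : 'rV[R]_n) :
  measurable_row f -> (forall y, 0 <= f y) ->
  iint (fun y => f (y + v)%R) = iint f.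
Proof.
elim: n f v => [|n IH] f v mf f0 /=; first by rewrite [v]thinmx0 addr0.
rewrite -(hsubmxK (v : 'rV_(1 + n))).
set a := lsubmx _; set b := rsubmx _.
transitivity (\int[mu]_t iint (fun y =>
    f (row_mx ((t + a 0 0)%R%:M : 'rV[R]_1) y))).
  apply: eq_integral => t _.
  rewrite -(IH (fun y => f (row_mx ((t + a 0 0)%R%:M : 'rV[R]_1) y)) b)//.
    congr iint; apply/funext => y; congr f; apply/rowP => i.
    rewrite !mxE; case: (fintype.split (i : 'I_(1 + n))) => j; rewrite !mxE//.
    by rewrite (ord1 j) eqxx !mulr1n.
  exact: measurable_row_slice.
rewrite (ge0_integral_translate
  (f := fun t => iint (fun y => f (row_mx (t%:M : 'rV[R]_1) y))))//.
  exact: measurable_iint_slice.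
by move=> t; exact: iint_ge0.
Qed.

Lemma coord_measurableD d (T : measurableType d) n (X Y : T -> 'rV[R]_n) :
  coord_measurable X -> coord_measurable Y ->
  coord_measurable (fun w => X w + Y w)%R.
Proof.
move=> mX mY i; under eq_fun do rewrite mxE.
exact: measurable_funD.
Qed.

Lemma coord_measurableM d (T : measurableType d) n m (X : T -> 'rV[R]_n)
    (M : 'M[R]_(n, m)) :
  coord_measurable X -> coord_measurable (fun w => X w *m M)%R.
Proof.
move=> mX i; under eq_fun do rewrite mxE.
apply: measurable_sum => j.
by apply: measurable_funM.
Qed.

Lemma measurable_rowM n m (f : 'rV[R]_m -> \bar R) (M : 'M[R]_(n, m)) :
  measurable_row f -> measurable_row (fun y => f (y *m M)%R).
Proof. by move=> mf d T X mX; apply: mf; exact: coord_measurableM. Qed.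

(** Both sides compute the double integral of f(x) g(x + yM): either y is
translated by x M^-1, or x is translated by - yM and then y by - x M^-1.  This is
the classical proof that Haar measures are unique. *)
Lemma iint_mulmx_swap n (f g : 'rV[R]_n -> \bar R) (M : 'M[R]_n) :
  M \in unitmx -> measurable_row f -> measurable_row g ->
  (forall y, 0 <= f y) -> (forall y, 0 <= g y) ->
  iint f * iint (fun y => g (y *m M)%R) =
  iint g * iint (fun y => f (- (y *m M))%R).
Proof.
move=> uM mf mg f0 g0.
have mgM : measurable_row (fun y => g (y *m M)%R) by exact: measurable_rowM.
have mfM : measurable_row (fun y => f (- (y *m M))%R).
  move=> d T X mX; under eq_fun do rewrite -mulmxN.
  exact: (measurable_rowM _ mf).
transitivity (iint (fun x => iint (fun y => f x * g (x + y *m M)%R))).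
  rewrite muleC -ge0_iintZl//; last exact: iint_ge0.
  congr iint; apply/funext => x.
  rewrite ge0_iintZl//.
    rewrite muleC; congr (_ * _).
    rewrite -(iint_translate (x *m invmx M)%R mgM)//.
    congr iint; apply/funext => y; congr g.
    by rewrite mulmxDl -mulmxA mulVmx// mulmx1 addrC.
  move=> d T Y mY; apply: mg.
  by apply: coord_measurableD; [exact: coord_measurable_cst|exact: coord_measurableM].
rewrite iint_swap; last 2 first.
- move=> d T X Y mX mY; apply: emeasurable_funM; first exact: mf.
  by apply: mg; apply: coord_measurableD => //; exact: coord_measurableM.
- by move=> x y; exact: mule_ge0.
transitivity (iint (fun y => iint (fun x => g x * f (x - y *m M)%R))).
  congr iint; apply/funext => y.
  rewrite -(iint_translate (y *m M)%R (f := fun x => g x * f (x - y *m M)%R)).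
  - by congr iint; apply/funext => x; rewrite addrK muleC.
  - move=> d T X mX; apply: emeasurable_funM; first exact: mg.
    by apply: mf; apply: coord_measurableD => //; exact: coord_measurable_cst.
  - by move=> x; exact: mule_ge0.
rewrite iint_swap; last 2 first.
- move=> d T X Y mX mY; apply: emeasurable_funM; first exact: mg.
  apply: mf; under eq_fun do rewrite -mulmxN.
  by apply: coord_measurableD => //; exact: coord_measurableM.
- by move=> x y; exact: mule_ge0.
rewrite muleC -ge0_iintZl//; last exact: iint_ge0.
congr iint; apply/funext => x.
rewrite ge0_iintZl//; last first.
  move=> d T Y mY; apply: mf; under eq_fun do rewrite -mulmxN.
  by apply: coord_measurableD; [exact: coord_measurable_cst|exact: coord_measurableM].
rewrite muleC; congr (_ * _).
rewrite -(iint_translate (- x *m invmx M)%R mfM)//.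
congr iint; apply/funext => y; congr f.
by rewrite mulmxDl -mulmxA mulVmx// mulmx1 opprD opprK addrC.
Qed.

(** The cube is centred, so that it is invariant under negation. *)
Definition unit_cube n : set 'rV[R]_n :=
  [set y | forall i, y 0%R i \in `[- 2^-1, 2^-1]%R].
Arguments unit_cube : clear implicits.

Lemma measurable_row_indic n (A : set 'rV[R]_n) :
  (forall d (T : measurableType d) (X : T -> 'rV[R]_n),
    coord_measurable X -> measurable (X @^-1` A)) ->
  measurable_row (fun y => (\1_A y)%:E).
Proof.
move=> mA d T X mX; apply/measurable_EFinP.
rewrite (_ : (fun w => _) = \1_(X @^-1` A)); last first.
  by apply/funext => w; rewrite /= !indicE.
by apply: measurable_indic; exact: mA.
Qed.

Lemma measurable_row_unit_cube n :
  measurable_row (fun y => (\1_(unit_cube n) y)%:E).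
Proof.
apply: measurable_row_indic => d T X mX.
rewrite (_ : _ @^-1` _ =
    \bigcap_(i in [set: 'I_n]) ((fun w => X w 0%R i) @^-1` [set` `[- 2^-1, 2^-1]%R])).
  apply: fin_bigcap_measurable => // i _.
  by rewrite -[X in measurable X]setTI; exact: mX.
by apply/seteqP; split=> w h i; [move=> _|]; apply: h.
Qed.

Lemma iint_unit_cube n : iint (fun y => (\1_(unit_cube n) y)%:E) = 1.
Proof.
elim: n => [|n IH] /=; first by rewrite indicE mem_set// => -[].
transitivity (\int[mu]_t (\1_[set` `[- 2^-1, 2^-1]%R] t)%:E).
  apply: eq_integral => t _.
  transitivity (iint (fun y => (\1_[set` `[- 2^-1, 2^-1]%R] t)%:E *
      (\1_(unit_cube n) y)%:E)); last first.
    rewrite ge0_iintZl ?IH ?mule1//; first exact: measurable_row_unit_cube.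
  congr iint; apply/funext => y; rewrite -EFinM; congr EFin.
  rewrite !indicE -natrM mulnb; congr (_ %:R)%R; congr nat_of_bool.
  apply/idP/andP; rewrite !inE.
    move=> h; split; rewrite ?inE; first by have := h ord0; rewrite row_cons0.
    by move=> i; have := h (lift ord0 i); rewrite row_consS.
  move=> [ht hy] i.
  by case: (unliftP ord0 i) => [j|] ->; rewrite ?row_consS ?row_cons0.
rewrite integral_indic//= setIT lebesgue_measure_itv/= lte_fin.
rewrite ifT; last by lra.
by rewrite -EFinD; congr EFin; lra.
Qed.

Lemma unit_cubeN n (y : 'rV[R]_n) :
  \1_(unit_cube n) (- y)%R = \1_(unit_cube n) y :> R.
Proof.
rewrite !indicE; congr (_ %:R)%R; congr nat_of_bool.
by apply/idP/idP; rewrite !inE => h i; have := h i; rewrite !mxE !in_itv/=; lra.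
Qed.

(** Linear changes of variables scale all integrals by the same positive constant:
[iint_mulmx_swap] against the indicator of the cube, whose integral is 1.  The
value of the constant never matters for solid angles, which are ratios. *)
Lemma iint_mulmx n (M : 'M[R]_n) : M \in unitmx ->
  exists2 c : R, (0 < c)%R & forall f : 'rV[R]_n -> \bar R,
    measurable_row f -> (forall y, 0 <= f y) ->
    iint (fun y => f (y *m M)%R) = c%:E * iint f.
Proof.
pose g (y : 'rV[R]_n) : \bar R := (\1_(unit_cube n) y)%:E.
have mg : measurable_row g by exact: measurable_row_unit_cube.
have g0 y : 0 <= g y by rewrite lee_fin.
pose c (N : 'M[R]_n) := iint (fun y => g (y *m N)%R).
have c0 N : 0 <= c N by exact: iint_ge0.
have cE N (f : 'rV[R]_n -> \bar R) : N \in unitmx ->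
    measurable_row f -> (forall y, 0 <= f y) ->
    iint (fun y => f (y *m N)%R) = c N * iint f.
  move=> uN mf f0.
  have uN' : (- N)%R \in unitmx by rewrite -scaleN1r unitmxZ// unitrN1.
  have := iint_mulmx_swap uN' mf mg f0 g0.
  rewrite iint_unit_cube mul1e muleC.
  under [in X in X * _ = _ -> _]eq_fun do rewrite /g mulmxN unit_cubeN.
  under [in X in _ = X -> _]eq_fun do rewrite mulmxN opprK.
  by move=> <-.
move=> uM.
have cV : c M * c (invmx M) = 1.
  have uV : invmx M \in unitmx by rewrite unitmx_inv.
  rewrite -(cE M (fun y => g (y *m invmx M)%R))//; last exact: measurable_rowM.
  under eq_fun do rewrite -mulmxA mulmxV// mulmx1.
  exact: iint_unit_cube.
have cf : c M \is a fin_num.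
  rewrite ge0_fin_numE// ltNge; apply/negP; rewrite leye_eq => /eqP cy.
  move: cV; rewrite cy; have := c0 (invmx M).
  rewrite le_eqVlt => /predU1P[<-|lt]; first by rewrite mule0 => -[]/esym/eqP; rewrite oner_eq0.
  by rewrite gt0_mulye.
exists (fine (c M)).
  rewrite lt_neqAle fine_ge0// andbT; apply/eqP => cM0.
  move: cV; rewrite -(fineK cf) -cM0 mul0e => -[]/esym/eqP.
  by rewrite oner_eq0.
by move=> f mf f0; rewrite fineK// cE.
Qed.

End iterated_integral.

(** * Gaussian integrals on the half line *)

Section half_line.
Context {R : realType}.
Local Notation mu := (@lebesgue_measure R).
Implicit Types (q c C r t x y : R).

Lemma derive_continuous (f f' : R -> R) :
  (forall x, is_derive x 1 f (f' x)) -> continuous f.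
Proof.
move=> df x; apply: differentiable_continuous; apply/derivable1_diffP.
by have [] := df x.
Qed.

Lemma derive1_of_is_derive (f : R -> R) x v :
  is_derive x 1 f v -> (f^`())%classic x = v.
Proof. by move=> df; rewrite derive1E; case: df. Qed.

Lemma integrable_EFinZl (D : set R) (f : R -> R) C : measurable D ->
  mu.-integrable D (EFin \o f) ->
  mu.-integrable D (EFin \o (fun t => C * f t)).
Proof.
move=> mD intf; rewrite (_ : _ \o _ = (fun t => (C%:E * (EFin \o f) t)%E)).
  exact: integrableZl.
by apply/funext => t /=; rewrite EFinM.
Qed.

Lemma integral_expRN : (\int[mu]_(t in `[0%R, +oo[) (expR (- t)%R)%:E = 1)%E.
Proof.
have dF t : is_derive t 1 (fun t => - expR (- t)) (expR (- t)).
  by apply: is_derive_eq; rewrite /GRing.scale/=; ring.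
have cF := derive_continuous dF.
have cE : continuous (fun t : R => expR (- t)).
  apply: (@derive_continuous _ (fun t => - expR (- t))) => x.
  by apply: is_derive_eq; rewrite /GRing.scale/=; ring.
rewrite (@ge0_continuous_FTC2y _ _ (fun t => - expR (- t)) 0 0).
- by rewrite !oppr0 expR0 -EFinB sub0r opprK.
- by move=> x _; exact: expR_ge0.
- exact: continuous_subspaceT.
- by rewrite -[X in _ --> X]oppr0; apply: cvgN; exact: cvgr_expR.
- by move=> x _; case: (dF x).
- exact/cvg_at_right_filter/cF.
- by move=> x _; rewrite (derive1_of_is_derive (dF x)).
Qed.

Lemma integrable_expRN : mu.-integrable `[0, +oo[ (EFin \o (fun t => expR (- t))).
Proof.
apply/integrableP; split.
  apply/measurable_EFinP; apply: measurable_funTS.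
  by apply: measurableT_comp => //; exact: measurable_oppr.
under eq_integral do rewrite /= ger0_norm ?expR_ge0//.
by rewrite integral_expRN ltry.
Qed.

Lemma integrable_expRN_dominated (g : R -> R) C :
  measurable_fun setT g -> (forall t, 0 <= t -> `|g t| <= C * expR (- t)) ->
  mu.-integrable `[0, +oo[ (EFin \o g).
Proof.
move=> mg gC; apply: (@le_integrable _ _ _ mu _ _ _
  (EFin \o (fun t => C * expR (- t)))) => //.
- by apply/measurable_EFinP; exact: measurable_funTS.
- move=> t /=; rewrite in_itv/= andbT => t0.
  by rewrite lee_fin (le_trans (gC _ t0))// ler_norm.
- by apply: integrable_EFinZl => //; exact: integrable_expRN.
Qed.

(** Adding C exp (- t) to g makes the integrand nonnegative, where the fundamental
theorem on the half line applies. *)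
Lemma Rintegral_derive_dominated (g G : R -> R) C : continuous g ->
  (forall t, is_derive t 1 G (g t)) ->
  (forall t, 0 <= t -> `|g t| <= C * expR (- t)) ->
  (forall t, 0 <= t -> `|G t| <= C * expR (- t)) ->
  \int[mu]_(t in `[0, +oo[) g t = - G 0.
Proof.
move=> cg dG gC GC.
have mg : measurable_fun setT g by exact: continuous_measurable_fun.
have ig := integrable_expRN_dominated mg gC.
have iC : mu.-integrable `[0, +oo[ (EFin \o (fun t => C * expR (- t))).
  by apply: integrable_EFinZl => //; exact: integrable_expRN.
have IC : \int[mu]_(t in `[0, +oo[) (C * expR (- t)) = C.
  rewrite RintegralZl//; last exact: integrable_expRN.
  by rewrite /Rintegral integral_expRN mulr1.
have dF t : is_derive t 1 (fun t => G t - C * expR (- t)) (g t + C * expR (- t)).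
  by apply: is_derive_eq; rewrite /GRing.scale/=; ring.
have cF := derive_continuous dF.
have cE : continuous (fun t : R => C * expR (- t)).
  apply: (@derive_continuous _ (fun t => - (C * expR (- t)))) => x.
  by apply: is_derive_eq; rewrite /GRing.scale/=; ring.
have cvC : (C * expR (- t)) @[t --> +oo] --> 0.
  rewrite -[X in _ --> X](mulr0 C); apply: cvgM; first exact: cvg_cst.
  exact: cvgr_expR.
have := @Rintegral_ge0_continuous_FTC2y _ (fun t => g t + C * expR (- t))
  (fun t => G t - C * expR (- t)) 0 0.
rewrite RintegralD// IC oppr0 expR0 mulr1 => H.
suff : \int[mu]_(t in `[0, +oo[) g t + C = 0 - (G 0 - C) by lra.
apply: H.
- by move=> t /gC; rewrite ler_norml => /andP[]; lra.
- apply: continuous_subspaceT => x; apply: cvgD; [exact: cg|exact: cE].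
- rewrite -[X in _ --> X](subr0 0); apply: cvgB => //.
  apply: norm_cvg0.
  apply: (@squeeze_cvgr _ _ _ _ (cst 0) (fun t => C * expR (- t))) => //.
    near=> t; rewrite normr_ge0/=; apply: GC.
    by near: t; exact: nbhs_pinfty_ge.
  exact: cvg_cst.
- by move=> x _; case: (dF x).
- have /cvg_at_right_filter := cF 0.
  by rewrite /= oppr0 expR0 mulr1.
- by move=> x _; rewrite (derive1_of_is_derive (dF x)).
Unshelve. all: end_near. Qed.

End half_line.

Section reflection.
Context {R : realType}.
Local Notation mu := (@lebesgue_measure R).

Lemma integral_itvNy0 (f : R -> \bar R) : measurable_fun setT f ->
  (\int[mu]_(t in `]-oo, 0%R]) f (- t)%R = \int[mu]_(t in `[0%R, +oo[) f t)%E.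
Proof.
move=> mf; rewrite integralE [RHS]integralE; congr (_ - _)%E.
  rewrite (ge0_integration_by_substitution0 (f := (f^\+)%E))//.
    by apply: eq_integral => t _; rewrite !funeposE.
  exact: measurable_funepos.
rewrite (ge0_integration_by_substitution0 (f := (f^\-)%E))//.
  by apply: eq_integral => t _; rewrite !funenegE.
exact: measurable_funeneg.
Qed.

Lemma integrable_itvNy0 (f : R -> R) : measurable_fun setT f ->
  mu.-integrable `[0, +oo[ (EFin \o (fun t => f (- t))) ->
  mu.-integrable `]-oo, 0] (EFin \o f).
Proof.
move=> mf /integrableP[_ i1]; apply/integrableP; split.
  by apply/measurable_EFinP; exact: measurable_funTS.
move: i1; rewrite -integral_itvNy0/=; last first.
  apply/measurable_EFinP; apply: (measurableT_comp (@normr_measurable R setT)).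
  exact: (measurableT_comp mf (oppr_measurable (D := setT))).
by under eq_integral do rewrite opprK.
Qed.

Lemma Rintegral_split0 (f : R -> R) : measurable_fun setT f ->
  mu.-integrable `[0, +oo[ (EFin \o f) ->
  mu.-integrable `[0, +oo[ (EFin \o (fun t => f (- t))) ->
  mu.-integrable setT (EFin \o f) /\
  \int[mu]_t f t = \int[mu]_(t in `[0, +oo[) f t +
                   \int[mu]_(t in `[0, +oo[) f (- t).
Proof.
move=> mf i1 i2.
have i2' := integrable_itvNy0 mf i2.
have i1' : mu.-integrable `]0, +oo[ (EFin \o f).
  by apply: integrableS i1 => // x /=; rewrite !in_itv/= !andbT => /ltW.
have setTE : [set: R] = `]-oo, 0]%classic `|` `]0, +oo[%classic.
  by apply/seteqP; split=> x //= _; rewrite !in_itv/= andbT; case: (leP x 0); [left|right].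
have dsj : [disjoint `]-oo, 0]%classic & `]0, +oo[%classic :> set R].
  rewrite disj_set2E; apply/eqP; rewrite -subset0 => x []/=.
  by rewrite !in_itv/= andbT leNgt => /negP.
have iT : mu.-integrable setT (EFin \o f).
  rewrite setTE; apply/integrableP; split.
    by apply/measurable_EFinP; exact: measurable_funTS.
  rewrite ge0_integral_setU//=.
  - move/integrableP : i2' => [_ h1]; move/integrableP : i1' => [_ h2].
    by rewrite lte_add_pinfty.
  - by apply/measurable_EFinP; apply: measurableT_comp => //; exact: measurable_funTS.
split => //.
rewrite {1}setTE Rintegral_setU//; last by rewrite -setTE.
rewrite addrC Rintegral_itv_obnd_cbnd//; congr (_ + _).
rewrite [RHS]/Rintegral -(integral_itvNy0 (f := EFin \o (fun t => f (- t))))/=.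
  by rewrite /Rintegral; under [in RHS]eq_integral do rewrite opprK.
by apply/measurable_EFinP; exact: measurableT_comp.
Qed.

End reflection.

Section half_gauss.
Context {R : realType}.
Local Notation mu := (@lebesgue_measure R).

Implicit Types (q r t y : R).

Definition gauss (q t : R) := expR (- (q * t ^+ 2) / 2).

Lemma is_derive_gauss q t : is_derive t 1 (gauss q) (- (q * t) * gauss q t).
Proof.
rewrite /gauss; apply: is_derive_eq.
by rewrite /GRing.scale/=; field.
Qed.

Lemma gauss_ge0 q t : 0 <= gauss q t. Proof. exact: expR_ge0. Qed.

Lemma gaussN q t : gauss q (- t) = gauss q t.
Proof. by rewrite /gauss sqrrN. Qed.

Lemma continuous_gauss q : continuous (gauss q).
Proof. exact: derive_continuous (is_derive_gauss q). Qed.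

Lemma is_derive_gaussM (h h1 : R -> R) q y t :
  (forall x : R, is_derive x 1 h (h1 x)) ->
  is_derive t 1 (fun t => gauss q t * h (t * y))
    (gauss q t * (y * h1 (t * y)) - q * t * gauss q t * h (t * y)).
Proof.
move=> dh; have dg := is_derive_gauss q t.
have dhy : is_derive t 1 (fun t => h (t * y)) (y * h1 (t * y)).
  by apply: is_derive_eq; rewrite /GRing.scale/=; ring.
apply: (is_derive_eq (is_deriveM dg dhy)); rewrite /GRing.scale/=.
by move: (gauss q t) (h _) (h1 _) => u v w; ring.
Qed.

(** The bound comes from completing a square:
(r + 2) t - q t^2 / 2 <= (r + 2)^2 / (2 q). *)
Lemma gauss_dominated (q r : R) : 0 < q -> 0 <= r -> exists2 C, 0 <= C &
  forall s t : R, 0 <= t -> `|s| <= r * t ->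
    (1 + t) * gauss q t * expR `|s| <= C * expR (- t).
Proof.
move=> q0 r0; exists (expR ((r + 2) ^+ 2 / (2 * q))); first exact: expR_ge0.
move=> s t t0 sr; rewrite -expRD.
apply: (@le_trans _ _ (expR t * gauss q t * expR `|s|)).
  rewrite ler_wpM2r ?expR_ge0// ler_wpM2r ?gauss_ge0//.
  exact: expR_ge1Dx.
rewrite -!expRD ler_expR -subr_ge0.
have -> : (r + 2) ^+ 2 / (2 * q) - t - (t + - (q * t ^+ 2) / 2 + `|s|) =
  (r + 2 - q * t) ^+ 2 / (2 * q) + (r * t - `|s|).
  by field; rewrite gt_eqF.
by rewrite addr_ge0 ?subr_ge0// divr_ge0 ?sqr_ge0// mulr_ge0// ltW.
Qed.

(** The solutions of E'' = c E with at most exponential growth: exp for c = 1, the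
trigonometric functions for c = -1.  One argument thus serves Phi on the real and
on the imaginary axis. *)
Context (c : R) (E E1 : R -> R).
Hypothesis dE : forall x : R, is_derive x 1 E (E1 x).
Hypothesis dE1 : forall x : R, is_derive x 1 E1 (c * E x).
Context (K : R).
Hypothesis EK : forall x, `|E x| <= K * expR `|x|.
Hypothesis E1K : forall x, `|E1 x| <= K * expR `|x|.

Definition half_gauss (q y : R) :=
  \int[mu]_(t in `[0, +oo[) (gauss q t * E (t * y)).

Let K0 : 0 <= K.
Proof.
by have := EK 0; rewrite normr0 expR0 mulr1; apply: le_trans.
Qed.

Let cE : continuous E := derive_continuous dE.
Let cE1 : continuous E1 := derive_continuous dE1.

Let contM (f : R -> R) (y : R) : continuous f -> continuous (fun t => f (t * y)).
Proof.
move=> cf t; apply: (@continuous_comp _ _ _ (fun t => t * y) f).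
  by apply: cvgM; [exact: cvg_id|exact: cvg_cst].
exact: cf.
Qed.

(** Differentiation under the integral sign brings down a factor t, and
t exp (- q t^2 / 2) is an exact derivative; integrating by parts with
E'' = c E turns the derivative into a first-order linear equation. *)
Lemma is_derive_half_gauss q y : 0 < q ->
  is_derive y 1 (half_gauss q) ((E1 0 + c * y * half_gauss q y) / q).
Proof.
move=> q0.
have [C C0 HC] := gauss_dominated q0 (addr_ge0 (normr_ge0 y) ler01).
pose f (y t : R) := gauss q t * E (t * y).
have df (z t : R) : is_derive z 1 (f ^~ t) (gauss q t * (t * E1 (t * z))).
  rewrite /f; apply: is_derive_eq.
  by rewrite /GRing.scale/=; ring.
have sb (z t : R) : y - 1 < z < y + 1 -> 0 <= t -> `|t * z| <= (`|y| + 1) * t.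
  move=> zy t0; rewrite normrM (ger0_norm t0) mulrC ler_wpM2r//.
  rewrite ler_norml; have := ler_norm y; have := ler_norm (- y).
  rewrite normrN; lra.
have bE (z t : R) : y - 1 < z < y + 1 -> 0 <= t ->
    `|f z t| <= K * C * expR (- t).
  move=> zy t0; rewrite normrM (ger0_norm (gauss_ge0 _ _)).
  have := HC _ _ t0 (sb _ _ zy t0).
  move=> /(ler_wpM2l K0); rewrite -(mulrA K C); apply: le_trans.
  apply: (@le_trans _ _ (gauss q t * (K * expR `|t * z|))).
    by rewrite ler_wpM2l ?gauss_ge0.
  rewrite -subr_ge0.
  have -> : K * ((1 + t) * gauss q t * expR `|t * z|) -
    gauss q t * (K * expR `|t * z|) = K * gauss q t * expR `|t * z| * t by ring.
  exact: (mulr_ge0 (mulr_ge0 (mulr_ge0 K0 (gauss_ge0 _ _)) (expR_ge0 _)) t0).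
have bE1 (z t : R) : y - 1 < z < y + 1 -> 0 <= t ->
    `|gauss q t * (t * E1 (t * z))| <= K * C * expR (- t).
  move=> zy t0; rewrite !normrM (ger0_norm (gauss_ge0 _ _)) (ger0_norm t0).
  have := HC _ _ t0 (sb _ _ zy t0).
  move=> /(ler_wpM2l K0); rewrite -(mulrA K C); apply: le_trans.
  apply: (@le_trans _ _ (gauss q t * (t * (K * expR `|t * z|)))).
    by rewrite ler_wpM2l ?gauss_ge0// ler_wpM2l.
  rewrite -subr_ge0.
  have -> : K * ((1 + t) * gauss q t * expR `|t * z|) -
    gauss q t * (t * (K * expR `|t * z|)) = K * gauss q t * expR `|t * z| by ring.
  exact: (mulr_ge0 (mulr_ge0 K0 (gauss_ge0 _ _)) (expR_ge0 _)).
have yy : y - 1 < y < y + 1 by lra.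
have mf z : measurable_fun setT (f z).
  apply: continuous_measurable_fun => t.
  by apply: cvgM; [exact: continuous_gauss|exact: contM].
have intf z : `]y - 1, y + 1[%classic z ->
    mu.-integrable `[0, +oo[ (EFin \o f z).
  rewrite /= in_itv/= => zy.
  by apply: (integrable_expRN_dominated (mf z)) => t t0; exact: bE.
have derf z t : `]y - 1, y + 1[%classic z -> `[0, +oo[%classic t ->
    derivable (f ^~ t) z 1 by move=> _ _; case: (df z t).
have mI : measurable (`[0, +oo[ : set R) by exact: measurable_itv.
have Iy : `]y - 1, y + 1[%classic y by rewrite /= in_itv.
have G0 t : 0 <= K * C * expR (- t) by rewrite !mulr_ge0// expR_ge0.
have iG : mu.-integrable `[0, +oo[ (EFin \o (fun t => K * C * expR (- t))).
  by apply: integrable_EFinZl => //; exact: integrable_expRN.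
have pf z t : partial1of2 f z t = gauss q t * (t * E1 (t * z)).
  by rewrite partial1of2E; case: (df z t).
have Gub z t : `]y - 1, y + 1[%classic z -> `[0, +oo[%classic t ->
    `|partial1of2 f z t| <= K * C * expR (- t).
  rewrite /= !in_itv/= andbT pf => zy t0; exact: bE1.
have D1 := @derivable_under_integral R _ _ mu f _ mI y (y - 1) (y + 1) Iy
  intf derf (fun t => K * C * expR (- t)) G0 iG Gub.
have D2 := @differentiation_under_integral R _ _ mu f _ mI y (y - 1) (y + 1) Iy
  intf derf (fun t => K * C * expR (- t)) G0 iG Gub.
apply: DeriveDef; first exact: D1.
rewrite -derive1E [LHS]D2.
under eq_Rintegral do rewrite pf.
(* the exact derivative in the integration by parts; its primitive is dg below *)
pose g (t : R) := t * gauss q t * E1 (t * y) - c * y / q * f y t.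
have ig1 : mu.-integrable `[0, +oo[ (EFin \o (fun t => gauss q t * (t * E1 (t * y)))).
  apply: (@integrable_expRN_dominated _ _ (K * C)); last first.
    by move=> t t0; exact: bE1.
  apply: continuous_measurable_fun => t.
  apply: cvgM; first exact: continuous_gauss.
  by apply: cvgM; [exact: cvg_id|exact: contM].
have -> : \int[mu]_(t in `[0, +oo[) (gauss q t * (t * E1 (t * y))) =
    \int[mu]_(t in `[0, +oo[) g t + c * y / q * half_gauss q y.
  rewrite /half_gauss -RintegralZl//; last exact: intf.
  rewrite -RintegralD//.
  - by apply: eq_Rintegral => t _; rewrite /g /f; ring.
  - have -> : EFin \o g = (fun t => ((gauss q t * (t * E1 (t * y)))%:E -
        (c * y / q * f y t)%:E)%E).
      by apply/funext => t; rewrite -EFinB /=; congr EFin; rewrite /g; ring.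
    apply: integrableB => //.
    by apply: integrable_EFinZl => //; exact: intf.
  - by apply: integrable_EFinZl => //; exact: intf.
have dg (t : R) :
    is_derive t 1 (fun t => - q^-1 * (gauss q t * E1 (t * y))) (g t).
  have dgE := is_derive_gaussM q y t dE1.
  apply: (is_derive_eq (is_deriveZ (- q^-1) dgE)); rewrite /g /f /GRing.scale/=.
  move: (gauss q t) (E (t * y)) (E1 (t * y)) => u v w; field.
  by rewrite gt_eqF.
rewrite (@Rintegral_derive_dominated _ g _
  (Num.max (K * C / q) (K * C + `|c * y / q| * (K * C))) _ dg).
- by rewrite mul0r /gauss expr0n/= mulr0 oppr0 mul0r expR0; field; rewrite gt_eqF.
- move=> t; apply: cvgB.
    apply: cvgM; last exact: contM.
    by apply: cvgM; [exact: cvg_id|exact: continuous_gauss].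
  apply: cvgM; first exact: cvg_cst.
  by apply: cvgM; [exact: continuous_gauss|exact: contM].
- move=> t t0; rewrite /g; apply: (le_trans (ler_normB _ _)).
  apply: (@le_trans _ _ ((K * C + `|c * y / q| * (K * C)) * expR (- t))); last first.
    by rewrite ler_wpM2r ?expR_ge0// le_max lexx orbT.
  rewrite mulrDl lerD//.
    have := bE1 _ _ yy t0.
    by rewrite [_ * (t * _)]mulrCA mulrA.
  rewrite (normrM (c * y / q)) -(mulrA _ (K * C)).
  exact: (ler_wpM2l (normr_ge0 _) (bE _ _ yy t0)).
- move=> t t0; apply: (@le_trans _ _ (K * C / q * expR (- t))); last first.
    by rewrite ler_wpM2r ?expR_ge0// le_max lexx.
  rewrite normrM normrN normfV (gtr0_norm q0) mulrC.
  rewrite mulrAC ler_wpM2r ?invr_ge0 ?(ltW q0)//.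
  rewrite normrM (ger0_norm (gauss_ge0 _ _)).
  have := HC _ _ t0 (sb _ _ yy t0).
  move=> /(ler_wpM2l K0); rewrite -(mulrA K C); apply: le_trans.
  apply: (@le_trans _ _ (gauss q t * (K * expR `|t * y|))).
    by rewrite ler_wpM2l ?gauss_ge0.
  rewrite -subr_ge0.
  have -> : K * ((1 + t) * gauss q t * expR `|t * y|) -
    gauss q t * (K * expR `|t * y|) = K * gauss q t * expR `|t * y| * t by ring.
  exact: (mulr_ge0 (mulr_ge0 (mulr_ge0 K0 (gauss_ge0 _ _)) (expR_ge0 _)) t0).
Qed.

Lemma integrable_half_gauss q y : 0 < q ->
  mu.-integrable `[0, +oo[ (EFin \o (fun t => gauss q t * E (t * y))).
Proof.
move=> q0; have [C C0 HC] := gauss_dominated q0 (normr_ge0 y).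
apply: (@integrable_expRN_dominated _ _ (K * C)).
  apply: continuous_measurable_fun => t.
  by apply: cvgM; [exact: continuous_gauss|exact: contM].
move=> t t0; rewrite normrM (ger0_norm (gauss_ge0 _ _)).
have /(_ t (t * y) t0) := fun t => HC ^~ t.
rewrite normrM (ger0_norm t0) mulrC lexx => /(_ isT).
move=> /(ler_wpM2l K0); rewrite -(mulrA K C); apply: le_trans.
apply: (@le_trans _ _ (gauss q t * (K * expR (t * `|y|)))).
  rewrite ler_wpM2l ?gauss_ge0//; have := EK (t * y).
  by rewrite normrM (ger0_norm t0).
rewrite (mulrC `|y|) -subr_ge0.
set e := expR _; set g := gauss _ _.
have -> : K * ((1 + t) * g * e) - g * (K * e) = K * g * e * t by ring.
exact: (mulr_ge0 (mulr_ge0 (mulr_ge0 K0 (gauss_ge0 _ _)) (expR_ge0 _)) t0).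
Qed.

Lemma integral_gauss q : 0 < q ->
  (\int[mu]_t (gauss q t)%:E = (Num.sqrt (2 * pi / q))%:E)%E.
Proof.
move=> q0; have s0 : (Num.sqrt q)^-1 != 0.
  by rewrite invr_eq0 gt_eqF// sqrtr_gt0.
have := integral_normal_pdf 0 (Num.sqrt q)^-1.
rewrite normal_pdfE//.
have -> : (fun x => ((fun x => normal_peak (Num.sqrt q)^-1 *
    normal_fun 0 (Num.sqrt q)^-1 x) x)%:E) =
  (fun x => ((Num.sqrt (2 * pi / q))^-1%:E * (gauss q x)%:E)%E).
  apply/funext => x; rewrite -EFinM; congr (_ * _)%:E.
    rewrite /normal_peak exprVn sqr_sqrtr ?(ltW q0)//; congr (Num.sqrt _)^-1.
    by rewrite -mulr_natl; ring.
  rewrite /normal_fun /gauss exprVn sqr_sqrtr ?(ltW q0)// subr0; congr expR.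
  by rewrite -mulr_natl; field; rewrite gt_eqF.
have r0 : 0 < Num.sqrt (2 * pi / q).
  by rewrite sqrtr_gt0 divr_gt0// mulr_gt0// pi_gt0.
rewrite ge0_integralZl//; last 2 first.
- apply/measurable_EFinP; apply: continuous_measurable_fun.
  exact: continuous_gauss.
- by move=> x _; rewrite lee_fin gauss_ge0.
move=> /(congr1 (fun z => (Num.sqrt (2 * pi / q))%:E * z)%E).
by rewrite muleA -EFinM mulfV ?gt_eqF// mul1e mule1.
Qed.

Lemma half_gauss_at0 q : 0 < q ->
  half_gauss q 0 = E 0 * (Num.sqrt (2 * pi / q) / 2).
Proof.
move=> q0; rewrite /half_gauss; under eq_Rintegral do rewrite mulr0 mulrC.
have H : (\int[mu]_(t in `[0%R, +oo[) (gauss q t)%:E =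
    (Num.sqrt (2 * pi / q) / 2)%:E)%E.
  have := integral_gauss q0.
  rewrite ge0_symfun_integralT; last 3 first.
  - by move=> x; exact: gauss_ge0.
  - exact: continuous_gauss.
  - by move=> x /=; rewrite gaussN.
  rewrite -set_itvcy => H.
  rewrite mulrC EFinM -H muleA -EFinM mulVf// mul1e.
  by [].
rewrite RintegralZl//; first by rewrite /Rintegral H.
apply/integrableP; split.
  apply/measurable_EFinP; apply: measurable_funTS.
  by apply: continuous_measurable_fun; exact: continuous_gauss.
by under eq_integral do rewrite /= ger0_norm ?gauss_ge0//; rewrite H ltry.
Qed.

(** The integrating factor of the equation of [is_derive_half_gauss]. *)
Lemma is_derive_gauss_half_gauss q y : 0 < q ->
  is_derive y 1 (fun y => expR (- (c * y ^+ 2) / (2 * q)) * half_gauss q y)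
    (E1 0 * expR (- (c * y ^+ 2) / (2 * q)) / q).
Proof.
move=> q0; have dA := is_derive_half_gauss y q0.
have dX : is_derive y 1 (fun y => expR (- (c * y ^+ 2) / (2 * q)))
    (- (c * y) / q * expR (- (c * y ^+ 2) / (2 * q))).
  apply: is_derive_eq; rewrite /GRing.scale/=; set e := expR _; field.
  by rewrite gt_eqF.
apply: (is_derive_eq (is_deriveM dX dA)); rewrite /GRing.scale/=.
by move: (expR _) (half_gauss q y) => u v; field; rewrite gt_eqF.
Qed.

(** In the sum over y and - y the inhomogeneous terms E'(0) / q cancel, so the sum
times the integrating factor is constant. *)
Lemma half_gauss_sum q y : 0 < q ->
  half_gauss q y + half_gauss q (- y) =
  E 0 * Num.sqrt (2 * pi / q) * expR (c * y ^+ 2 / (2 * q)).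
Proof.
move=> q0.
pose V y := expR (- (c * y ^+ 2) / (2 * q)) * half_gauss q y.
have dV z := is_derive_gauss_half_gauss z q0.
rewrite -/V in dV.
have dW (z : R) : is_derive z 1 (fun z => V z + V (- z)) 0.
  have dVN : is_derive z 1 (fun z => V (- z))
      (- (E1 0 * expR (- (c * z ^+ 2) / (2 * q)) / q)).
    have := @is_derive1_comp _ V -%R z _ _ (dV (- z)).
    move=> /(_ (- 1)); rewrite sqrrN mulrN1; apply.
  by apply: (is_derive_eq (is_deriveD (dV z) dVN)); rewrite subrr.
have := is_derive_0_is_cst y 0 dW; rewrite /V sqrrN -mulrDr oppr0.
rewrite expr0n/= mulr0 oppr0 mul0r expR0 !mul1r half_gauss_at0// => H.
have e0 : expR (- (c * y ^+ 2) / (2 * q)) != 0 by rewrite gt_eqF ?expR_gt0.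
apply: (mulfI e0); rewrite H [RHS]mulrCA -expRD.
rewrite -[X in expR X]mulrDl addNr mul0r expR0 mulr1; field.
by [].
Qed.

Lemma integral_gauss_full q y : 0 < q ->
  mu.-integrable setT (EFin \o (fun t => gauss q t * E (t * y))) /\
  \int[mu]_t (gauss q t * E (t * y)) =
    E 0 * Num.sqrt (2 * pi / q) * expR (c * y ^+ 2 / (2 * q)).
Proof.
move=> q0.
have [|||i ->] := @Rintegral_split0 _ (fun t => gauss q t * E (t * y)).
- apply: continuous_measurable_fun => t.
  by apply: cvgM; [exact: continuous_gauss|exact: contM].
- exact: integrable_half_gauss.
- rewrite (_ : (fun t => _) = (fun t => gauss q t * E (t * - y))).
    exact: integrable_half_gauss.
  by apply/funext => t; rewrite gaussN mulNr mulrN.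
split=> //; rewrite -half_gauss_sum//; congr (_ + _).
by apply: eq_Rintegral => t _; rewrite gaussN mulNr mulrN.
Qed.

(** [is_derive_gauss_half_gauss] integrated along the segment from 0 to y, the path
used in the definition of [Phi]. *)
Lemma half_gauss_primitive y :
  expR (- (c * y ^+ 2) / 2) * half_gauss 1 y =
  E 0 * (Num.sqrt (2 * pi) / 2) +
  E1 0 * \int[mu]_(t in `[0, 1]) (y * expR (- (c * (t * y) ^+ 2) / 2)).
Proof.
pose V y := expR (- (c * y ^+ 2) / (2 * 1)) * half_gauss 1 y.
have dV z := is_derive_gauss_half_gauss z ltr01.
rewrite -/V in dV.
pose f t := E1 0 * (y * expR (- (c * (t * y) ^+ 2) / 2)).
have dVy (t : R) : is_derive t 1 (fun t => V (t * y)) (f t).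
  have := @is_derive1_comp _ V ( *%R^~ y) t _ _ (dV (t * y)).
  have dm : is_derive t 1 ( *%R^~ y) y.
    by apply: is_derive_eq; rewrite /GRing.scale/= mulr0 mulr1 add0r.
  move=> /(_ y dm) H; apply: (is_derive_eq H).
  by rewrite /f divr1 mulr1; ring.
have ce : continuous (fun t : R => y * expR (- (c * (t * y) ^+ 2) / 2)).
  have dx (x : R) : is_derive x 1 (fun t : R => y * expR (- (c * (t * y) ^+ 2) / 2))
      (y * (expR (- (c * (x * y) ^+ 2) / 2) * (- (c * x * y ^+ 2)))).
    apply: is_derive_eq; rewrite /GRing.scale/=.
    by move: (expR _) => u; field.
  exact: derive_continuous dx.
have cf : continuous f.
  by move=> t; apply: cvgM; [exact: cvg_cst|exact: ce].
have cV := derive_continuous dVy.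
have := @continuous_FTC2 _ f (fun t => V (t * y)) 0 1 ltr01.
have i01 (h : R -> R) : continuous h -> mu.-integrable `[0, 1] (EFin \o h).
  move=> ch; apply: continuous_compact_integrable; first exact: segment_compact.
  exact: continuous_subspaceT.
move=> /(_ (continuous_subspaceT cf)) H.
have {H} : (\int[mu]_(x in `[0%R, 1%R]) (f x)%:E =
    (V (1 * y)%R)%:E - (V (0 * y)%R)%:E)%E.
  apply: H.
  - split.
    + by move=> x _; case: (dVy x).
    + exact/cvg_at_right_filter/cV.
    + exact/cvg_at_left_filter/cV.
  - by move=> x _; rewrite (derive1_of_is_derive (dVy x)).
move=> /(congr1 fine)/=.
rewrite -/(Rintegral _ _ _) RintegralZl//; last exact: i01.
rewrite mul1r mul0r /V expr0n/= !mulr0 oppr0 mul0r expR0 mul1r half_gauss_at0//.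
by rewrite mulr1 divr1 => ->; ring.
Qed.

End half_gauss.

(** * Laplace and Fourier transforms of the Gaussian weights *)

Section weights.
Context {R : realType}.
Local Notation mu := (@lebesgue_measure R).
Implicit Types (t x y q : R) (b : bool).

(** The real part of (u + i v) exp (i x). *)
Definition trig (u v x : R) : R := u * cos x - v * sin x.

Lemma is_derive_trig u v x : is_derive x 1 (trig u v) (trig (- v) u x).
Proof.
by rewrite /trig; apply: is_derive_eq; rewrite /GRing.scale/=; ring.
Qed.

Lemma is_derive_trig1 u v x :
  is_derive x 1 (trig (- v) u) (-1 * trig u v x).
Proof.
by apply: (is_derive_eq (is_derive_trig _ _ _)); rewrite /trig; ring.
Qed.

Lemma expR_normr_ge1 x : 1 <= expR `|x|.
Proof. by rewrite -expR0 ler_expR. Qed.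

Lemma norm_cos_le1 x : `|cos x| <= 1.
Proof. by rewrite ler_norml cos_geN1 cos_le1. Qed.

Lemma norm_sin_le1 x : `|sin x| <= 1.
Proof. by rewrite ler_norml sin_geN1 sin_le1. Qed.

Lemma norm_trig u v x : `|trig u v x| <= (`|u| + `|v|) * expR `|x|.
Proof.
apply: (@le_trans _ _ (`|u| + `|v|)); last first.
  by rewrite ler_peMr ?addr_ge0 ?expR_normr_ge1.
apply: (le_trans (ler_normB _ _)).
by rewrite !normrM lerD// ler_piMr// ?norm_cos_le1 ?norm_sin_le1.
Qed.

Lemma norm_trig1 u v x : `|trig (- v) u x| <= (`|u| + `|v|) * expR `|x|.
Proof. by have := norm_trig (- v) u x; rewrite normrN addrC. Qed.

Lemma is_derive_expR1 x : is_derive x 1 (@expR R) (1 * expR x).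
Proof. by rewrite mul1r; exact: is_derive_expR. Qed.

Lemma norm_expR_le x : `|expR x| <= 1 * expR `|x|.
Proof. by rewrite mul1r ger0_norm ?expR_ge0// ler_expR ler_norm. Qed.

Definition isqrt2pi : R := (Num.sqrt (2 * pi))^-1.

Lemma isqrt2pi_gt0 : 0 < isqrt2pi.
Proof. by rewrite invr_gt0 sqrtr_gt0 mulr_gt0// pi_gt0. Qed.

Lemma isqrt2pi_ge0 : 0 <= isqrt2pi. Proof. exact: ltW isqrt2pi_gt0. Qed.

Lemma isqrt2piK : isqrt2pi * Num.sqrt (2 * pi) = 1.
Proof. by rewrite mulVf// gt_eqF// sqrtr_gt0 mulr_gt0// pi_gt0. Qed.

(** The range of a coordinate: [true] for a constrained one, [false] for a free
one. *)
Definition wdom b : set R := if b then `[0, +oo[%classic else setT.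

Definition weight b t : R := \1_(wdom b) t * (isqrt2pi * gauss 1 t).

Lemma measurable_wdom b : measurable (wdom b).
Proof. by case: b; [exact: measurable_itv|exact: measurableT]. Qed.

Lemma weight_ge0 b t : 0 <= weight b t.
Proof. by rewrite !mulr_ge0 ?isqrt2pi_ge0 ?gauss_ge0 ?ler0n. Qed.

Lemma measurable_gauss q : measurable_fun setT (@gauss R q).
Proof. by apply: continuous_measurable_fun; exact: continuous_gauss. Qed.

Lemma measurable_weight b : measurable_fun setT (weight b).
Proof.
apply: measurable_funM; first exact: measurable_indic (measurable_wdom b).
by apply: measurable_funM => //; exact: measurable_gauss.
Qed.

Section weight_integral.
Context (c : R) (E E1 : R -> R).
Hypothesis dE : forall x : R, is_derive x 1 E (E1 x).
Hypothesis dE1 : forall x : R, is_derive x 1 E1 (c * E x).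
Context (K : R).
Hypothesis EK : forall x, `|E x| <= K * expR `|x|.
Hypothesis E1K : forall x, `|E1 x| <= K * expR `|x|.

Let weightE b y (t : R) : weight b t * E (t * y) =
  isqrt2pi * ((fun t => gauss 1 t * E (t * y)) \_ (wdom b)) t.
Proof.
rewrite /weight patchE indicE; case: ifP => _; first by rewrite mul1r mulrA.
by rewrite !mul0r mulr0.
Qed.

Lemma integrable_weight b y :
  mu.-integrable setT (EFin \o (fun t => weight b t * E (t * y))).
Proof.
have [i _] := integral_gauss_full dE dE1 EK E1K y (@ltr01 R).
under eq_fun do rewrite /= weightE.
apply: integrable_EFinZl => //.
rewrite -restrict_EFin; apply/integrable_restrict => //; first exact: measurable_wdom.
by rewrite setTI; apply: integrableS i => //; exact: measurable_wdom.
Qed.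

Lemma Rintegral_weight b y :
  \int[mu]_t (weight b t * E (t * y)) =
  isqrt2pi * \int[mu]_(t in wdom b) (gauss 1 t * E (t * y)).
Proof.
have [i _] := integral_gauss_full dE dE1 EK E1K y (@ltr01 R).
under eq_Rintegral do rewrite weightE.
rewrite RintegralZl//.
  by rewrite [in RHS]Rintegral_mkcond.
rewrite -restrict_EFin; apply/integrable_restrict => //; first exact: measurable_wdom.
by rewrite setTI; apply: integrableS i => //; exact: measurable_wdom.
Qed.

Lemma Rintegral_weight_true y :
  \int[mu]_t (weight true t * E (t * y)) = isqrt2pi * half_gauss E 1 y.
Proof. exact: Rintegral_weight. Qed.

Lemma Rintegral_weight_false y :
  \int[mu]_t (weight false t * E (t * y)) = E 0 * expR (c * y ^+ 2 / 2).
Proof.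
rewrite Rintegral_weight.
have [_ ->] := integral_gauss_full dE dE1 EK E1K y (@ltr01 R).
rewrite divr1 mulr1 -[RHS]mul1r; have := isqrt2piK.
by move: isqrt2pi (Num.sqrt _) (expR _) (E 0) => i s e e0 <-; ring.
Qed.

Lemma Rintegral_weight_primitive y :
  expR (- (c * y ^+ 2) / 2) * \int[mu]_t (weight true t * E (t * y)) =
  E 0 / 2 + isqrt2pi * (E1 0 *
    \int[mu]_(t in `[0, 1]) (y * expR (- (c * (t * y) ^+ 2) / 2))).
Proof.
rewrite Rintegral_weight_true mulrCA (half_gauss_primitive dE dE1 EK E1K).
rewrite mulrDr; congr (_ + _); rewrite mulrCA; congr (_ * _).
by rewrite mulrA isqrt2piK mul1r.
Qed.

Lemma measurable_Rintegral_weight b :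
  measurable_fun setT (fun y => \int[mu]_t (weight b t * E (t * y))).
Proof.
apply: continuous_measurable_fun; case: b.
  under eq_fun do rewrite Rintegral_weight_true.
  move=> y; apply: cvgM; first exact: cvg_cst.
  exact: (derive_continuous
    (fun x => is_derive_half_gauss dE dE1 EK E1K x (@ltr01 R))).
under eq_fun do rewrite Rintegral_weight_false.
have dx (x : R) : is_derive x 1 (fun y : R => E 0 * expR (c * y ^+ 2 / 2))
    (E 0 * (expR (c * x ^+ 2 / 2) * (c * x))).
  apply: is_derive_eq; rewrite /GRing.scale/=.
  by move: (expR _) (E 0) => u v; field.
exact: derive_continuous dx.
Qed.

End weight_integral.

Lemma EFin_Rintegral d (T : measurableType d) (m : {measure set T -> \bar R})
    (D : set T) (f : T -> R) : measurable D -> m.-integrable D (EFin \o f) ->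
  (\int[m]_(x in D) f x)%:E = (\int[m]_(x in D) (f x)%:E)%E.
Proof. by move=> mD i; rewrite fineK//; exact: integrable_fin_num. Qed.

Definition laplace_weight b y : R := \int[mu]_t (weight b t * expR (t * y)).

Definition fourier_weight b y : R[i] :=
  (\int[mu]_t (weight b t * cos (t * y))) +i*
  (\int[mu]_t (weight b t * sin (t * y))).

(** Case E = exp of the primitive formula. *)
Lemma Phi_real y : Phi y%:C = (expR (- y ^+ 2 / 2) * laplace_weight true y)%:C.
Proof.
have := Rintegral_weight_primitive (@is_derive_expR R) is_derive_expR1
  norm_expR_le norm_expR_le y.
rewrite mul1r -/(laplace_weight _ _) => ->.
rewrite expR0 !mul1r /Phi /cintegral.
have Ef t : y%:C * cexp (- (t%:C * y%:C) ^+ 2 / 2) =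
    (y * expR (- (1 * (t * y) ^+ 2) / 2))%:C.
  rewrite mul1r -rmorphM -rmorphXn -rmorphN -(rmorph_nat (real_complex R) 2).
  rewrite -fmorphV -rmorphM /cexp /= cos0 sin0; simpc; congr (_ +i* _).
under [X in X +i* _]eq_Rintegral do rewrite Ef /=.
under [X in _ +i* X]eq_Rintegral do rewrite Ef /=.
rewrite Rintegral_cst//= mul0r -/isqrt2pi.
rewrite -(rmorph1 (real_complex R)) -(rmorph_nat (real_complex R) 2).
rewrite -fmorphV -rmorphM /=; simpc.
by [].
Qed.

Lemma trig10 x : trig 1 0 x = cos x.
Proof. by rewrite /trig; ring. Qed.

Lemma trig0N1 x : trig 0 (-1) x = sin x.
Proof. by rewrite /trig; ring. Qed.

(** Case E = cos and E = sin of the primitive formula, for the real and for the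
imaginary part. *)
Lemma Phi_imag y :
  Phi (0 +i* y) = (expR (y ^+ 2 / 2))%:C * fourier_weight true y.
Proof.
have Hc := Rintegral_weight_primitive (is_derive_trig 1 0) (is_derive_trig1 1 0)
  (norm_trig 1 0) (norm_trig1 1 0) y.
have Hs := Rintegral_weight_primitive (is_derive_trig 0 (-1))
  (is_derive_trig1 0 (-1)) (norm_trig 0 (-1)) (norm_trig1 0 (-1)) y.
move: Hc Hs; rewrite !mulN1r opprK.
under eq_Rintegral do rewrite trig10.
under [in X in _ -> X -> _]eq_Rintegral do rewrite trig0N1.
rewrite /trig cos0 sin0 /fourier_weight; simpc => -> ->.
rewrite /Phi /cintegral -/isqrt2pi.
have Ef t : (0 +i* y) * cexp (- (t%:C * (0 +i* y)) ^+ 2 / 2) =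
    0 +i* (y * expR (- (-1 * (t * y) ^+ 2) / 2)).
  have -> : - (t%:C * (0 +i* y)) ^+ 2 / 2 =
      (- (-1 * (t * y) ^+ 2) / 2)%:C :> R[i].
    rewrite -(rmorph_nat (real_complex R) 2) -fmorphV expr2; simpc.
    by congr (_ +i* _); ring.
  by rewrite /cexp /= cos0 sin0; simpc.
under [X in X +i* _]eq_Rintegral do rewrite Ef /=.
under [X in _ +i* X]eq_Rintegral do rewrite Ef /=.
rewrite Rintegral_cst//= mul0r.
rewrite -(rmorph1 (real_complex R)) -(rmorph_nat (real_complex R) 2).
rewrite -fmorphV -rmorphM /=; simpc.
congr (_ +i* _); lra.
Qed.

End weights.

Section complex_functions.
Context {R : realType}.
Implicit Types (f g : R -> R[i]).

Definition cbounded (M : R) (z : R[i]) :=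
  `|complex.Re z| <= M /\ `|complex.Im z| <= M.

Lemma cboundedM M N z w : cbounded M z -> cbounded N w ->
  cbounded (2 * (M * N)) (z * w).
Proof.
case: z w => [a b] [a' b'] [/= aM bM] [/= aN bN].
have H (s t s' t' : R) : `|s| <= M -> `|t| <= M -> `|s'| <= N -> `|t'| <= N ->
    `|s * s'| + `|t * t'| <= 2 * (M * N).
  move=> h1 h2 h3 h4; rewrite mulr2n mulrDl mul1r !normrM.
  by rewrite lerD// ler_pM.
by split; rewrite /=; [apply: le_trans (ler_normB _ _) _|
  apply: le_trans (ler_normD _ _) _]; apply: H.
Qed.

Lemma cbounded_prod n (F : 'I_n -> R[i]) :
  (forall j, cbounded 1 (F j)) -> cbounded (2 ^+ n) (\prod_j F j).
Proof.
elim: n F => [|n IH] F F1.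
  by rewrite big_ord0 expr0; split; rewrite /= ?normr1 ?normr0.
rewrite big_ord_recl exprS -[X in 2 * X]mul1r.
by apply: cboundedM => //; apply: IH.
Qed.

Definition cis (x : R) : R[i] := cos x +i* sin x.

Lemma cisD x y : cis (x + y) = cis x * cis y.
Proof. by rewrite /cis cosD sinD; simpc; congr (_ +i* _); ring. Qed.

Lemma cbounded_cis x : cbounded 1 (cis x).
Proof. by split; rewrite /= ?norm_cos_le1 ?norm_sin_le1. Qed.

Definition cmeasurable d (T : measurableType d) (f : T -> R[i]) :=
  measurable_fun setT (fun x => complex.Re (f x)) /\
  measurable_fun setT (fun x => complex.Im (f x)).

Context d (T : measurableType d).

Lemma cmeasurable_cst z : cmeasurable (fun _ : T => z).
Proof. by split; exact: measurable_cst. Qed.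

Lemma cmeasurableM (f g : T -> R[i]) :
  cmeasurable f -> cmeasurable g -> cmeasurable (fun x => f x * g x).
Proof.
move=> [rf imf] [rg img].
have E x : f x * g x = (complex.Re (f x) * complex.Re (g x) -
    complex.Im (f x) * complex.Im (g x)) +i*
    (complex.Re (f x) * complex.Im (g x) +
    complex.Im (f x) * complex.Re (g x)).
  by case: (f x) (g x) => [? ?] [? ?].
split; under eq_fun do rewrite E /=.
  by apply: measurable_funB; apply: measurable_funM.
by apply: measurable_funD; apply: measurable_funM.
Qed.

Lemma cmeasurable_prod n (F : 'I_n -> T -> R[i]) :
  (forall j, cmeasurable (F j)) -> cmeasurable (fun x => \prod_j F j x).
Proof.
elim: n F => [|n IH] F mF.
  under eq_fun do rewrite big_ord0.
  by split => /=; exact: measurable_cst.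
split; under eq_fun do rewrite big_ord_recl.
  have [] // := cmeasurableM (mF ord0) (IH _ (fun j => mF (lift ord0 j))).
have [] // := cmeasurableM (mF ord0) (IH _ (fun j => mF (lift ord0 j))).
Qed.

Lemma cmeasurable_cis (f : T -> R) : measurable_fun setT f ->
  cmeasurable (fun x => cis (f x)).
Proof.
move=> mf; split => /=.
  by apply: measurableT_comp mf; apply: continuous_measurable_fun; exact: continuous_cos.
by apply: measurableT_comp mf; apply: continuous_measurable_fun; exact: continuous_sin.
Qed.

End complex_functions.

Section density_identity.
Context {R : realType}.
Local Notation mu := (@lebesgue_measure R).
Implicit Types (t x y q theta : R).

(** The integrand over t left when the additional Gaussian variable has been
integrated out; [theta] accumulates the coordinates already integrated, which is
what makes the induction on the dimension run. *)
Definition gauss_density (c q theta : R) n (a : 'I_n -> R) (b : 'I_n -> bool)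
    (t : 'rV[R]_n) : R :=
  \prod_j weight (b j) (t 0 j) * ((Num.sqrt q)^-1 *
    expR (c * (theta + \sum_j a j * t 0 j) ^+ 2 / (2 * q))).

Lemma gauss_density_cons c q theta n (a : 'I_n.+1 -> R) b t (y : 'rV[R]_n) :
  gauss_density c q theta a b (row_mx (t%:M : 'rV[R]_1) y) =
  weight (b ord0) t * gauss_density c q (theta + a ord0 * t)
    (a \o lift ord0) (b \o lift ord0) y.
Proof.
rewrite /gauss_density !big_ord_recl row_cons0 mulrA addrA.
congr (_ * _ * (_ * expR (c * (_ + _) ^+ 2 / _))).
  by apply: eq_bigr => j _; rewrite row_consS.
by apply: eq_bigr => j _; rewrite row_consS.
Qed.

Lemma gauss_density_ge0 c q theta n (a : 'I_n -> R) b (t : 'rV[R]_n) :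
  0 <= gauss_density c q theta a b t.
Proof.
by rewrite mulr_ge0//; apply: prodr_ge0 => j _; exact: weight_ge0.
Qed.

Lemma measurable_gauss_density_param c q n (a : 'I_n -> R) b :
  measurable_param (fun (theta : R) (v : 'rV[R]_n) => (gauss_density c q theta a b v)%:E).
Proof.
move=> d T h X mh mX; apply/measurable_EFinP.
apply: measurable_funM.
  apply: measurable_prod => j _.
  exact: (measurableT_comp (measurable_weight (b j)) (mX j)).
apply: measurable_funM => //; apply: measurableT_comp => //.
apply: measurable_funM => //; apply: measurable_funM => //.
apply: measurable_funX; apply: measurable_funD => //.
by apply: measurable_sum => j; apply: measurable_funM => //; exact: mX.
Qed.

Lemma measurable_gauss_density c q theta n (a : 'I_n -> R) b :
  measurable_row (fun v : 'rV[R]_n => (gauss_density c q theta a b v)%:E).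
Proof.
move=> d T X mX.
by have := @measurable_gauss_density_param c q n a b _ T (fun=> theta) X; apply.
Qed.

Lemma measurable_laplace_weight b : measurable_fun setT (@laplace_weight R b).
Proof.
exact: (measurable_Rintegral_weight (@is_derive_expR R) (@is_derive_expR1 R)
  (@norm_expR_le R) (@norm_expR_le R)).
Qed.

Lemma laplace_weight_ge0 b y : 0 <= laplace_weight b y.
Proof.
by apply: Rintegral_ge0 => t _; rewrite mulr_ge0 ?weight_ge0 ?expR_ge0.
Qed.

Lemma EFin_laplace_weight b y :
  ((laplace_weight b y)%:E = \int[mu]_t (weight b t * expR (t * y))%:E)%E.
Proof.
rewrite /laplace_weight EFin_Rintegral//.
exact: (integrable_weight (@is_derive_expR R) (@is_derive_expR1 R)
  (@norm_expR_le R) (@norm_expR_le R)).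
Qed.

Lemma gaussian_real_base theta q : 0 < q ->
  (\int[mu]_x (isqrt2pi * (expR (theta * x) * gauss q x))%:E =
  ((Num.sqrt q)^-1 * expR (theta ^+ 2 / (2 * q)))%:E)%E.
Proof.
move=> q0.
have [i H] := integral_gauss_full (@is_derive_expR R) (@is_derive_expR1 R)
  (@norm_expR_le R) (@norm_expR_le R) theta q0.
have Ef : (fun x => (isqrt2pi * (expR (theta * x) * gauss q x))%:E) =
    (fun x => (isqrt2pi%:E * (EFin \o (fun x => gauss q x * expR (x * theta))%R) x)%E).
  by apply/funext => x; rewrite /= -EFinM (mulrC theta) (mulrC (expR _)).
rewrite Ef integralZl// -EFin_Rintegral// H expR0 -EFinM; congr EFin.
rewrite !mul1r mulrA; congr (_ * _).
rewrite sqrtrM ?mulr_ge0 ?pi_ge0// mulrA isqrt2piK mul1r.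
by rewrite sqrtrV// ltW.
Qed.

(** Linearization of the square by one more Gaussian variable x.  All integrands are
nonnegative, so Tonelli allows peeling off the coordinates one at a time: each
one shifts [theta]. *)
Lemma integral_prod_laplace_weight n (a : 'I_n -> R) b theta q : 0 < q ->
  (\int[mu]_x (isqrt2pi * (\prod_j laplace_weight (b j) (a j * x) *
      (expR (theta * x) * gauss q x)))%:E =
  iint (fun v : 'rV[R]_n => (gauss_density 1 q theta a b v)%:E))%E.
Proof.
move=> q0; elim: n a b theta => [|n IH] a b theta.
  under eq_integral do rewrite big_ord0 mul1r.
  rewrite gaussian_real_base// /= /gauss_density !big_ord0 addr0.
  by congr EFin; rewrite !mul1r.
pose a' := a \o lift ord0; pose b' := b \o lift ord0.
pose Z x := \prod_(j < n) laplace_weight (b' j) (a' j * x).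
have Z0 x : 0 <= Z x by apply: prodr_ge0 => j _; exact: laplace_weight_ge0.
have mZ : measurable_fun setT Z.
  apply: measurable_prod => j _.
  apply: (measurableT_comp (measurable_laplace_weight (b' j))).
  by apply: measurable_funM.
pose F (xt : R * R) : \bar R := (weight (b ord0) xt.2 * expR (xt.2 * (a ord0 * xt.1)) *
  (isqrt2pi * (Z xt.1 * (expR (theta * xt.1) * gauss q xt.1))))%:E.
have r0 x : 0 <= isqrt2pi * (Z x * (expR (theta * x) * gauss q x)).
  by rewrite mulr_ge0 ?isqrt2pi_ge0// mulr_ge0 ?Z0// mulr_ge0 ?expR_ge0 ?gauss_ge0.
have F0 xt : (0 <= F xt)%E.
  by rewrite lee_fin mulr_ge0// mulr_ge0 ?weight_ge0 ?expR_ge0.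
have mr : measurable_fun setT (fun x => isqrt2pi * (Z x * (expR (theta * x) * gauss q x))).
  apply: measurable_funM => //; apply: measurable_funM => //.
  apply: measurable_funM; last exact: measurable_gauss.
  by apply: measurableT_comp => //; apply: measurable_funM.
have mF : measurable_fun setT F.
  apply/measurable_EFinP; apply: measurable_funM.
    apply: measurable_funM.
      exact: (measurableT_comp (measurable_weight (b ord0)) measurable_snd).
    apply: measurableT_comp => //; apply: measurable_funM => //.
    by apply: measurable_funM.
  exact: (measurableT_comp mr measurable_fst).
transitivity (\int[mu]_x \int[mu]_t F (x, t))%E.
  apply: eq_integral => x _; rewrite big_ord_recl /F /=.
  under [RHS]eq_integral do rewrite EFinM.
  rewrite ge0_integralZr//.
  - by rewrite -EFin_laplace_weight -EFinM; congr EFin; rewrite /Z /a' /b' /=; ring.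
  - apply/measurable_EFinP; apply: measurable_funM; first exact: measurable_weight.
    by apply: measurableT_comp => //; apply: measurable_funM.
  - by move=> t _; rewrite lee_fin mulr_ge0 ?weight_ge0 ?expR_ge0.
  - by rewrite lee_fin.
transitivity (\int[mu]_t \int[mu]_x F (x, t))%E.
  exact: (fubini_tonelli (m1 := mu) (m2 := mu) _ mF F0).
rewrite iintS; apply: eq_integral => t _.
under [in RHS]eq_fun do rewrite gauss_density_cons EFinM.
rewrite ge0_iintZl; last 3 first.
- exact: measurable_gauss_density.
- by move=> y; rewrite lee_fin gauss_density_ge0.
- by rewrite lee_fin weight_ge0.
rewrite -IH -ge0_integralZl; last 4 first.
- exact: measurableT.
- apply/measurable_EFinP; apply: measurable_funM => //; apply: measurable_funM => //.
  apply: measurable_funM; last exact: measurable_gauss.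
  by apply: measurableT_comp => //; apply: measurable_funM.
- move=> x _; rewrite lee_fin mulr_ge0 ?isqrt2pi_ge0// mulr_ge0 ?Z0//.
  by rewrite mulr_ge0 ?expR_ge0 ?gauss_ge0.
- by rewrite lee_fin weight_ge0.
apply: eq_integral => x _; rewrite /F -EFinM /=; congr EFin.
rewrite mulrDl expRD (_ : a ord0 * t * x = t * (a ord0 * x)); last by ring.
rewrite [X in _ = _ * (_ * (X * _))](_ : _ = Z x)//.
set w := weight _ _; set e1 := expR _; set e2 := expR _; set g := gauss _ _.
by move: w e1 e2 g (Z x) => *; ring.
Qed.

Let Ed (u v : R) := is_derive_trig u v.
Let E1d (u v : R) := is_derive_trig1 u v.
Let EK (u v : R) := norm_trig u v.
Let E1K (u v : R) := norm_trig1 u v.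

Lemma integrable_weight_trig b u v y :
  mu.-integrable setT (EFin \o (fun t => weight b t * trig u v (t * y))).
Proof. exact: (integrable_weight (Ed u v) (E1d u v) (EK u v) (E1K u v)). Qed.

Lemma integrable_weight_cos b y :
  mu.-integrable setT (EFin \o (fun t => weight b t * cos (t * y))).
Proof.
have := integrable_weight_trig b 1 0 y.
by under eq_fun do rewrite /= trig10.
Qed.

Lemma integrable_weight_sin b y :
  mu.-integrable setT (EFin \o (fun t => weight b t * sin (t * y))).
Proof.
have := integrable_weight_trig b 0 (-1) y.
by under eq_fun do rewrite /= trig0N1.
Qed.

Lemma measurable_fourier_weight b : cmeasurable (@fourier_weight R b).
Proof.
split; rewrite /fourier_weight /=.
  have := measurable_Rintegral_weight (Ed 1 0) (E1d 1 0) (EK 1 0) (E1K 1 0) b.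
  by under eq_fun do under eq_Rintegral do rewrite trig10.
have := measurable_Rintegral_weight (Ed 0 (-1)) (E1d 0 (-1)) (EK 0 (-1))
  (E1K 0 (-1)) b.
by under eq_fun do under eq_Rintegral do rewrite trig0N1.
Qed.

Lemma integrable_weight0 b : mu.-integrable setT (EFin \o (@weight R b)).
Proof.
have := integrable_weight_cos b 0.
by under eq_fun do rewrite /= mulr0 cos0 mulr1.
Qed.

Lemma Rintegral_weight_le1 b : \int[mu]_t weight b t <= 1.
Proof.
apply: (@le_trans _ _ (\int[mu]_t weight false t)).
  apply: le_Rintegral => //; [exact: integrable_weight0|exact: integrable_weight0|].
  move=> t _; rewrite /weight ler_wpM2r ?mulr_ge0 ?isqrt2pi_ge0 ?gauss_ge0//.
  by rewrite !indicE in_setT ler_nat leq_b1.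
have := Rintegral_weight_false (@is_derive_expR R) (@is_derive_expR1 R)
  (@norm_expR_le R) (@norm_expR_le R) 0.
rewrite expr0n/= mulr0 mul0r expR0 mulr1 => <-.
by under [leRHS]eq_Rintegral do rewrite mulr0 expR0 mulr1.
Qed.

Lemma norm_Rintegral_weight_le1 b (f : R -> R) :
  mu.-integrable setT (EFin \o (fun t => weight b t * f t)) ->
  (forall t, `|f t| <= 1) -> `|\int[mu]_t (weight b t * f t)| <= 1.
Proof.
move=> i f1; apply: le_trans (Rintegral_weight_le1 b).
apply: (le_trans (le_normr_Rintegral _ i)) => //.
apply: le_Rintegral => //.
- by have /integrable_norm := i.
- exact: integrable_weight0.
- move=> t _; rewrite normrM (ger0_norm (weight_ge0 _ _)).
  by rewrite ler_piMr ?weight_ge0.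
Qed.

Lemma cbounded_fourier_weight b y : cbounded 1 (fourier_weight b y).
Proof.
split; rewrite /fourier_weight /=; apply: norm_Rintegral_weight_le1.
- exact: integrable_weight_cos.
- by move=> t; exact: norm_cos_le1.
- exact: integrable_weight_sin.
- by move=> t; exact: norm_sin_le1.
Qed.

(** Stated with a complex factor, so that the real part of a product of Fourier
transforms can be expanded one factor at a time. *)
Lemma Re_fourier_weightM b y (z : R[i]) :
  (complex.Re (fourier_weight b y * z))%:E =
  (\int[mu]_t (weight b t * complex.Re (cis (t * y) * z))%:E)%E.
Proof.
case: z => u v; rewrite /fourier_weight /cis; simpc => /=.
transitivity (\int[mu]_t (weight b t * trig u v (t * y))%:E)%E; last first.
  by apply: eq_integral => t _; congr (_ * _)%:E; rewrite /trig /=; ring.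
rewrite -EFin_Rintegral//; last exact: integrable_weight_trig.
congr EFin.
have E t : weight b t * trig u v (t * y) =
    u * (weight b t * cos (t * y)) - v * (weight b t * sin (t * y)).
  by rewrite /trig; ring.
under [RHS]eq_Rintegral do rewrite E.
have ic := integrable_weight_cos b y; have is' := integrable_weight_sin b y.
rewrite RintegralB//; [|exact: integrable_EFinZl|exact: integrable_EFinZl].
by rewrite !RintegralZl//= mulrC (mulrC v).
Qed.

Definition fourier_weight_prod n (a : 'I_n -> R) (b : 'I_n -> bool) (w : R[i]) theta x :
  R[i] := w * \prod_j fourier_weight (b j) (a j * x) * cis (theta * x).

Lemma cmeasurable_fourier_weight_prod n (a : 'I_n -> R) b w theta :
  cmeasurable (fourier_weight_prod a b w theta).
Proof.
apply: cmeasurableM.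
  apply: cmeasurableM; first exact: cmeasurable_cst.
  apply: cmeasurable_prod => j; have [mr mi] := measurable_fourier_weight (b j).
  by split; [apply: (measurableT_comp mr)|apply: (measurableT_comp mi)];
    apply: measurable_funM.
by apply: cmeasurable_cis; apply: measurable_funM.
Qed.

Lemma cbounded_fourier_weight_prod n (a : 'I_n -> R) b w theta : exists2 M, 0 <= M &
  forall x, cbounded M (fourier_weight_prod a b w theta x).
Proof.
pose B := `|complex.Re w| + `|complex.Im w|.
exists (2 * (2 * (B * 2 ^+ n) * 1)); first by rewrite !mulr_ge0 ?addr_ge0 ?exprn_ge0.
move=> x; apply: cboundedM; last exact: cbounded_cis.
apply: cboundedM; first by split; rewrite /B ?lerDl ?lerDr.
by apply: cbounded_prod => j; exact: cbounded_fourier_weight.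
Qed.

Lemma integrable_gauss_bounded q (f : R -> R) M : 0 < q ->
  measurable_fun setT f -> (forall x, `|f x| <= M) ->
  mu.-integrable setT (EFin \o (fun x => isqrt2pi * (f x * gauss q x))).
Proof.
move=> q0 mf fM.
have ig : mu.-integrable setT (EFin \o (@gauss R q)).
  have [+ _] := integral_gauss_full (@is_derive_expR R) (@is_derive_expR1 R)
    (@norm_expR_le R) (@norm_expR_le R) 0 q0.
  by under eq_fun do rewrite /= mulr0 expR0 mulr1.
apply: integrable_EFinZl => //.
apply: (@le_integrable _ _ _ mu _ _ _ (EFin \o (fun x => M * gauss q x))) => //.
- by apply/measurable_EFinP; apply: measurable_funM => //; exact: measurable_gauss.
- move=> x _; rewrite lee_fin !normrM ler_wpM2r//.
  by apply: (le_trans (fM x)); exact: ler_norm.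
- exact: integrable_EFinZl.
Qed.

(** The analogue of [integral_prod_laplace_weight] for an oscillating kernel, where
Fubini needs domination: the transforms are bounded by 1 and the weights are
integrable.  The values w = 1 and w = - i give the real and the imaginary part of
the integral of the product; the latter vanishes. *)
Lemma integral_prod_fourier_weight n (a : 'I_n -> R) b theta q w : 0 < q -> 0 <= complex.Re w ->
  (\int[mu]_x (isqrt2pi * (complex.Re (fourier_weight_prod a b w theta x) * gauss q x))%:E =
  (complex.Re w)%:E *
    iint (fun v : 'rV[R]_n => (gauss_density (-1) q theta a b v)%:E))%E.
Proof.
move=> q0 w0; elim: n a b theta => [|n IH] a b theta.
  have [i H] := integral_gauss_full (Ed (complex.Re w) (complex.Im w))
    (E1d _ _) (EK _ _) (E1K _ _) theta q0.
  have Ef : (fun x => (isqrt2pi * (complex.Re (fourier_weight_prod a b w theta x) * gauss q x))%:E) =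
      (fun x => (isqrt2pi%:E * (EFin \o (fun x => gauss q x *
        trig (complex.Re w) (complex.Im w) (x * theta))%R) x)%E).
    apply/funext => x; rewrite /= -EFinM /fourier_weight_prod big_ord0 mulr1 /cis.
    by rewrite (mulrC theta) /trig; case: w {i H w0} => u v; simpc => /=; congr EFin; ring.
  rewrite Ef integralZl// -EFin_Rintegral// H -EFinM /= -EFinM; congr EFin.
  rewrite /gauss_density !big_ord0 addr0 mul1r /trig cos0 sin0 mulr1 mulr0 subr0.
  rewrite !mulrA (mulrC isqrt2pi) -!mulrA; congr (_ * _); rewrite !mulrA; congr (_ * _).
  rewrite sqrtrM ?mulr_ge0 ?pi_ge0// mulrA isqrt2piK mul1r.
  by rewrite sqrtrV// ltW.
pose a' := a \o lift ord0; pose b' := b \o lift ord0.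
pose Z := fourier_weight_prod a' b' w theta.
have [M M0 HM] := cbounded_fourier_weight_prod a' b' w theta.
have mZ : cmeasurable Z by exact: cmeasurable_fourier_weight_prod.
pose F (xt : R * R) : \bar R :=
  (weight (b ord0) xt.2 * (complex.Re (cis (xt.2 * (a ord0 * xt.1)) * Z xt.1)) *
  (isqrt2pi * gauss q xt.1))%:E.
have mF : measurable_fun setT F.
  apply/measurable_EFinP; apply: measurable_funM; last first.
    apply: measurable_funM => //.
    exact: (measurableT_comp (measurable_gauss q) measurable_fst).
  apply: measurable_funM.
    exact: (measurableT_comp (measurable_weight (b ord0)) measurable_snd).
  have mc : cmeasurable (fun xt : R * R => cis (xt.2 * (a ord0 * xt.1))).
    by apply: cmeasurable_cis; do 2 apply: measurable_funM => //.
  have mZ1 : cmeasurable (fun xt : R * R => Z xt.1).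
    case: mZ => m1 m2; split; first exact: (measurableT_comp m1 measurable_fst).
    exact: (measurableT_comp m2 measurable_fst).
  by case: (cmeasurableM mc mZ1).
have bZ x t : `|complex.Re (cis (t * (a ord0 * x)) * Z x)| <= 2 * (1 * M).
  by have [] := cboundedM (cbounded_cis (t * (a ord0 * x))) (HM x).
(* an integrable bound of F on the product space *)
pose G (xt : R * R) : \bar R :=
  (weight (b ord0) xt.2 * (isqrt2pi * (2 * (1 * M) * gauss q xt.1)))%:E.
have gM0 x : 0 <= isqrt2pi * (2 * (1 * M) * gauss q x).
  by rewrite mulr_ge0 ?isqrt2pi_ge0// mulr_ge0 ?gauss_ge0// mulr_ge0// mul1r.
have mG : measurable_fun setT G.
  apply/measurable_EFinP; apply: measurable_funM.
    exact: (measurableT_comp (measurable_weight (b ord0)) measurable_snd).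
  do 2 apply: measurable_funM => //.
  exact: (measurableT_comp (measurable_gauss q) measurable_fst).
have iG : (mu \x mu)%E.-integrable setT G.
  apply/integrable12ltyP => //.
  apply: (@le_lt_trans _ _ (\int[mu]_x (isqrt2pi * (2 * (1 * M) * gauss q x))%:E)%E).
    apply: ge0_le_integral => //.
    - by move=> x _; apply: integral_ge0.
    - have mN : measurable_fun setT (abse \o G) by exact: measurableT_comp.
      exact: (measurable_fun_fubini_tonelli_F (m2 := mu) (abse \o G) mN
        (fun=> abse_ge0 _)).
    - apply/measurable_EFinP; do 2 apply: measurable_funM => //.
      exact: measurable_gauss.
    - move=> x _; rewrite /G /=.
      under eq_integral do
        rewrite normrM (ger0_norm (weight_ge0 _ _)) (ger0_norm (gM0 _)) EFinM.
      rewrite ge0_integralZr//; last 3 first.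
      + by apply/measurable_EFinP; exact: measurable_weight.
      + by move=> t _; rewrite lee_fin weight_ge0.
      + by rewrite lee_fin.
      rewrite -[leRHS]mul1e lee_wpmul2r ?lee_fin//.
      by rewrite -EFin_Rintegral ?lee_fin ?Rintegral_weight_le1//;
        exact: integrable_weight0.
  have nM : `|2 * (1 * M)| <= 2 * (1 * M) by rewrite ger0_norm// mulr_ge0// mul1r.
  have /integrableP[_] := @integrable_gauss_bounded q (fun=> 2 * (1 * M))
    (2 * (1 * M)) q0 (measurable_cst _) (fun _ => nM).
  by under eq_integral do rewrite /= ger0_norm//.
have iF : (mu \x mu)%E.-integrable setT F.
  apply: (@le_integrable _ _ _ (mu \x mu)%E setT measurableT F G _ _ iG).
    exact: mF.
  move=> -[x t] _; rewrite /F /G /= lee_fin.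
  move: (weight_ge0 (b ord0) t) (@isqrt2pi_ge0 R) (gauss_ge0 q x) (bZ x t).
  move: (weight _ _) isqrt2pi (gauss q x) (complex.Re _) (2 * (1 * M)).
  move=> r i g z N r0 i0 g0 zN.
  rewrite !normrM (ger0_norm r0) (ger0_norm i0) (ger0_norm g0) -mulrA.
  rewrite ler_wpM2l// mulrCA ler_wpM2l// ler_wpM2r//.
  by rewrite (le_trans zN)// ler_norm.
transitivity (\int[mu]_x \int[mu]_t F (x, t))%E.
  apply: eq_integral => x _; rewrite /F /=.
  under [RHS]eq_integral do rewrite EFinM.
  rewrite integralZr//; last first.
    have := integrable_weight_trig (b ord0) (complex.Re (Z x)) (complex.Im (Z x)) (a ord0 * x).
    apply: eq_integrable => // t _ /=; congr (_ * _)%:E.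
    by rewrite /trig /cis; case: (Z x) => u v; simpc => /=; ring.
  rewrite -Re_fourier_weightM -EFinM; congr EFin.
  rewrite /fourier_weight_prod big_ord_recl mulrCA; congr (_ * _).
  congr complex.Re.
  by rewrite /Z /fourier_weight_prod /a' /b' /=; ring.
rewrite (Fubini iF) iintS.
rewrite -ge0_integralZl//; last 2 first.
- apply: (measurable_iint_slice
    (f := fun v : 'rV[R]_n.+1 => (gauss_density (-1) q theta a b v)%:E)).
    exact: measurable_gauss_density.
  by move=> y; rewrite lee_fin gauss_density_ge0.
- by move=> t _; apply: iint_ge0 => y; rewrite lee_fin gauss_density_ge0.
apply: eq_integral => t _.
under [in RHS]eq_fun do rewrite gauss_density_cons EFinM.
rewrite ge0_iintZl; last 3 first.
- exact: measurable_gauss_density.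
- by move=> y; rewrite lee_fin gauss_density_ge0.
- by rewrite lee_fin weight_ge0.
rewrite muleCA -IH -integralZl//; last first.
  have [N N0 HN] := cbounded_fourier_weight_prod a' b' w (theta + a ord0 * t).
  apply: (@integrable_gauss_bounded q _ N) => //.
    by case: (cmeasurable_fourier_weight_prod a' b' w (theta + a ord0 * t)).
  by move=> x; case: (HN x).
apply: eq_integral => x _; rewrite /F -EFinM /=; congr EFin.
have -> : fourier_weight_prod (a \o lift ord0) (b \o lift ord0) w (theta + a ord0 * t) x =
    cis (t * (a ord0 * x)) * Z x.
  rewrite /Z /fourier_weight_prod mulrDl cisD (_ : a ord0 * t * x = t * (a ord0 * x)).
    by rewrite [RHS]mulrC -[RHS]mulrA.
  by ring.
by move: (weight _ _) isqrt2pi (gauss q x) (complex.Re _) => *; ring.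
Qed.

End density_identity.

(** * Gaussian means of products of Phi *)

Section gaussian_mean_Phi.
Context {R : realType}.
Local Notation mu := (@lebesgue_measure R).
Implicit Types (c x q : R).

Lemma laplace_weight_false y : laplace_weight false y = expR (y ^+ 2 / 2) :> R.
Proof.
rewrite /laplace_weight (Rintegral_weight_false (@is_derive_expR R) (@is_derive_expR1 R)
  (@norm_expR_le R) (@norm_expR_le R)).
by rewrite expR0 !mul1r.
Qed.

Lemma fourier_weight_false y : fourier_weight false y = (expR (- y ^+ 2 / 2))%:C :> R[i].
Proof.
rewrite /fourier_weight.
have Hc := Rintegral_weight_false (is_derive_trig 1 0) (is_derive_trig1 1 0)
  (norm_trig 1 0) (norm_trig1 1 0) y.
have Hs := Rintegral_weight_false (is_derive_trig 0 (-1))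
  (is_derive_trig1 0 (-1)) (norm_trig 0 (-1)) (norm_trig1 0 (-1)) y.
move: Hc Hs.
under eq_Rintegral do rewrite trig10.
under [in X in _ -> X -> _]eq_Rintegral do rewrite trig0N1.
rewrite /trig cos0 sin0 !mulN1r => -> ->.
by congr (_ +i* _); ring.
Qed.

Lemma prod_expR n (f : 'I_n -> R) :
  \prod_j expR (f j) = expR (\sum_j f j).
Proof.
elim: n f => [|n IH] f; first by rewrite !big_ord0 expR0.
by rewrite !big_ord_recl expRD IH.
Qed.

(** The product of the prefactors of the one-dimensional integrals changes the
variance of the Gaussian in x. *)
Lemma gauss_shift n (a : 'I_n -> R) e x :
  expR (\sum_j - (e * (a j * x) ^+ 2) / 2) * gauss 1 x =
  gauss (1 + e * \sum_j a j ^+ 2) x.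
Proof.
rewrite /gauss -expRD; congr expR.
rewrite -mulr_suml sumrN -mulrDl; congr (_ / 2); rewrite -opprD; congr (- _).
rewrite mul1r mulrDl mul1r addrC; congr (_ + _).
rewrite -mulr_sumr -mulrA; congr (_ * _); rewrite mulr_suml.
by apply: eq_bigr => j _; rewrite exprMn.
Qed.

Lemma gauss_density_le c q theta n (a : 'I_n -> R) b (v : 'rV[R]_n) :
  gauss_density c q theta a b v <= gauss_density c q theta a (fun=> false) v.
Proof.
rewrite ler_wpM2r//.
apply: ler_prod => j _; rewrite weight_ge0/= /weight ler_wpM2r//.
  by rewrite mulr_ge0 ?isqrt2pi_ge0 ?gauss_ge0.
by rewrite !indicE in_setT ler_nat leq_b1.
Qed.

Lemma gauss_density_scale e s q n (a : 'I_n -> R) b (v : 'rV[R]_n) :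
  gauss_density (e * s ^+ 2) q 0 a b v =
  gauss_density e q 0 (fun j => s * a j) b v.
Proof.
rewrite /gauss_density !add0r.
have -> : \sum_j s * a j * v 0 j = s * \sum_j a j * v 0 j.
  by rewrite mulr_sumr; apply: eq_bigr => j _; rewrite mulrA.
by rewrite [in RHS]exprMn -[e * _ * _]mulrA.
Qed.

Lemma iint_gauss_density_real n (a : 'I_n -> R) b :
  let q := 1 + \sum_j a j ^+ 2 in
  (\int[mu]_x (isqrt2pi * (\prod_j laplace_weight (b j) (a j * x) * gauss q x))%:E =
  iint (fun v : 'rV[R]_n => (gauss_density 1 q 0 a b v)%:E))%E.
Proof.
move=> q; rewrite -integral_prod_laplace_weight; last first.
  by rewrite ltr_pwDl// sumr_ge0// => j _; rewrite sqr_ge0.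
by apply: eq_integral => x _; rewrite mul0r expR0 mul1r.
Qed.

Lemma iint_gauss_density_imag n (a : 'I_n -> R) b w :
  let q := 1 - \sum_j a j ^+ 2 in 0 < q -> 0 <= complex.Re w ->
  (\int[mu]_x (isqrt2pi * (complex.Re (w * \prod_j fourier_weight (b j) (a j * x)) *
     gauss q x))%:E =
  (complex.Re w)%:E * iint (fun v : 'rV[R]_n => (gauss_density (-1) q 0 a b v)%:E))%E.
Proof.
move=> q q0 w0; rewrite -integral_prod_fourier_weight//.
apply: eq_integral => x _; rewrite /fourier_weight_prod mul0r /cis cos0 sin0.
by rewrite [1 +i* 0](_ : _ = 1)// mulr1.
Qed.

Lemma integral_isqrt2pi_gauss : (\int[mu]_x (isqrt2pi * gauss 1 x)%:E = 1)%E.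
Proof.
under eq_integral do rewrite EFinM.
rewrite ge0_integralZl//; last 3 first.
- by apply/measurable_EFinP; exact: measurable_gauss.
- by move=> x _; rewrite lee_fin gauss_ge0.
- by rewrite lee_fin isqrt2pi_ge0.
by rewrite integral_gauss// -EFinM divr1 isqrt2piK.
Qed.

(** With all coordinates free, the transforms of the weights are the exponentials
that [gauss_shift] absorbs, and a total Gaussian mass remains. *)
Lemma iint_gauss_density_total c n (a : 'I_n -> R) :
  let q := 1 + c * \sum_j a j ^+ 2 in 0 < q ->
  (iint (fun v : 'rV[R]_n => (gauss_density c q 0 a (fun=> false) v)%:E) = 1)%E.
Proof.
move=> q q0; pose s := Num.sqrt `|c|.
have s2 : s ^+ 2 = `|c| by rewrite sqr_sqrtr.
have sa : \sum_j (s * a j) ^+ 2 = `|c| * \sum_j a j ^+ 2.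
  by rewrite mulr_sumr; apply: eq_bigr => j _; rewrite exprMn s2.
have [c0|c0] := leP 0 c.
  have cE : c = 1 * s ^+ 2 by rewrite s2 ger0_norm// mul1r.
  rewrite {1}cE; under eq_fun do rewrite gauss_density_scale.
  have := iint_gauss_density_real (fun j => s * a j) (fun=> false).
  rewrite /= sa (ger0_norm c0) -/q => <-.
  rewrite -integral_isqrt2pi_gauss; apply: eq_integral => x _; congr (_ * _)%:E.
  under eq_bigr do rewrite laplace_weight_false.
  have -> : q = 1 + 1 * \sum_j (s * a j) ^+ 2 by rewrite mul1r sa ger0_norm.
  rewrite -gauss_shift mulrA prod_expR -expRD -big_split/= big1 ?expR0 ?mul1r//.
  by move=> j _; rewrite mul1r -mulrDl subrr mul0r.
have cE : c = -1 * s ^+ 2 by rewrite s2 ltr0_norm// mulN1r opprK.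
rewrite {1}cE; under eq_fun do rewrite gauss_density_scale.
have qE : q = 1 - \sum_j (s * a j) ^+ 2 by rewrite sa ltr0_norm// mulNr opprK.
have := @iint_gauss_density_imag _ (fun j => s * a j) (fun=> false) 1.
rewrite /= -qE => /(_ q0 ler01); rewrite mul1e => <-.
rewrite -integral_isqrt2pi_gauss; apply: eq_integral => x _; congr (_ * _)%:E.
under eq_bigr do rewrite fourier_weight_false.
rewrite mul1r -rmorph_prod/= prod_expR qE -mulN1r -gauss_shift mulrA -expRD.
rewrite -big_split/= big1 ?expR0 ?mul1r// => j _.
by rewrite mulN1r opprK -mulrDl addNr mul0r.
Qed.

Lemma iint_gauss_density_fin_num c n (a : 'I_n -> R) b :
  let q := 1 + c * \sum_j a j ^+ 2 in 0 < q ->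
  iint (fun v : 'rV[R]_n => (gauss_density c q 0 a b v)%:E) \is a fin_num.
Proof.
move=> q q0; rewrite ge0_fin_numE; last first.
  by apply: iint_ge0 => v; rewrite lee_fin gauss_density_ge0.
apply: (@le_lt_trans _ _ 1%E); last exact: ltry.
rewrite -(iint_gauss_density_total q0); apply: le_iint.
- exact: measurable_gauss_density.
- exact: measurable_gauss_density.
- by move=> v; rewrite lee_fin gauss_density_ge0.
- by move=> v; rewrite lee_fin gauss_density_le.
Qed.

Lemma gaussian_meanE (f : R -> R[i]) (u v : R -> R) :
  (forall x, f x * (expR (- x ^+ 2 / 2))%:C = u x +i* v x) ->
  mu.-integrable setT (EFin \o (fun x => isqrt2pi * u x)) ->
  mu.-integrable setT (EFin \o (fun x => isqrt2pi * v x)) ->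
  gaussian_mean f =
    (\int[mu]_x (isqrt2pi * u x)) +i* (\int[mu]_x (isqrt2pi * v x)).
Proof.
move=> fE iu iv; rewrite /gaussian_mean /cintegral -/isqrt2pi.
under [X in X +i* _]eq_Rintegral do rewrite fE /=.
under [X in _ +i* X]eq_Rintegral do rewrite fE /=.
have isqV h : mu.-integrable setT (EFin \o (fun x => isqrt2pi * h x)) ->
    mu.-integrable setT (EFin \o h).
  move=> /(@integrable_EFinZl _ _ _ isqrt2pi^-1 measurableT).
  by under eq_fun do rewrite /= mulKf ?gt_eqF ?isqrt2pi_gt0//.
rewrite !RintegralZl//; [|exact: isqV|exact: isqV].
by simpc.
Qed.

(** The scaling s = sqrt |c| reduces to c = 1, where the arguments of [Phi] are real,
or to c = -1, where they are imaginary. *)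
Lemma gaussian_mean_Phi c n (a : 'I_n -> R) b :
  let q := 1 + c * \sum_j a j ^+ 2 in 0 < q ->
  gaussian_mean (fun x =>
    \prod_j (if b j then Phi ((a j)%:C * csqrt c * x%:C) else 1)) =
  (fine (iint (fun v : 'rV[R]_n => (gauss_density c q 0 a b v)%:E)))%:C.
Proof.
move=> q q0; pose s := Num.sqrt `|c|.
have s2 : s ^+ 2 = `|c| by rewrite sqr_sqrtr.
have sa : \sum_j (s * a j) ^+ 2 = `|c| * \sum_j a j ^+ 2.
  by rewrite mulr_sumr; apply: eq_bigr => j _; rewrite exprMn s2.
have i0 : mu.-integrable setT (EFin \o (fun x : R => isqrt2pi * 0)).
  by under eq_fun do rewrite /= mulr0; exact: integrable0.
have fin := iint_gauss_density_fin_num b q0.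
have [c0|c0] := leP 0 c.
  have cE : c = 1 * s ^+ 2 by rewrite s2 ger0_norm// mul1r.
  have qE : q = 1 + 1 * \sum_j (s * a j) ^+ 2 by rewrite mul1r sa ger0_norm.
  pose u x := \prod_j laplace_weight (b j) (s * a j * x) * gauss q x.
  have H := iint_gauss_density_real (fun j => s * a j) b.
  rewrite /= -[\sum_j _]mul1r -qE in H.
  rewrite -/q in fin; move: fin; rewrite {1 3}cE.
  under eq_fun do rewrite gauss_density_scale.
  rewrite -H => fin.
  have u0 x : 0 <= isqrt2pi * u x.
    rewrite mulr_ge0 ?isqrt2pi_ge0// mulr_ge0 ?gauss_ge0//.
    by apply: prodr_ge0 => j _; exact: laplace_weight_ge0.
  have iu : mu.-integrable setT (EFin \o (fun x => isqrt2pi * u x)).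
    apply/integrableP; split.
      apply/measurable_EFinP; apply: measurable_funM => //.
      apply: measurable_funM; last exact: measurable_gauss.
      apply: measurable_prod => j _.
      apply: (measurableT_comp (measurable_laplace_weight (b j))).
      by apply: measurable_funM.
    under eq_integral do rewrite /= (ger0_norm (u0 _)).
    by rewrite -ge0_fin_numE//; apply: integral_ge0 => x _; rewrite lee_fin.
  rewrite (@gaussian_meanE _ u (fun=> 0))//.
    by under [X in _ +i* X]eq_Rintegral do rewrite mulr0; rewrite Rintegral_cst//= mul0r.
  move=> x; rewrite /csqrt c0 -/s.
  have ss : s = Num.sqrt c by rewrite /s ger0_norm.
  have Pj j : (if b j then Phi ((a j)%:C * (Num.sqrt c)%:C * x%:C) else 1) =
      (expR (- (1 * (s * a j * x) ^+ 2) / 2) * laplace_weight (b j) (s * a j * x))%:C.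
    rewrite -ss mul1r -!rmorphM (mulrC (a j)); case: (b j).
      by rewrite Phi_real.
    by rewrite laplace_weight_false -expRD -mulrDl addNr mul0r expR0.
  under eq_bigr do rewrite Pj.
  rewrite -rmorph_prod -rmorphM /=; congr (_ +i* _).
  rewrite big_split/= prod_expR mulrAC mulrC; congr (_ * _).
  by rewrite qE -gauss_shift; congr (_ * _); rewrite /gauss mul1r.
have cE : c = -1 * s ^+ 2 by rewrite s2 ltr0_norm// mulN1r opprK.
have qE : q = 1 - \sum_j (s * a j) ^+ 2 by rewrite sa ltr0_norm// mulNr opprK.
pose P x : R[i] := \prod_j fourier_weight (b j) (s * a j * x).
have [mPr mPi] : cmeasurable P.
  apply: cmeasurable_prod => j; have [mr mi] := @measurable_fourier_weight R (b j).
  by split; [apply: (measurableT_comp mr)|apply: (measurableT_comp mi)];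
    apply: measurable_funM.
have bP x : cbounded (2 ^+ n) (P x).
  by apply: cbounded_prod => j; exact: cbounded_fourier_weight.
have iu : mu.-integrable setT
    (EFin \o (fun x => isqrt2pi * (complex.Re (P x) * gauss q x))).
  by apply: (integrable_gauss_bounded (M := 2 ^+ n) q0 mPr) => x; case: (bP x).
have iv : mu.-integrable setT
    (EFin \o (fun x => isqrt2pi * (complex.Im (P x) * gauss q x))).
  by apply: (integrable_gauss_bounded (M := 2 ^+ n) q0 mPi) => x; case: (bP x).
rewrite (gaussian_meanE _ iu iv).
  rewrite [RHS]/real_complex_def; congr (_ +i* _).
    have := @iint_gauss_density_imag _ (fun j => s * a j) b 1.
    rewrite /= -qE => /(_ q0 ler01); rewrite mul1e.
    under [in X in _ = X -> _]eq_fun do rewrite -gauss_density_scale -cE.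
    move=> <-; rewrite /Rintegral; congr fine.
    by apply: eq_integral => x _; rewrite mul1r.
  (* multiplication by - i turns the imaginary part into a real part *)
  have := @iint_gauss_density_imag _ (fun j => s * a j) b (0 -i* 1).
  rewrite /= -qE => /(_ q0 (lexx 0)); rewrite mul0e => /(congr1 fine)/= <-.
  rewrite /Rintegral; congr fine; apply: eq_integral => x _.
  rewrite -/(P x); case: (P x) => A B; simpc => /=.
  by [].
move=> x; rewrite /csqrt leNgt c0 /=.
have ss : s = Num.sqrt (- c) by rewrite /s ltr0_norm.
have Pj j : (if b j then Phi ((a j)%:C * (0 +i* Num.sqrt (- c)) * x%:C) else 1) =
    (expR (- (-1 * (s * a j * x) ^+ 2) / 2))%:C * fourier_weight (b j) (s * a j * x).
  rewrite -ss mulN1r opprK; case: (b j).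
    rewrite (_ : _ * x%:C = 0 +i* (s * a j * x)) ?Phi_imag//.
    by simpc; rewrite (mulrC (a j)).
  by rewrite fourier_weight_false -rmorphM -expRD -mulrDl addrN mul0r expR0.
under eq_bigr do rewrite Pj.
rewrite big_split/= -rmorph_prod/= prod_expR mulrAC -rmorphM/= -/(P x).
have -> : expR (\sum_i - (-1 * (s * a i * x) ^+ 2) / 2) * expR (- x ^+ 2 / 2) = gauss q x.
  have -> : q = 1 + -1 * \sum_j (s * a j) ^+ 2 by rewrite mulN1r.
  by rewrite -gauss_shift /gauss mul1r.
by case: (P x) => A B; simpc; rewrite mulrC (mulrC B).
Qed.

End gaussian_mean_Phi.

(** * Solid angles from Gaussian integrals *)

Section cone_integrals.
Context {R : realType} (n : nat).
Local Open Scope ereal_scope.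

Context (q : 'rV[R]_n -> R) (K : set 'rV[R]_n).
Hypothesis mq : measurable_row (fun v => (q v)%:E).

(** The counterpart for sets of [measurable_row]. *)
Definition test_measurable (A : set 'rV[R]_n) :=
  forall d (T : measurableType d) (X : T -> 'rV[R]_n),
    coord_measurable X -> measurable (X @^-1` A).

Definition sublevel (r : R) : set 'rV[R]_n := [set v | (q v <= r)%R].

Lemma test_measurableI (A B : set 'rV[R]_n) :
  test_measurable A -> test_measurable B -> test_measurable (A `&` B).
Proof.
by move=> mA mB d T X mX; rewrite preimage_setI; apply: measurableI; [exact: mA|exact: mB].
Qed.

Lemma test_measurable_sublevel r : test_measurable (sublevel r).
Proof.
move=> d T X mX; have /measurable_EFinP := mq mX.
move=> m; rewrite (_ : _ @^-1` _ = (fun w => q (X w)) @^-1` `]-oo, r]%classic).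
  by rewrite -[X in measurable X]setTI; exact: m.
by apply/seteqP; split=> w /=; rewrite in_itv.
Qed.

Definition cone_volume := iint (fun v => (\1_(K `&` sublevel 1) v)%:E).
Definition cone_gauss := iint (fun v => (\1_K v * expR (- q v / 2))%:E).

(** The slice at height s, for s in the open unit interval, of the region under the
graph of exp (- q / 2) over K. *)
Definition cone_slice (s : R) (v : 'rV[R]_n) : \bar R :=
  (\1_`]0%R, 1%R[ s * \1_`]-oo, expR (- q v / 2)] s * \1_K v)%:E.

End cone_integrals.

Section cone_ratio.
Context {R : realType} (n : nat).
Local Notation mu := (@lebesgue_measure R).
Local Open Scope ereal_scope.
Context (q : 'rV[R]_n -> R).
Hypothesis q_ge0 : forall v, (0 <= q v)%R.
Hypothesis qZ : forall (r : R) v, q (r *: v)%R = (r ^+ 2 * q v)%R.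
Hypothesis mq : measurable_row (fun v => (q v)%:E).

Definition scale_invariant (K : set 'rV[R]_n) :=
  forall (r : R) v, (0 < r)%R -> K (r *: v)%R <-> K v.

Lemma measurable_row_gauss_cone (K : set 'rV[R]_n) : test_measurable K ->
  measurable_row (fun v => (\1_K v * expR (- q v / 2))%:E).
Proof.
move=> mK d T X mX; apply/measurable_EFinP; apply: measurable_funM.
  by have /measurable_EFinP := measurable_row_indic mK mX.
apply: measurableT_comp => //; apply: measurable_funM => //.
by apply: measurableT_comp => //; have /measurable_EFinP := mq mX.
Qed.

Lemma cone_slice_ge0 K s v : 0 <= cone_slice q K s v.
Proof. by rewrite lee_fin !mulr_ge0. Qed.

Lemma integral_cone_slice K v :
  \int[mu]_s cone_slice q K s v = (\1_K v * expR (- q v / 2))%:E.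
Proof.
have e0 := expR_gt0 (- q v / 2).
have e1 : (expR (- q v / 2) <= 1)%R.
  by rewrite -expR0 ler_expR mulNr oppr_le0 mulr_ge0// invr_ge0.
transitivity (\int[mu]_s ((\1_K v)%:E *
    (\1_(`]0%R, 1%R[ `&` `]-oo, expR (- q v / 2)]) s)%:E)).
  apply: eq_integral => s _; rewrite /cone_slice indicI -EFinM; congr EFin.
  by rewrite mulrC.
rewrite ge0_integralZl//; last first.
  apply/measurable_EFinP; apply: measurable_indic.
  by apply: measurableI; exact: measurable_itv.
rewrite EFinM; congr (_ * _).
rewrite integral_indic//=; last by apply: measurableI; exact: measurable_itv.
rewrite setIT.
have [e1'|e1'] := ltP (expR (- q v / 2)) 1%R.
  rewrite (_ : _ `&` _ = `]0%R, expR (- q v / 2)]%classic); last first.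
    apply/seteqP; split=> x /=; rewrite !in_itv/=.
      by move=> [/andP[-> _] ->].
    by move=> /andP[x0 xe]; rewrite x0 xe; split=> //; exact: le_lt_trans xe e1'.
  by rewrite lebesgue_measure_itv/= lte_fin e0 oppr0 adde0.
have -> : expR (- q v / 2) = 1%R by apply/eqP; rewrite eq_le e1 e1'.
rewrite (_ : _ `&` _ = `]0%R, 1%R[%classic); last first.
  apply/seteqP; split=> x /=; rewrite !in_itv/=; first by case.
  by move=> /andP[x0 x1]; rewrite x0 x1 ltW.
by rewrite lebesgue_measure_itv/= lte_fin ltr01 oppr0 adde0.
Qed.

Lemma measurable_cone_slice K : test_measurable K ->
  measurable_param (cone_slice q K).
Proof.
move=> mK d T h X mh mX; apply/measurable_EFinP; apply: measurable_funM.
  apply: measurable_funM.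
    exact: (measurableT_comp (measurable_indic (measurable_itv _)) mh).
  have me : measurable_fun setT (fun w => expR (- q (X w) / 2)).
    apply: measurableT_comp => //; apply: measurable_funM => //.
    by apply: measurableT_comp => //; have /measurable_EFinP := mq mX.
  rewrite (_ : (fun w => _) = \1_[set w | (h w <= expR (- q (X w) / 2))%R]).
    apply: measurable_indic.
    rewrite (_ : [set w | _] = (fun w => (expR (- q (X w) / 2) - h w)%R) @^-1` `[0%R, +oo[%classic).
      by rewrite -[X in measurable X]setTI; exact: measurable_funB.
    by apply/seteqP; split=> w /=; rewrite in_itv/= andbT subr_ge0.
  by apply/funext => w; rewrite !indicE; congr (_ %:R)%R; congr nat_of_bool.
by have /measurable_EFinP := measurable_row_indic mK mX.
Qed.

Lemma cone_gaussE K : test_measurable K ->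
  cone_gauss q K = \int[mu]_s iint (cone_slice q K s).
Proof.
move=> mK; rewrite integral_iint_swap.
- by congr iint; apply/funext => v; rewrite integral_cone_slice.
- exact: measurable_cone_slice.
- exact: cone_slice_ge0.
Qed.

Lemma measurable_iint_cone_slice K : test_measurable K ->
  measurable_fun setT (fun s => iint (cone_slice q K s)).
Proof.
move=> mK; apply: measurable_iint; first exact: measurable_cone_slice.
exact: cone_slice_ge0.
Qed.

(** The slice at height s is the part of the cone where q <= - 2 ln s, a homothetic
copy of the unit ball in the cone; the ratio of volumes depends on s only. *)
Lemma iint_cone_slice (s : R) : exists2 c : R, (0 <= c)%R &
  forall K, test_measurable K -> scale_invariant K ->
    iint (cone_slice q K s) = c%:E * cone_volume q K.
Proof.
have [s01|s01] := boolP (s \in `]0%R, 1%R[); last first.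
  exists 0%R => // K _ _; rewrite mul0e.
  have -> : cone_slice q K s = (fun v => 0 * (\1_K v)%:E).
    apply/funext => v; rewrite /cone_slice mul0e indicE (_ : (_ \in _) = false) ?mul0r//.
    by apply/negbTE; rewrite mem_setE.
  under eq_fun do rewrite mul0e.
  rewrite -[X in iint X](_ : (fun=> 0 * 0) = _); last by apply/funext => v; rewrite mul0e.
  rewrite (ge0_iintZl (f := cst 0))// ?mul0e// => d T X mX.
  exact: measurable_cst.
(* s <= exp (- q / 2) means q <= r ^+ 2 *)
pose r := Num.sqrt (- (2 * ln s)).
have [s0 s1] : (0 < s /\ s < 1)%R by move: s01; rewrite in_itv/= => /andP[].
have l0 : (0 < - (2 * ln s))%R by rewrite oppr_gt0 pmulr_rlt0// ln_lt0// s0 s1.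
have r0 : (0 < r)%R by rewrite sqrtr_gt0.
have r2 : (r ^+ 2 = - (2 * ln s))%R by rewrite sqr_sqrtr// ltW.
have uM : (r^-1)%:M \in @unitmx R n.
  by rewrite -scalemx1 unitmxZ ?unitmx1// unitfE invr_eq0 gt_eqF.
have [c c0 cE] := iint_mulmx uM.
exists c => [|K mK hK]; first exact: ltW.
rewrite -cE; last 2 first.
- apply: measurable_row_indic; apply: test_measurableI => //.
  exact: test_measurable_sublevel.
- by move=> v; rewrite lee_fin.
congr iint; apply/funext => v; rewrite /cone_slice; congr EFin.
rewrite mul_mx_scalar indicI.
rewrite [X in (X * _ * _)%R]indicE mem_setE s01 mul1r mulrC; congr (_ * _)%R.
  rewrite !indicE; congr (_ %:R)%R; congr nat_of_bool.
  by apply/idP/idP; rewrite !inE => /hK; apply; rewrite invr_gt0.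
rewrite !indicE; congr (_ %:R)%R; congr nat_of_bool.
have E : (s <= expR (- q v / 2))%R = (q (r^-1 *: v) <= 1)%R.
  rewrite qZ exprVn ler_pdivrMl ?exprn_gt0// mulr1 r2.
  rewrite -[in LHS](lnK s0) ler_expR.
  by apply/idP/idP; lra.
by apply/idP/idP; rewrite !inE /= in_itv/= E.
Qed.

(** Layer-cake integration over the heights s: every slice contributes the same
multiple of the ball volume for K and for the whole space. *)
Lemma cone_gauss_volume K : test_measurable K -> scale_invariant K ->
  cone_gauss q K * cone_volume q setT = cone_volume q K * cone_gauss q setT.
Proof.
move=> mK hK.
have mT : @test_measurable R n setT by move=> d T X _; rewrite preimage_setT.
have hT : scale_invariant setT by [].
have V0 L : 0 <= cone_volume q L by apply: iint_ge0 => v; rewrite lee_fin.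
have S0 L s : 0 <= iint (cone_slice q L s).
  by apply: iint_ge0 => v; exact: cone_slice_ge0.
rewrite !cone_gaussE// -ge0_integralZr//; last exact: measurable_iint_cone_slice.
rewrite -ge0_integralZl//; last exact: measurable_iint_cone_slice.
apply: eq_integral => s _; have [c c0 cE] := iint_cone_slice s.
by rewrite !cE// muleCA muleA.
Qed.

Lemma cone_volume_setT_gt0 : 0 < cone_gauss q setT ->
  0 < cone_volume q setT.
Proof.
move=> I0; rewrite lt0e; apply/andP; split; last first.
  by apply: iint_ge0 => v; rewrite lee_fin.
apply/eqP => V0; move: I0.
have mT : @test_measurable R n setT by move=> d T X _; rewrite preimage_setT.
rewrite cone_gaussE// (_ : (fun s => _) = cst 0); first by rewrite integral0 ltxx.
apply/funext => s; have [c c0 cE] := iint_cone_slice s.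
by rewrite cE// V0 mule0.
Qed.

Lemma cone_volume_lty : cone_gauss q setT < +oo ->
  forall K, test_measurable K -> cone_volume q K < +oo.
Proof.
move=> I0 K mK.
have mT : @test_measurable R n setT by move=> d T X _; rewrite preimage_setT.
apply: (@le_lt_trans _ _ ((expR 2^-1)%:E * cone_gauss q setT)); last first.
  rewrite lte_mul_pinfty// ?lee_fin ?expR_ge0//.
rewrite /cone_gauss -ge0_iintZl//; last first.
  exact: measurable_row_gauss_cone.
apply: le_iint.
- apply: measurable_row_indic; apply: test_measurableI => //.
  exact: test_measurable_sublevel.
- move=> d T X mX; apply: emeasurable_funM => //.
  exact: measurable_row_gauss_cone.
- by move=> v; rewrite lee_fin.
- move=> v; rewrite -EFinM lee_fin (indicE _ setT) in_setT mul1r -expRD indicE.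
  have [|_] := boolP (v \in _); last exact: expR_ge0.
  rewrite inE => -[_ /= q1]; rewrite -[leLHS]expR0 ler_expR.
  have : (q v <= 1)%R by exact: q1.
  by lra.
Qed.

End cone_ratio.

Section rank_one.
Context {R : realType} (n : nat) (a : 'I_n -> R).

Let r : 'rV[R]_n := \row_j a j.
Let N : R := \sum_j a j ^+ 2.

(** The matrix 1 - gamma a^T a; these matrices form a commutative family closed under
products, and under inverses and square roots as far as these exist. *)
Definition rank_one (gamma : R) : 'M[R]_n :=
  \matrix_(i, j) ((i == j)%:R - gamma * (a i * a j)).

Let rank_oneE gamma : rank_one gamma = 1%:M - gamma *: (r^T *m r).
Proof.
by apply/matrixP => i j; rewrite !mxE big_ord1 !mxE.
Qed.

Let rr : (r^T *m r) *m (r^T *m r) = N *: (r^T *m r).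
Proof.
rewrite mulmxA -(mulmxA r^T) (_ : r *m r^T = N%:M).
  by rewrite mul_mx_scalar -scalemxAl.
apply/matrixP => i j; rewrite !ord1 !mxE eqxx mulr1n.
by apply: eq_bigr => k _; rewrite !mxE expr2.
Qed.

Lemma rank_one_mul beta gamma :
  rank_one beta *m rank_one gamma = rank_one (beta + gamma - beta * gamma * N).
Proof.
rewrite !rank_oneE mulmxBl mul1mx mulmxBr mulmx1.
rewrite -!scalemxAl -!scalemxAr rr !scalerA.
apply/matrixP => i j; rewrite !mxE big_ord1 !mxE.
by ring.
Qed.

Lemma rank_one_form gamma (y z : 'rV[R]_n) :
  (y *m rank_one gamma *m z^T) 0 0 =
  \sum_j y 0 j * z 0 j - gamma * (\sum_j a j * y 0 j) * (\sum_j a j * z 0 j).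
Proof.
rewrite rank_oneE mulmxBr mulmx1 mulmxBl -scalemxAr -scalemxAl.
have : (y *m (r^T *m r) *m z^T) 0 0 = (\sum_j a j * y 0 j) * (\sum_j a j * z 0 j).
  rewrite mulmxA -mulmxA mxE big_ord1 !mxE.
  by congr (_ * _); apply: eq_bigr => j _; rewrite !mxE// mulrC.
move: (_ *m z^T) => X XE; rewrite [LHS]mxE [in X in _ + X]mxE [in X in _ - X]mxE XE.
rewrite mulrA mxE; congr (_ - _); apply: eq_bigr => j _.
by rewrite mxE.
Qed.

Lemma rank_one0 : rank_one 0 = 1%:M.
Proof. by rewrite rank_oneE scale0r subr0. Qed.

Lemma tr_rank_one gamma : (rank_one gamma)^T = rank_one gamma.
Proof.
by apply/matrixP => i j; rewrite !mxE eq_sym (mulrC (a j)).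
Qed.

Lemma rank_one_inv gamma : 1 - gamma * N != 0 ->
  rank_one gamma *m rank_one (- gamma / (1 - gamma * N)) = 1%:M.
Proof.
move=> h; rewrite rank_one_mul -rank_one0; congr rank_one.
by field.
Qed.

Lemma rank_one_unit gamma : 1 - gamma * N != 0 -> rank_one gamma \in unitmx.
Proof. by move=> /rank_one_inv/mulmx1_unit[]. Qed.

(** On the line of a the matrix acts by 1 - gamma |a|^2 and elsewhere by 1, so it is
enough to take the square root of this number. *)
Lemma rank_one_sqrt gamma : 0 < 1 - gamma * N ->
  exists beta, rank_one beta \in unitmx /\
    rank_one beta *m rank_one beta = rank_one gamma.
Proof.
move=> h; pose s := Num.sqrt (1 - gamma * N).
have s0 : 0 < s by rewrite sqrtr_gt0.
have s2 : s ^+ 2 = 1 - gamma * N by rewrite sqr_sqrtr// ltW.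
suff [beta E] : exists beta, rank_one beta *m rank_one beta = rank_one gamma.
  exists beta; split=> //; have : rank_one gamma \in unitmx.
    by apply: rank_one_unit; rewrite gt_eqF.
  by rewrite -E unitmx_mul => /andP[].
have [N0|N0] := eqVneq N 0.
  exists (gamma / 2); rewrite rank_one_mul; congr rank_one.
  by rewrite N0 mulr0 subr0; field.
(* the eigenvalue 1 - beta N of the root must be s *)
exists ((1 - s) / N); rewrite rank_one_mul; congr rank_one.
have -> : gamma = (1 - s ^+ 2) / N by rewrite s2; field.
by field.
Qed.

Lemma det_rank_one_gt0 gamma : 0 < 1 - gamma * N -> 0 < \det (rank_one gamma).
Proof.
move=> /rank_one_sqrt[beta [u <-]]; rewrite det_mulmx -expr2.
by rewrite exprn_even_gt0//= -unitfE -unitmxE.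
Qed.

End rank_one.

Section scalar_functions.
Context {R : realType} (V : lmodType R) (f : V -> R).
Hypothesis fl : scalar f.

Lemma scalar_scale c v : f (c *: v) = c * f v.
Proof.
have f0 : f 0 = 0.
  by have := fl (-1) 0 0; rewrite scaler0 addr0 mulN1r addNr.
by have := fl c v 0; rewrite !addr0 f0 addr0.
Qed.

Lemma scalar_sum n (y : 'I_n -> R) (w : 'I_n -> V) :
  f (\sum_i y i *: w i) = \sum_i y i * f (w i).
Proof.
have f0 : f 0 = 0 by rewrite -(scale0r 0) scalar_scale mul0r.
apply: (big_ind2 (fun s t => f s = t)) => //= [s t s' t' <- <-|i _].
  by have := fl 1 s s'; rewrite scale1r mul1r.
exact: scalar_scale.
Qed.

End scalar_functions.

Section solid_angle_orthant.
Context {R : realType} (V : vectType R) (g : V -> V -> R).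
Hypothesis gl : forall u, scalar (g u).
Hypothesis gr : forall u, scalar (g ^~ u).

Lemma bilinear_sum n (w w' : 'I_n -> V) (x y : 'I_n -> R) :
  g (\sum_i x i *: w i) (\sum_j y j *: w' j) =
  \sum_i \sum_j x i * y j * g (w i) (w' j).
Proof.
have := scalar_sum (gr (\sum_j y j *: w' j)) x w; rewrite /= => ->.
apply: eq_bigr => i _; rewrite (scalar_sum (gl (w i))) mulr_sumr.
by apply: eq_bigr => j _; rewrite mulrA.
Qed.

Context (n : nat) (w : n.-tuple V) (c : R) (a : 'I_n -> R) (b : 'I_n -> bool).
Let Q : R := 1 + c * \sum_j a j ^+ 2.
Hypothesis Q0 : 0 < Q.
Hypothesis gw : forall i j : 'I_n, g w`_i w`_j = (i == j)%:R - c / Q * (a i * a j).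

Let q (t : 'rV[R]_n) : R :=
  g (\sum_j t 0 j *: w`_j) (\sum_j t 0 j *: w`_j).

Let qE t : q t = \sum_j t 0 j ^+ 2 - c / Q * (\sum_j a j * t 0 j) ^+ 2.
Proof.
rewrite /q bilinear_sum expr2 mulr_suml mulr_sumr -sumrB; apply: eq_bigr => i _.
under eq_bigr do rewrite gw mulrBr.
rewrite sumrB (bigD1 i)//= eqxx mulr1 big1 ?addr0.
  rewrite expr2; congr (_ - _); rewrite mulr_sumr mulr_sumr; apply: eq_bigr => j _.
  by ring.
by move=> j; rewrite eq_sym => /negbTE ->; rewrite mulr0.
Qed.

Let cQ : 0 < 1 - c / Q * \sum_j a j ^+ 2.
Proof.
have -> : 1 - c / Q * \sum_j a j ^+ 2 = Q^-1.
  rewrite -[X in X - _](mulfV (lt0r_neq0 Q0)) mulrAC -mulrBl /Q.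
  by rewrite addrK mul1r.
by rewrite invr_gt0.
Qed.

Let q_ge0 t : 0 <= q t.
Proof.
have [beta [_ E]] := rank_one_sqrt cQ.
suff -> : q t = \sum_j ((t *m rank_one a beta) 0 j) ^+ 2.
  by apply: sumr_ge0 => j _; rewrite sqr_ge0.
transitivity ((t *m rank_one a (c / Q) *m t^T) 0 0).
  by rewrite rank_one_form qE [X in _ * X]expr2 mulrA.
rewrite -E !mulmxA -mulmxA -{2}(tr_rank_one a beta) -trmx_mul mxE.
by apply: eq_bigr => j _; rewrite [X in _ * X]mxE expr2.
Qed.

Let qZ (r : R) t : q (r *: t) = r ^+ 2 * q t.
Proof.
rewrite !qE mulrBr; congr (_ - _).
  by rewrite mulr_sumr; apply: eq_bigr => j _; rewrite mxE exprMn.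
have -> : \sum_j a j * (r *: t) 0 j = r * \sum_j a j * t 0 j.
  by rewrite mulr_sumr; apply: eq_bigr => j _; rewrite mxE mulrCA.
by rewrite exprMn mulrCA.
Qed.

Let mq : measurable_row (fun t => (q t)%:E).
Proof.
move=> d T X mX; apply/measurable_EFinP; rewrite /comp.
under eq_fun do rewrite qE.
apply: measurable_funB.
  by apply: measurable_sum => j; apply: measurable_funX; exact: mX.
apply: measurable_funM => //; apply: measurable_funX.
by apply: measurable_sum => j; apply: measurable_funM => //; exact: mX.
Qed.

Definition orthant : set 'rV[R]_n := [set t | forall j, b j -> 0 <= t 0 j].

Let mO : test_measurable orthant.
Proof.
move=> d T X mX.
rewrite (_ : _ @^-1` _ = \bigcap_(j in [set j | b j])
    ((fun w => X w 0 j) @^-1` `[0, +oo[%classic)).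
  apply: fin_bigcap_measurable => // j _.
  by rewrite -[X in measurable X]setTI; exact: mX.
apply/seteqP; split=> z h j /=; first by rewrite in_itv/= andbT; exact: h.
by move=> /(h j); rewrite /= in_itv/= andbT.
Qed.

Let cO : scale_invariant orthant.
Proof.
move=> r t r0; split=> h j bj; have := h j bj; rewrite mxE.
  by rewrite pmulr_rge0.
by rewrite pmulr_rge0.
Qed.

Let K0 : R := isqrt2pi ^+ n * (Num.sqrt Q)^-1.

Let K0_gt0 : 0 < K0.
Proof. by rewrite mulr_gt0 ?exprn_gt0 ?isqrt2pi_gt0// invr_gt0 sqrtr_gt0. Qed.

Let sum_half (t : 'rV[R]_n) : \prod_j gauss 1 (t 0 j) *
  expR (c * (\sum_j a j * t 0 j) ^+ 2 / (2 * Q)) = expR (- q t / 2).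
Proof.
rewrite /gauss prod_expR -expRD; congr expR; rewrite qE.
under eq_bigr do rewrite mul1r.
rewrite -mulr_suml sumrN.
by move: (\sum_j _) (\sum_j _) => u v; field; rewrite gt_eqF.
Qed.

Let prod_wdom (t : 'rV[R]_n) :
  \prod_j \1_(wdom (b j)) (t 0 j) = \1_orthant t :> R.
Proof.
have [tO|tO] := pselect (orthant t).
  rewrite [RHS]indicE mem_set// big1// => j _; rewrite indicE mem_set//.
  by rewrite /wdom; case: ifP => // bj; rewrite /= in_itv/= andbT tO.
rewrite [RHS]indicE memNset//.
have [j [bj tj]] : exists j, b j /\ ~ 0 <= t 0 j.
  apply: contrapT => H; apply: tO => j bj; apply: contrapT => H'.
  by apply: H; exists j.
rewrite (bigD1 j)//= indicE memNset ?mul0r// /wdom bj /= in_itv/= andbT.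
exact: tj.
Qed.

Let density_cone (t : 'rV[R]_n) :
  gauss_density c Q 0 a b t = K0 * (\1_orthant t * expR (- q t / 2)).
Proof.
rewrite /gauss_density add0r -sum_half /weight big_split/= prod_wdom.
rewrite big_split/= prodr_const card_ord /K0.
by move: (expR _) (\prod_j _) (\1_orthant t) => u v z; ring.
Qed.

Let iint_density_cone :
  (iint (fun t : 'rV[R]_n => (gauss_density c Q 0 a b t)%:E) =
  K0%:E * cone_gauss q orthant)%E.
Proof.
rewrite /cone_gauss -ge0_iintZl//.
- by congr iint; apply/funext => t; rewrite density_cone EFinM.
- exact: measurable_row_gauss_cone.
- by rewrite lee_fin ltW.
Qed.

Let wvec (t : 'rV[R]_n) : V := \sum_j t 0 j *: w`_j.

(** The basis chosen by [subspace_vol] is replaced by w: the Gram determinant and the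
change of variables contribute one positive factor, common to all sets. *)
Lemma subspace_vol_basis m (e : m.-tuple V) (L : {vspace V}) :
  basis_of L e -> basis_of L w -> exists2 s : R, 0 < s & forall A : set V,
    test_measurable [set t | A (wvec t)] ->
    ((Num.sqrt (\det (\matrix_(i < m, j < m) g e`_i e`_j)))%:E *
      lebesgue_vol [set x : 'rV[R]_m | A (\sum_i x 0 i *: e`_i)%R] =
    s%:E * iint (fun t => (\1_[set t | A (wvec t)] t)%:E))%E.
Proof.
move=> be bw.
have mn : m = n by rewrite -(size_basis be) (size_basis bw).
subst m.
pose M : 'M[R]_n := \matrix_(i, j) coord w j e`_i.
pose M' : 'M[R]_n := \matrix_(i, j) coord e j w`_i.
have eL (i : 'I_n) : e`_i \in L by apply: (basis_mem be); rewrite mem_nth ?size_tuple.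
have wL (i : 'I_n) : w`_i \in L by apply: (basis_mem bw); rewrite mem_nth ?size_tuple.
have eM (i : 'I_n) : e`_i = \sum_j M i j *: w`_j.
  by rewrite {1}(coord_basis bw (eL i)); apply: eq_bigr => j _; rewrite mxE.
have uM : M \in unitmx.
  suff /mulmx1_unit[] : M *m M' = 1%:M by [].
  apply/matrixP => i j; rewrite !mxE.
  have fe : free e by case/andP: be.
  rewrite -(coord_free i j fe) [in RHS](eM i) linear_sum/=; apply: eq_bigr => k _.
  by rewrite linearZ/= !mxE.
have wM (x : 'rV[R]_n) : \sum_i x 0 i *: e`_i = wvec (x *m M).
  rewrite /wvec; under [RHS]eq_bigr do rewrite mxE scaler_suml.
  rewrite exchange_big/=; apply: eq_bigr => i _.
  by rewrite {1}(eM i) scaler_sumr; apply: eq_bigr => j _; rewrite scalerA.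
have gramE : \matrix_(i < n, j < n) g e`_i e`_j = M *m rank_one a (c / Q) *m M^T.
  apply/matrixP => i j; rewrite !mxE {1}(eM i) {1}(eM j) bilinear_sum.
  rewrite exchange_big/=; apply: eq_bigr => k _.
  rewrite !mxE mulr_suml; apply: eq_bigr => l _.
  by rewrite !mxE gw mulrAC.
have [s s0 sE] := iint_mulmx uM.
have d0 : 0 < \det (\matrix_(i < n, j < n) g e`_i e`_j).
  rewrite gramE !det_mulmx det_tr mulrAC -expr2.
  by rewrite mulr_gt0 ?det_rank_one_gt0// exprn_even_gt0//= -unitfE -unitmxE.
exists (Num.sqrt (\det (\matrix_(i < n, j < n) g e`_i e`_j)) * s).
  by rewrite mulr_gt0 ?sqrtr_gt0.
move=> A mA; rewrite EFinM -muleA; congr (_ * _)%E.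
rewrite -sE//; last exact: measurable_row_indic.
rewrite lebesgue_vol_iint; congr iint; apply/funext => x; congr EFin.
rewrite !indicE; congr (_ %:R); congr nat_of_bool.
by apply/idP/idP; rewrite !inE /= wM.
Qed.

(** The common factor cancels in the ratio of volumes, which is turned into a ratio
of Gaussian integrals; the total mass is 1 by [iint_gauss_density_total]. *)
Lemma solid_angle_orthant (K : set V) : basis_of (lin_hull K) w ->
  (forall t, K (wvec t) <-> orthant t) ->
  solid_angle g K =
    fine (iint (fun t : 'rV[R]_n => (gauss_density c Q 0 a b t)%:E)).
Proof.
move=> bw hK.
have [s s0 sE] := subspace_vol_basis (vbasisP (lin_hull K)) bw.
have B1 : [set t | g (wvec t) (wvec t) <= 1] = sublevel q 1 by [].
have T1 : [set t | (([set` lin_hull K] `&` [set u | g u u <= 1]) (wvec t))] =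
    setT `&` sublevel q 1.
  apply/seteqP; split=> t /=; first by case.
  case=> _ t1; split=> //=; apply: memv_suml => j _; apply: memvZ.
  by apply: (basis_mem bw); rewrite mem_nth ?size_tuple.
have K1 : [set t | ((K `&` [set u | g u u <= 1]) (wvec t))] =
    orthant `&` sublevel q 1.
  by apply/seteqP; split=> t /= [] /hK ? ?; split => //; exact/hK.
have mT : @test_measurable R n setT by move=> d T X _; rewrite preimage_setT.
have mB := test_measurable_sublevel mq 1.
transitivity (fine (s%:E * cone_volume q orthant) /
    fine (s%:E * cone_volume q setT)).
  rewrite /cone_volume -K1 -T1 -!sE//; first by rewrite T1; exact: test_measurableI.
  by rewrite K1; exact: test_measurableI.
have total := iint_gauss_density_total Q0.
have totalE : (K0%:E * cone_gauss q setT = 1)%E.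
  rewrite -total /cone_gauss -ge0_iintZl//.
  - congr iint; apply/funext => t; rewrite -EFinM; congr EFin.
    rewrite indicE in_setT mul1r /gauss_density add0r -sum_half.
    under [in RHS]eq_bigr do rewrite /weight indicE in_setT mul1r.
    rewrite big_split/= prodr_const card_ord /K0.
    by move: (expR _) (\prod_j _) => u v; ring.
  - exact: measurable_row_gauss_cone.
  - by rewrite lee_fin ltW.
have G0 : (0 <= cone_gauss q setT)%E.
  by apply: iint_ge0 => t; rewrite lee_fin mulr_ge0 ?expR_ge0.
have Gfin : (cone_gauss q setT < +oo)%E.
  rewrite ltNge; apply/negP; rewrite leye_eq => /eqP Gy.
  by move: totalE; rewrite Gy gt0_muley.
have Ggt0 : (0 < cone_gauss q setT)%E.
  rewrite lt0e G0 andbT; apply/eqP => Gz.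
  by move: totalE; rewrite Gz mule0 => -[]/esym/eqP; rewrite oner_eq0.
have VT := cone_volume_setT_gt0 q_ge0 qZ mq Ggt0.
have VTf : cone_volume q setT \is a fin_num.
  by rewrite ge0_fin_numE ?(ltW VT)//; exact: cone_volume_lty.
have VKf : cone_volume q orthant \is a fin_num.
  rewrite ge0_fin_numE; first exact: cone_volume_lty.
  by apply: iint_ge0 => t; rewrite lee_fin.
have H := cone_gauss_volume q_ge0 qZ mq mO cO.
have Dfin := iint_gauss_density_fin_num b Q0.
rewrite !fineM// -mulf_div divff ?gt_eqF// mul1r.
have VT0 : fine (cone_volume q setT) != 0.
  by rewrite gt_eqF// fine_gt0// VT; exact: cone_volume_lty.
apply: (mulIf VT0); rewrite divfK//.
apply: EFin_inj; rewrite EFinM !fineK//.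
rewrite iint_density_cone -muleA H muleCA totalE mule1.
by [].
Qed.

End solid_angle_orthant.

(** * Cones parametrized by a basis *)

Section lin_hull_theory.
Context {R : realType}.

Lemma lin_hull_eq (V : vectType R) (K : set V) (L : {vspace V}) :
  is_lin_hull K L -> lin_hull K = L.
Proof.
move=> [KL L1]; have [KH H1] := lin_hullP K.
by apply/eqP; rewrite eqEsubv (H1 _ KL) (L1 _ KH).
Qed.

Lemma lin_hull_image (V W : vectType R) (f : 'Hom(V, W)) (K : set V) :
  lin_hull [set f u | u in K] = (f @: lin_hull K)%VS.
Proof.
have [KH H1] := lin_hullP K.
apply: lin_hull_eq; split=> [_ [u Ku <-]|U fU] /=.
  by apply: memv_img; exact: KH.
have /H1 : K `<=` [set` (f @^-1: U)%VS].
  by move=> u Ku /=; rewrite -memv_preim; apply: fU; exists u.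
move=> /subvP HU; apply/subvP => _ /memv_imgP[u uH ->].
by have := HU _ uH; rewrite -memv_preim.
Qed.

End lin_hull_theory.

Section cone_param.
Context {R : realType}.

Definition lincomb (V : vectType R) n (w : 'I_n -> V) (t : 'rV[R]_n) : V :=
  \sum_j t 0 j *: w j.

(** The last condition makes the vectors w themselves members of K, so that they span
its linear hull. *)
Definition cone_param (V : vectType R) (K : set V) n (w : 'I_n -> V)
    (O : set 'rV[R]_n) :=
  [/\ forall t, lincomb w t = 0 -> t = 0, K = [set lincomb w t | t in O] &
      forall i, O (delta_mx 0 i)].

Lemma lincombB (V : vectType R) n (w : 'I_n -> V) t t' :
  lincomb w (t - t') = lincomb w t - lincomb w t'.
Proof.
by rewrite /lincomb -sumrB; apply: eq_bigr => j _; rewrite !mxE scalerBl.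
Qed.

Lemma lincomb_delta (V : vectType R) n (w : 'I_n -> V) i :
  lincomb w (delta_mx 0 i) = w i.
Proof.
rewrite /lincomb (bigD1 i)//= mxE !eqxx scale1r big1 ?addr0// => j ji.
by rewrite mxE (negbTE ji) andbF scale0r.
Qed.

Context (V : vectType R) (K : set V) (n : nat) (w : 'I_n -> V) (O : set 'rV[R]_n).
Hypothesis Kw : cone_param K w O.

Lemma lincomb_inj : injective (lincomb w).
Proof.
case: Kw => fw _ _ t t' /eqP; rewrite -subr_eq0 -lincombB => /eqP/fw/eqP.
by rewrite subr_eq0 => /eqP.
Qed.

Lemma cone_paramP t : K (lincomb w t) <-> O t.
Proof.
case: (Kw) => _ -> _; split=> [[t' Ot' /lincomb_inj <-//]|Ot].
by exists t.
Qed.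

Let W := [tuple w i | i < n].

Lemma nth_tuple_basis (i : 'I_n) : W`_i = w i.
Proof. by rewrite -tnth_nth tnth_mktuple. Qed.

Lemma cone_param_basis : basis_of (lin_hull K) W.
Proof.
case: (Kw) => fw KE Oe; rewrite /basis_of; apply/andP; split; last first.
  apply/freeP => k H i; pose t : 'rV[R]_n := \row_j k j.
  suff : t = 0 by move=> /rowP/(_ i); rewrite !mxE.
  apply: fw; rewrite -[RHS]H; apply: eq_bigr => j _.
  by rewrite nth_tuple_basis mxE.
apply/eqP/esym; apply: lin_hull_eq; split=> [u|U KU].
  rewrite KE => -[t _ <-] /=; apply: memv_suml => j _; apply: memvZ.
  by apply: memv_span; rewrite -nth_tuple_basis mem_nth ?size_tuple.
apply/span_subvP => u /mapP[i _ ->]; apply: KU.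
by rewrite KE; exists (delta_mx 0 i) => //; exact: lincomb_delta.
Qed.

Lemma isometric_cone_param (W' : vectType R) (g : V -> V -> R)
    (h : W' -> W' -> R) (C : set W') (w' : 'I_n -> W') :
  (forall u, scalar (g u)) -> (forall u, scalar (g ^~ u)) ->
  (forall u, scalar (h u)) -> (forall u, scalar (h ^~ u)) ->
  C = [set lincomb w' t | t in O] ->
  (forall i j, h (w' i) (w' j) = g (w i) (w j)) -> isometric g K h C.
Proof.
move=> gl gr hl hr CE gram; have bW := cone_param_basis.
pose F (u : V) : W' := \sum_i coord W i u *: w' i.
have linF : linear F.
  move=> k u v; rewrite /F scaler_sumr -big_split/=; apply: eq_bigr => i _.
  by rewrite linearP/= scalerDl scalerA.
pose FL : {linear V -> W'} := HB.pack F (GRing.isLinear.Build _ _ _ _ F linF).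
pose f := linfun FL.
have fE u : f u = F u by rewrite lfunE.
have fw t : f (lincomb w t) = lincomb w' t.
  rewrite fE /F; apply: eq_bigr => i _; congr (_ *: _).
  have -> : lincomb w t = \sum_j t 0 j *: W`_j.
    by apply: eq_bigr => j _; rewrite nth_tuple_basis.
  by rewrite coord_sum_free//; case/andP: bW.
have inW u : u \in lin_hull K -> exists t, u = lincomb w t.
  move=> uL; exists (\row_j coord W j u).
  rewrite {1}(coord_basis bW uL); apply: eq_bigr => j _.
  by rewrite nth_tuple_basis mxE.
have fK : [set f u | u in K] = C.
  case: (Kw) => _ KE _; rewrite CE KE; apply/seteqP; split.
    by move=> _ [_ [t Ot <-] <-]; exists t.
  by move=> _ [t Ot <-]; exists (lincomb w t) => //; exists t.
exists f; split => //; last by rewrite -lin_hull_image fK.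
move=> u v /inW[t ->] /inW[t' ->]; rewrite !fw /lincomb.
rewrite (bilinear_sum hl hr) (bilinear_sum gl gr).
by apply: eq_bigr => i _; apply: eq_bigr => j _; rewrite gram.
Qed.

(** Free coordinates ([b j] false) contribute the factor 1. *)
Lemma solid_angle_cone_param (g : V -> V -> R) c (a : 'I_n -> R) b :
  (forall u, scalar (g u)) -> (forall u, scalar (g ^~ u)) ->
  O = orthant b ->
  let Q := 1 + c * \sum_j a j ^+ 2 in 0 < Q ->
  (forall i j, g (w i) (w j) = (i == j)%:R - c / Q * (a i * a j)) ->
  (solid_angle g K)%:C = gaussian_mean (fun x =>
    \prod_j (if b j then Phi ((a j)%:C * csqrt c * x%:C) else 1)).
Proof.
move=> gl gr OE Q Q0 gw; rewrite gaussian_mean_Phi//; congr (_%:C).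
apply: (solid_angle_orthant gl gr (w := W)) => //.
- by move=> i j; rewrite !nth_tuple_basis gw.
- exact: cone_param_basis.
- move=> t; rewrite -OE -cone_paramP.
  by rewrite (eq_bigr (fun j => t 0 j *: w j))// => j _; rewrite nth_tuple_basis.
Qed.

End cone_param.

(** * Tangent cones of box faces *)

Section dot_theory.
Context {R : realType} (n : nat).
Implicit Types u v w : 'rV[R]_n.

Lemma dotC u v : dot u v = dot v u.
Proof. by apply: eq_bigr => i _; rewrite mulrC. Qed.

Lemma dot_linear u : scalar (dot u).
Proof.
move=> k v w; rewrite /dot mulr_sumr -big_split/=.
by apply: eq_bigr => i _; rewrite !mxE; ring.
Qed.

Lemma dot_linearl u : scalar (@dot R n ^~ u).
Proof. by move=> k v w; rewrite !(dotC _ u) dot_linear. Qed.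

Lemma dotDr u v w : dot u (v + w) = dot u v + dot u w.
Proof. by have := dot_linear u 1 v w; rewrite scale1r mul1r. Qed.

Lemma dot0r u : dot u 0 = 0.
Proof. by apply: big1 => i _; rewrite mxE mulr0. Qed.

Lemma dot0l u : dot 0 u = 0.
Proof. by rewrite dotC dot0r. Qed.

Lemma dotZr u k v : dot u (k *: v) = k * dot u v.
Proof. by have := dot_linear u k v 0; rewrite !addr0 dot0r addr0. Qed.

Lemma dotDl u v w : dot (v + w) u = dot v u + dot w u.
Proof. by rewrite !(dotC _ u) dotDr. Qed.

Lemma dotZl u k v : dot (k *: v) u = k * dot v u.
Proof. by rewrite !(dotC _ u) dotZr. Qed.

Lemma dot_delta i u : dot (delta_mx 0 i) u = u 0 i.
Proof.
rewrite /dot (bigD1 i)//= mxE !eqxx mul1r big1 ?addr0// => j ji.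
by rewrite mxE (negbTE ji) andbF mul0r.
Qed.

Lemma dot_ge0 u : 0 <= dot u u.
Proof. by apply: sumr_ge0 => i _; rewrite -expr2 sqr_ge0. Qed.

Lemma enorm_sqr u : enorm u ^+ 2 = dot u u.
Proof. by rewrite sqr_sqrtr// dot_ge0. Qed.

Lemma enormZ k u : enorm (k *: u) = `|k| * enorm u.
Proof.
rewrite /enorm dotZr dotZl mulrA -expr2 sqrtrM ?sqr_ge0//.
by rewrite sqrtr_sqr.
Qed.

End dot_theory.

Lemma dot_row_mx (R : realType) m n (u u' : 'rV[R]_m) (v v' : 'rV[R]_n) :
  dot (row_mx u v) (row_mx u' v') = dot u u' + dot v v'.
Proof.
rewrite /dot big_split_ord/=; congr (_ + _); apply: eq_bigr => i _.
  by rewrite !row_mxEl.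
by rewrite !row_mxEr.
Qed.

Section klein_metric_theory.
Context {R : realType} (d : nat) (kappa : R) (x : 'rV[R]_d).
Local Notation g := (klein_metric kappa x).

Lemma klein_metricC u v : g u v = g v u.
Proof. by rewrite /klein_metric dotC (mulrAC kappa). Qed.

Lemma klein_metric_linear u : scalar (g u).
Proof.
by move=> k v w; rewrite /klein_metric !dot_linear; ring.
Qed.

Lemma klein_metric_linearl u : scalar (g ^~ u).
Proof.
by move=> k v w; rewrite !(klein_metricC _ u) klein_metric_linear.
Qed.

Let s := 1 + kappa * dot x x.

Lemma klein_metricE u v :
  g u v = dot u v / s - kappa * dot x u * dot x v / s ^+ 2.
Proof. by rewrite /klein_metric enorm_sqr. Qed.

Lemma klein_ball_gt0 : klein_ball kappa x -> 0 < s.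
Proof.
rewrite /klein_ball /s; case: ifPn => [k0 _|]; first by rewrite ltr_pwDl// mulr_ge0 ?dot_ge0.
rewrite -ltNge => k0 /= xk.
have r0 : 0 < Num.sqrt (- kappa) by rewrite sqrtr_gt0 oppr_gt0.
move: xk; rewrite ltr_pdivlMr// => xk.
have : (enorm x * Num.sqrt (- kappa)) ^+ 2 < 1.
  by rewrite expr_lt1// mulr_ge0 ?sqrtr_ge0.
by rewrite exprMn enorm_sqr sqr_sqrtr ?oppr_ge0 ?ltW//; lra.
Qed.

End klein_metric_theory.

Section box_face_theory.
Context {R : realType} (d : nat) (taum taup : 'I_d -> R).
Hypothesis htaum : forall i, 0 < taum i.
Hypothesis htaup : forall i, 0 < taup i.
Context (p : nat) (x : 'rV[R]_d).
Local Notation F := (box_face taum taup p).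
Hypothesis hx : relint F x.

Lemma relint_face : F x. Proof. by case: hx. Qed.

(** The point x + e (u - v) lies in the affine hull of the face, close to x. *)
Lemma relint_dir u v : F u -> F v -> exists2 e : R, 0 < e & F (x + e *: (u - v)).
Proof.
move=> Fu Fv; case: hx => Fx [e e0 H].
(* the added 1 covers the case u = v *)
pose r := e / (2 * (enorm (u - v) + 1)).
have n0 : 0 <= enorm (u - v) by exact: sqrtr_ge0.
have r0 : 0 < r by rewrite divr_gt0// mulr_gt0// ltr_wpDl.
exists r => //; apply: H; last first.
  rewrite addrC addKr enormZ gtr0_norm// /r mulrAC ltr_pdivrMr ?mulr_gt0 ?ltr_wpDl//.
  by rewrite ltr_pM2l//; lra.
pose z (i : 'I_3) := if val i == 0%N then x else if val i == 1%N then u else v.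
pose c (i : 'I_3) := if val i == 0%N then 1 else if val i == 1%N then r else - r.
exists 3%N, z, c; split.
- by move=> [[|[|i]] ?]; rewrite /z.
- by rewrite !big_ord_recl big_ord0 /c /=; ring.
- rewrite !big_ord_recl big_ord0 /c /z /= scale1r addr0 scalerBr.
  by rewrite scaleNr.
Qed.

Let full : 'rV[R]_d := \row_i taup i.

Let F_full : F full.
Proof.
split=> i; rewrite mxE// lexx andbT.
by rewrite (@le_trans _ _ 0) ?oppr_le0 ?ltW.
Qed.

Let drop (j : 'I_d) : 'rV[R]_d := \row_i if i == j then - taum j else taup i.

Let F_drop (j : 'I_d) : (p <= j)%N -> F (drop j).
Proof.
move=> pj; split=> i; rewrite mxE.
  have t0 := htaup i; have s0 := htaum i; case: eqP => [<-|_].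
    by rewrite lexx/=; lra.
  by rewrite lexx andbT; lra.
by move=> ip; case: eqP => // ij; move: ip; rewrite ij ltnNge pj.
Qed.

Lemma relint_box_lt (j : 'I_d) : (p <= j)%N -> - taum j < x 0 j < taup j.
Proof.
move=> pj; have t0 := htaup j; have s0 := htaum j.
have [e e0 [/(_ j) + _]] := relint_dir F_full (F_drop pj).
have [e' e'0 [/(_ j) + _]] := relint_dir (F_drop pj) F_full.
rewrite !mxE eqxx => /andP[h1 _] /andP[_ h2].
have : 0 < e * (taup j - - taum j) by rewrite mulr_gt0//; lra.
have : 0 < e' * (taup j - - taum j) by rewrite mulr_gt0//; lra.
move: h1; rewrite -opprB mulrN => h1 u1 u2.
by apply/andP; split; lra.
Qed.

(** A finite intersection of right neighbourhoods of 0 is nonempty. *)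
Lemma small_scale (I : finType) (P : I -> R -> Prop) :
  (forall i, exists2 e : R, 0 < e & forall e', 0 < e' -> e' <= e -> P i e') ->
  exists2 e : R, 0 < e & forall i, P i e.
Proof.
move=> H.
have HP : \forall e \near 0^'+, forall i, P i e.
  apply: filter_forall => i; have [e e0 He] := H i.
  near=> e'; apply: He; first by near: e'; exact: nbhs_right_gt.
  by near: e'; exact: nbhs_right_le.
near (0 : R)^'+ => e; exists e; first by near: e; exact: nbhs_right_gt.
by near: e.
Unshelve. all: end_near. Qed.

Lemma small_scale_le (y z D : R) : 0 < D - y ->
  exists2 e : R, 0 < e & forall e', 0 < e' -> e' <= e -> y + e' * z <= D.
Proof.
move=> D0; have z1 : 0 < `|z| + 1 by rewrite ltr_wpDl.
exists ((D - y) / (`|z| + 1)); first by rewrite divr_gt0.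
move=> e' e0; rewrite ler_pdivlMr// => h.
have : e' * z <= e' * (`|z| + 1).
  by rewrite ler_wpM2l ?(ltW e0)//; have := ler_norm z; lra.
by lra.
Qed.

Context (m : nat) (a : 'I_m -> 'rV[R]_d) (b : 'I_m -> R).
Hypothesis hab : irredundant_representation a b (box taum taup).

Lemma box_ineq r y : box taum taup y -> dot (a r) y <= b r.
Proof. by case: hab => _ -> _; apply. Qed.

(** An inequality tight at a relative interior point is tight on the whole face:
from x one can move a little away from any point y of the face, and the affine
function would exceed its bound. *)
Lemma active_of_eq r : dot (a r) x = b r -> active a b F r.
Proof.
move=> ar y Fy; apply/eqP; rewrite eq_le box_ineq//=; last by case: Fy.
have [e e0 [/(box_ineq r) + _]] := relint_dir relint_face Fy.
rewrite dotDr dotZr ar gerDl pmulr_rle0// -scaleN1r dotDr dotZr ar.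
by lra.
Qed.

(** Both cones consist of the directions along which one can move from x and stay in
the box: for the given inequalities because the others are slack at x, for the
coordinate inequalities because the coordinates beyond p are interior and the
lower bounds are slack. *)
Lemma tangent_cone_box_face :
  tangent_cone a b F = [set u | forall i : 'I_d, (i < p)%N -> u 0 i <= 0].
Proof.
have [bx fx] := relint_face.
apply/seteqP; split=> u /=.
  move=> Tu; have [e e0 He] : exists2 e : R, 0 < e & forall r, dot (a r) (x + e *: u) <= b r.
    apply: small_scale => r; have [ar|ar] := eqVneq (dot (a r) x) (b r).
      exists 1 => // e' e0 _; rewrite dotDr dotZr ar gerDl.
      by rewrite pmulr_rle0//; apply: Tu; exact: active_of_eq.
    have [|e e0 He] := @small_scale_le (dot (a r) x) (dot (a r) u) (b r).
      by rewrite subr_gt0 lt_neqAle ar box_ineq.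
    by exists e => // e' e'0 /(He _ e'0); rewrite dotDr dotZr.
  move=> i ip; have : box taum taup (x + e *: u) by case: hab => _ -> _.
  move=> /(_ i)/andP[_]; rewrite !mxE fx// gerDl pmulr_rle0//.
move=> hu r ar; have arx : dot (a r) x = b r by apply: ar; exact: relint_face.
have [e e0 He] : exists2 e : R, 0 < e &
    forall i, - taum i <= x 0 i + e * u 0 i <= taup i.
  apply: small_scale => i; have t0 := htaup i; have s0 := htaum i.
  have lo : - taum i < x 0 i.
    case: (ltnP i p) => [ip|pi]; first by rewrite fx//; lra.
    by case/andP: (relint_box_lt pi).
  have [|e1 e10 H1] := @small_scale_le (- x 0 i) (- u 0 i) (taum i).
    by rewrite opprK addrC -[taum i]opprK subr_gt0.
  case: (ltnP i p) => [ip|pi].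
    exists e1 => // e' e'0 /(H1 _ e'0); have := hu i ip; rewrite fx// => u0 h.
    have : e' * u 0 i <= 0 by rewrite pmulr_rle0.
    by move: h; rewrite mulrN => h1 h2; apply/andP; split; lra.
  have /andP[_ up] := relint_box_lt pi.
  have [|e2 e20 H2] := @small_scale_le (x 0 i) (u 0 i) (taup i).
    by rewrite subr_gt0.
  exists (Num.min e1 e2); first by rewrite lt_min e10.
  move=> e' e'0; rewrite le_min => /andP[/(H1 _ e'0) h1 /(H2 _ e'0) h2].
  by move: h1; rewrite mulrN => h1; apply/andP; split; lra.
have : box taum taup (x + e *: u) by move=> i; rewrite !mxE.
by move=> /(box_ineq r); rewrite dotDr dotZr arx gerDl pmulr_rle0.
Qed.

End box_face_theory.

(** * The cones of a face in the Klein metric *)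

Section orthocentric.
Context {R : realType} (p : nat).
Implicit Types tau : 'I_p -> R.
Local Notation one := (fun _ : 'I_p => 1 : R).

(** The required Gram matrix is D (1 + a^T a / lambda_0) D with a = tau and D the
diagonal matrix of the inverses of tau; the rows of D times the square root of
the middle factor realize it. *)
Lemma orthocentric_cone_exists (lambda0 : R) tau : lambda0 != 0 ->
  (forall i, tau i != 0) -> 0 < 1 + 1 / lambda0 * \sum_j tau j ^+ 2 ->
  exists n (C : set 'rV[R]_n),
    orthocentric_cone lambda0 (fun j => tau j ^+ 2) one C.
Proof.
move=> l0 tau0 h.
have [|beta [uS SS]] := @rank_one_sqrt R p tau (- (1 / lambda0)).
  by rewrite mulNr opprK.
set S := rank_one tau beta in uS SS.
pose D := diag_mx (\row_j (tau j)^-1).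
pose v i := row i (D *m S).
have vE : \matrix_i v i = D *m S.
  by apply/matrixP => i j; rewrite !mxE.
have uD : D \in unitmx.
  rewrite unitmxE det_diag unitfE; apply/prodf_neq0 => j _.
  by rewrite mxE invr_eq0.
exists p, (pos_hull (fun i => 1 *: v i)); split => //.
- by move=> i; rewrite expf_neq0.
- by move=> i; left.
exists v; split => //; first by rewrite vE row_free_unit unitmx_mul uD.
move=> i j.
have -> : dot (v i) (v j) = (D *m S *m (D *m S)^T) i j.
  by rewrite [RHS]mxE; apply: eq_bigr => l _; rewrite ![row _ _ _ _]mxE [X in _ = _ * X]mxE.
rewrite trmx_mul tr_rank_one mulmxA -(mulmxA D S) SS tr_diag_mx.
rewrite mul_mx_diag mxE mul_diag_mx !mxE.
have [<-|_] := eqVneq i j; rewrite /= ?mulr0n ?mulr1n; last first.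
  by field; rewrite l0 !tau0.
by field; rewrite l0 tau0.
Qed.

Lemma pos_hull_lincomb n (v : 'I_p -> 'rV[R]_n) tau : (forall i, 0 < tau i) ->
  pos_hull (fun i => 1 *: v i) =
  [set lincomb (fun i => tau i *: v i) t | t in orthant xpredT].
Proof.
move=> tau0; apply/seteqP; split=> u.
  move=> [c c0 ->]; exists (\row_i (c i / tau i)).
    by move=> i _; rewrite mxE divr_ge0// ltW.
  apply: eq_bigr => i _; rewrite mxE scalerA divfK ?scale1r//.
  by rewrite gt_eqF.
move=> [t t0 <-]; exists (fun i => t 0 i * tau i).
  by move=> i; rewrite mulr_ge0 ?t0// ltW.
by apply: eq_bigr => i _; rewrite scale1r scalerA.
Qed.

End orthocentric.

Section face_cones.
Context {R : realType} (p k : nat) (kappa : R) (x : 'rV[R]_(p + k)).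
Local Notation g := (klein_metric kappa x).
Let s := 1 + kappa * dot x x.
Hypothesis s0 : 0 < s.
Let tau (i : 'I_p) := x 0 (lshift k i).
Let xi (j : 'I_k) := x 0 (rshift p j).
Let sigma := 1 + kappa * \sum_j tau j ^+ 2.
Hypothesis tau0 : forall i, 0 < tau i.

Let r := Num.sqrt s.
Let r0 : 0 < r. Proof. by rewrite sqrtr_gt0. Qed.
Let rr : r * r = s. Proof. by rewrite -expr2 sqr_sqrtr// ltW. Qed.

Let dot_split : dot x x = \sum_j tau j ^+ 2 + \sum_j xi j ^+ 2.
Proof. by rewrite /dot big_split_ord/=; congr (_ + _); apply: eq_bigr. Qed.

(** For kappa < 0, dropping the free coordinates of x only increases s. *)
Lemma face_sigma_gt0 : 0 < sigma.
Proof.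
have [k0|k0] := leP 0 kappa.
  by rewrite ltr_pwDl// mulr_ge0// sumr_ge0// => j _; rewrite sqr_ge0.
apply: (lt_le_trans s0); rewrite lerD2l dot_split mulrDr gerDl.
by rewrite mulr_le0_ge0 ?(ltW k0)// sumr_ge0// => j _; rewrite sqr_ge0.
Qed.
Let sigma0 := face_sigma_gt0.

Definition face_tangent : set 'rV[R]_(p + k) :=
  [set u | forall i : 'I_(p + k), (i < p)%N -> u 0 i <= 0].

Definition face_normal : set 'rV[R]_(p + k) :=
  [set v | forall u, face_tangent u -> g v u <= 0].

Lemma face_tangent_param :
  cone_param face_tangent (fun i => - r *: delta_mx 0 i)
    (orthant (fun i : 'I_(p + k) => (i < p)%N)).
Proof.
have sumE t : lincomb (fun i => - r *: delta_mx 0 i) t = - r *: t.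
  rewrite [in RHS](row_sum_delta t) scaler_sumr; apply: eq_bigr => i _.
  by rewrite scalerA mulrC -scalerA.
split.
- by move=> t /eqP; rewrite sumE scaler_eq0 oppr_eq0 gt_eqF//= => /eqP.
- apply/seteqP; split=> u.
    move=> Tu; exists (- r^-1 *: u).
      move=> i ip; rewrite mxE mulNr oppr_ge0 pmulr_rle0 ?invr_gt0//.
      exact: Tu.
    by rewrite sumE scalerA mulrNN mulfV ?scale1r// gt_eqF.
  move=> [t t0 <-] i ip; rewrite sumE mxE mulNr oppr_le0 mulr_ge0 ?(ltW r0)//.
  exact: t0.
- by move=> i j _; rewrite mxE ler0n.
Qed.

(** Here the free coordinates keep their own entries in the Gram matrix: only the
number of factors [Phi] knows which coordinates are constrained. *)
Lemma face_tangent_angle :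
  (solid_angle g face_tangent)%:C = gaussian_mean (fun z =>
    \prod_j Phi ((tau j)%:C * csqrt kappa * z%:C)).
Proof.
have sE : 1 + kappa * \sum_j x 0 j ^+ 2 = s by rewrite /s /dot.
rewrite (solid_angle_cone_param face_tangent_param (c := kappa) (a := x 0)
  (b := fun i : 'I_(p + k) => (i < p)%N)) ?sE//.
- congr gaussian_mean; apply/funext => z; rewrite big_split_ord/=.
  rewrite [X in _ * X]big1 ?mulr1.
    by apply: eq_bigr => i _; rewrite ltn_ord.
  by move=> i _; rewrite ltnNge leq_addr.
- exact: klein_metric_linear.
- exact: klein_metric_linearl.
- move=> i j; rewrite klein_metricE -/s !dotZl !dotZr dot_delta.
  rewrite ![dot x _]dotC !dot_delta mxE eqxx/= -rr.
  by field; rewrite gt_eqF.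
Qed.

(** Up to the factor s, the basis dual to the coordinate basis for the metric g. *)
Let nu (i : 'I_(p + k)) : 'rV[R]_(p + k) := delta_mx 0 i + (kappa * x 0 i) *: x.

Let g_nu i u : g (nu i) u = u 0 i / s.
Proof.
rewrite klein_metricE -/s /nu dotDl dotZl dot_delta dotDr dotZr.
rewrite (dotC x (delta_mx _ _)) dot_delta /s.
have : 1 + kappa * dot x x != 0 by rewrite gt_eqF.
by move: (dot x x) => D D0; field.
Qed.

Let nu_expand v : v = \sum_i (s * g v (delta_mx 0 i)) *: nu i.
Proof.
set z := \sum_i _.
have gz u : g z u = g v u.
  rewrite /z (scalar_sum (klein_metric_linearl kappa x u)).
  rewrite [in RHS](row_sum_delta u) (scalar_sum (klein_metric_linear kappa x v)).
  apply: eq_bigr => i _; rewrite g_nu; field.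
  by rewrite gt_eqF.
apply/rowP => j; apply: (mulIf (x := s^-1)); first by rewrite invr_eq0 gt_eqF.
by rewrite -!g_nu ![g (nu j) _]klein_metricC gz.
Qed.

(** Generators of the normal cone, normalized so that the Gram matrix does not
involve s. *)
Let nw (i : 'I_p) := r *: nu (lshift k i).

Let g_nw i u : g (nw i) u = u 0 (lshift k i) / r.
Proof.
have /= := scalar_scale (klein_metric_linearl kappa x u) r (nu (lshift k i)).
rewrite -/(nw i) => ->; rewrite g_nu -rr; field.
by rewrite gt_eqF.
Qed.

Let g_nw_sum t u : g (lincomb nw t) u = (\sum_i t 0 i * u 0 (lshift k i)) / r.
Proof.
rewrite /lincomb (scalar_sum (klein_metric_linearl kappa x u)) mulr_suml.
by apply: eq_bigr => i _; rewrite g_nw mulrA.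
Qed.

(** In the expansion of v over nu the coefficients are s g(v, e_i).  Membership in the
normal cone makes them nonnegative for i < p, where - e_i is tangent, and zero
beyond, where both e_i and - e_i are. *)
Lemma face_normal_param :
  cone_param face_normal nw (orthant xpredT).
Proof.
split.
- move=> t H; apply/rowP => i.
  have := g_nw_sum t (delta_mx 0 (lshift k i)).
  rewrite H -(scale0r 0) (scalar_scale (klein_metric_linearl kappa x _)) mul0r.
  rewrite (bigD1 i)//= mxE !eqxx mulr1 big1 ?addr0.
    move=> /esym/eqP; rewrite mulf_eq0 invr_eq0 (gt_eqF r0) orbF mxE.
    by move=> /eqP.
  move=> j ji; rewrite mxE eqxx/= (inj_eq (@lshift_inj _ _)) (negbTE ji).
  by rewrite mulr0.
- apply/seteqP; split=> v.
    move=> Nv; exists (\row_i (r * g v (delta_mx 0 (lshift k i)))).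
      move=> i _; rewrite mxE pmulr_rge0//.
      have := Nv (-1 *: delta_mx 0 (lshift k i)).
      rewrite (scalar_scale (klein_metric_linear kappa x v)) mulN1r oppr_le0; apply.
      by move=> l lp; rewrite !mxE mulN1r oppr_le0 ler0n.
    rewrite [RHS]nu_expand big_split_ord/= [X in _ + X]big1 ?addr0.
      apply: eq_bigr => i _; rewrite mxE /nw scalerA -rr; congr (_ *: _).
      by ring.
    move=> j _; suff -> : g v (delta_mx 0 (rshift p j)) = 0 by rewrite mulr0 scale0r.
    have Tj (c : R) : face_tangent (c *: delta_mx 0 (rshift p j)).
      move=> l lp; rewrite !mxE eqxx/= (_ : (l == _) = false) ?mulr0//.
      by apply/negbTE; apply: contraL lp => /eqP ->; rewrite -leqNgt leq_addr.
    have := Nv _ (Tj 1); have := Nv _ (Tj (-1)).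
    rewrite !(scalar_scale (klein_metric_linear kappa x v)) mul1r mulN1r oppr_le0 => h1 h2.
    by apply/eqP; rewrite eq_le h1 h2.
  move=> [t t0 <-] u Tu; rewrite g_nw_sum pmulr_lle0 ?invr_gt0//.
  apply: sumr_le0 => i _; rewrite mulr_ge0_le0 ?t0//.
  by apply: Tu; rewrite /= ltn_ord.
- by move=> i j _; rewrite mxE ler0n.
Qed.

Let g_nw_nw i j : g (nw i) (nw j) = (i == j)%:R + kappa * (tau i * tau j).
Proof.
rewrite g_nw /nw /nu !mxE eqxx/= (inj_eq (@lshift_inj _ _)) /tau.
by field; rewrite gt_eqF.
Qed.

(** The sign e costs nothing, since the Gram matrix is quadratic in tau; it absorbs
the difference between the square root of an inverse and the inverse of the square
root. *)
Lemma face_normal_angle (kappa0 : kappa != 0) :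
  let mu0 := - (1 / kappa) - \sum_j tau j ^+ 2 in forall e : R, e ^+ 2 = 1 ->
  (solid_angle g face_normal)%:C = gaussian_mean (fun z =>
    \prod_j Phi ((e * tau j)%:C * csqrt (mu0^-1) * z%:C)).
Proof.
move=> mu0 e e2.
have mu0E : mu0 = - sigma / kappa by rewrite /mu0 /sigma; field.
have sg : sigma != 0 by rewrite gt_eqF.
have eN : \sum_j (e * tau j) ^+ 2 = \sum_j tau j ^+ 2.
  by apply: eq_bigr => j _; rewrite exprMn e2 mul1r.
have QE : 1 + mu0^-1 * \sum_j (e * tau j) ^+ 2 = sigma^-1.
  rewrite eN mu0E; have -> : \sum_j tau j ^+ 2 = (sigma - 1) / kappa.
    by rewrite /sigma; field.
  by field; rewrite sg kappa0.
rewrite (solid_angle_cone_param face_normal_param (c := mu0^-1)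
  (a := fun j => e * tau j) (b := xpredT)) ?QE ?invr_gt0//.
- exact: klein_metric_linear.
- exact: klein_metric_linearl.
- move=> i j; rewrite g_nw_nw [e * _ * _]mulrACA -[e * e]expr2 e2 mul1r mu0E.
  by field; rewrite sg kappa0.
Qed.

Lemma face_normal_isometric n (C : set 'rV[R]_n) (kappa0 : kappa != 0) :
  orthocentric_cone (1 / kappa) (fun j => tau j ^+ 2) (fun=> 1) C ->
  isometric g face_normal (@dot R n) C.
Proof.
move=> [_ _ _ [v [_ vv CE]]].
apply: (isometric_cone_param face_normal_param (w' := fun i => tau i *: v i)).
- exact: klein_metric_linear.
- exact: klein_metric_linearl.
- exact: dot_linear.
- exact: dot_linearl.
- by rewrite CE; exact: pos_hull_lincomb.
- move=> i j; rewrite g_nw_nw dotZl dotZr vv.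
  have ti : tau i != 0 by rewrite gt_eqF.
  have [<-|_] := eqVneq i j; rewrite /= ?mulr0n ?mulr1n.
    by field; rewrite ti kappa0.
  by field; rewrite ti kappa0.
Qed.

Let taur : 'rV[R]_p := lsubmx x.
Let xir : 'rV[R]_k := rsubmx x.

Let gE u u' v v' : g (row_mx u v) (row_mx u' v') =
  (dot u u' + dot v v') / s -
  kappa * (dot taur u + dot xir v) * (dot taur u' + dot xir v') / s ^+ 2.
Proof.
have dx y z : dot x (row_mx y z) = dot taur y + dot xir z.
  by rewrite -{1}(hsubmxK x) dot_row_mx.
by rewrite klein_metricE -/s dot_row_mx !dx.
Qed.

Let sE : s = sigma + kappa * dot xir xir.
Proof.
rewrite /s /sigma dot_split mulrDr addrA; congr (_ + kappa * _).
by apply: eq_bigr => j _; rewrite !mxE expr2.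
Qed.

(** The generators are A i, orthogonal to the lineality space, and the basis L of the
lineality space made orthogonal by the inverse square root of the restricted
metric; a factor r = sqrt s, and 1 / tau i for A i, normalizes their Gram matrix. *)
Lemma face_tangent_isometric n (C : set 'rV[R]_n) (kappa0 : kappa != 0) :
  let mu0 := - (1 / kappa) - \sum_j tau j ^+ 2 in
  orthocentric_cone mu0 (fun j => tau j ^+ 2) (fun=> 1) C ->
  isometric g face_tangent (@dot R (k + n)) (orthogonal_sum [set: 'rV[R]_k] C).
Proof.
move=> mu0 [_ _ _ [v [_ vv CE]]].
have sg : sigma != 0 by rewrite gt_eqF.
have ss : s != 0 by rewrite gt_eqF.
have rn : r != 0 by rewrite gt_eqF.
have ti i : tau i != 0 by rewrite gt_eqF.
have mu0E : 1 / mu0 = - kappa / sigma.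
  have -> : mu0 = - sigma / kappa by rewrite /mu0 /sigma; field.
  by field; rewrite sg kappa0.
have [|beta [uS SS]] := @rank_one_sqrt R k xi (kappa / s).
  have -> : \sum_j xi j ^+ 2 = dot xir xir.
    by apply: eq_bigr => j _; rewrite !mxE expr2.
  have -> : 1 - kappa / s * dot xir xir = sigma / s by rewrite sE; field; rewrite -sE.
  by rewrite divr_gt0.
set S := rank_one xi beta in uS SS.
(* S * S is s times the Gram matrix of the metric on the lineality space *)
pose B := invmx S.
have BSB : B *m rank_one xi (kappa / s) *m B^T = 1%:M.
  by rewrite -SS trmx_inv tr_rank_one mulmxA mulVmx// mul1mx mulmxV.
pose A (i : 'I_p) : 'rV[R]_(p + k) :=
  row_mx (delta_mx 0 i) ((kappa * tau i / sigma) *: xir).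
pose L (j : 'I_k) : 'rV[R]_(p + k) := row_mx 0 (row j B).
pose w (i : 'I_(p + k)) : 'rV[R]_(p + k) :=
  match fintype.split i with inl i => - (r / tau i) *: A i | inr j => r *: L j end.
pose w' (i : 'I_(p + k)) : 'rV[R]_(k + n) :=
  match fintype.split i with
  | inl i => row_mx 0 (v i) | inr j => row_mx (delta_mx 0 j) 0 end.
have wl i : w (lshift k i) = - (r / tau i) *: A i by rewrite /w (unsplitK (inl i)).
have wr j : w (rshift p j) = r *: L j by rewrite /w (unsplitK (inr j)).
have w'l i : w' (lshift k i) = row_mx 0 (v i) by rewrite /w' (unsplitK (inl i)).
have w'r j : w' (rshift p j) = row_mx (delta_mx 0 j) 0 by rewrite /w' (unsplitK (inr j)).
have wE t : lincomb w t = row_mx (\row_i (- (r / tau i) * t 0 (lshift k i)))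
    ((- (r * kappa / sigma) * \sum_i t 0 (lshift k i)) *: xir +
     r *: (rsubmx t *m B)).
  rewrite /lincomb big_split_ord/=.
  under eq_bigr do rewrite wl scalerA.
  under [X in _ + X]eq_bigr do rewrite wr scalerA.
  apply/rowP => l; rewrite mxE !summxE; case: (split_ordP l) => [i ->|j ->].
    rewrite row_mxEl mxE [X in _ + X]big1 ?addr0; last first.
      by move=> j _; rewrite mxE row_mxEl mxE mulr0.
    rewrite (bigD1 i)//= mxE row_mxEl mxE !eqxx mulr1 big1 ?addr0 1?mulrC//.
    by move=> j ji; rewrite mxE row_mxEl mxE eq_sym (negbTE ji) andbF mulr0.
  rewrite row_mxEr !mxE; congr (_ + _).
    rewrite mulr_sumr mulr_suml; apply: eq_bigr => i _.
    by rewrite mxE row_mxEr !mxE; field; rewrite sg ti.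
  rewrite mulr_sumr; apply: eq_bigr => i _.
  by rewrite mxE row_mxEr !mxE; ring.
have w'E t : lincomb w' t = row_mx (rsubmx t) (\sum_i t 0 (lshift k i) *: v i).
  rewrite /lincomb big_split_ord/=.
  under eq_bigr do rewrite w'l scale_row_mx scaler0.
  under [X in _ + X]eq_bigr do rewrite w'r scale_row_mx scaler0.
  apply/rowP => l; rewrite mxE !summxE; case: (split_ordP l) => [i ->|j ->].
    rewrite row_mxEl mxE big1 ?add0r; last by move=> j _; rewrite row_mxEl mxE.
    rewrite (bigD1 i)//= row_mxEl !mxE !eqxx mulr1 big1 ?addr0// => j ji.
    by rewrite row_mxEl !mxE eq_sym (negbTE ji) andbF mulr0.
  rewrite row_mxEr summxE [X in _ + X]big1 ?addr0; last first.
    by move=> i _; rewrite row_mxEr mxE.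
  by apply: eq_bigr => i _; rewrite row_mxEr.
have paramT : cone_param face_tangent w (orthant (fun i : 'I_(p + k) => (i < p)%N)).
  split.
  - move=> t; rewrite wE -row_mx0 => /eq_row_mx[/rowP h1].
    have t1 i : t 0 (lshift k i) = 0.
      have := h1 i; rewrite !mxE => /eqP; rewrite mulf_eq0 oppr_eq0 mulf_eq0.
      by rewrite invr_eq0 (negbTE rn) (negbTE (ti i))/= => /eqP.
    rewrite big1 ?mulr0 ?scale0r ?add0r; last by move=> i _; exact: t1.
    move=> /eqP; rewrite scaler_eq0 (negbTE rn)/= => /eqP.
    move=> /(congr1 (mulmx^~ S)); rewrite -mulmxA mulVmx// mulmx1 mul0mx.
    move=> /rowP h2; apply/rowP => l; case: (split_ordP l) => [i ->|j ->]; first by rewrite t1 row_mxEl mxE.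
    by rewrite row_mxEr mxE; have := h2 j; rewrite !mxE.
  - apply/seteqP; split=> u.
      move=> Tu.
      pose t1 : 'rV[R]_p := \row_i (- (tau i / r) * u 0 (lshift k i)).
      pose t2 : 'rV[R]_k := (r^-1 *: (rsubmx u +
        (r * kappa / sigma * \sum_i t1 0 i) *: xir)) *m S.
      exists (row_mx t1 t2).
        move=> l; case: (split_ordP l) => [i ->|j ->] lp.
          rewrite row_mxEl mxE mulNr oppr_ge0 mulr_ge0_le0//; first by rewrite ltW// divr_gt0.
          by apply: Tu; rewrite /= ltn_ord.
        by [].
      have st : \sum_i (row_mx t1 t2) 0 (lshift k i) = \sum_i t1 0 i.
        by apply: eq_bigr => i _; rewrite row_mxEl.
      rewrite wE st row_mxKr /t2 -mulmxA mulmxV// mulmx1 scalerA mulfV// scale1r.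
      apply/rowP => l; case: (split_ordP l) => [i ->|j ->].
        by rewrite row_mxEl mxE row_mxEl mxE; field; rewrite rn ti.
      rewrite row_mxEr !mxE.
      by move: (\sum_i _) => z; ring.
    move=> [t t0 <-] l; rewrite wE; case: (split_ordP l) => [i ->|j ->] lp; last first.
      by [].
    rewrite row_mxEl mxE mulNr oppr_le0 mulr_ge0//; first by rewrite ltW// divr_gt0.
    by apply: t0; rewrite /= ltn_ord.
  - by move=> i j _; rewrite mxE ler0n.
apply: (isometric_cone_param paramT (w' := w')).
- exact: klein_metric_linear.
- exact: klein_metric_linearl.
- exact: dot_linear.
- exact: dot_linearl.
- rewrite CE; apply/seteqP; split=> u.
    move=> [y _ [z [c c0 ->] <-]]; exists (row_mx (\row_i c i) y).
      move=> l; case: (split_ordP l) => [i ->|j ->] lp.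
        by rewrite row_mxEl mxE.
      by [].
    rewrite w'E row_mxKr; congr row_mx; apply: eq_bigr => i _.
    by rewrite row_mxEl mxE scale1r.
  move=> [t t0 <-]; rewrite w'E; exists (rsubmx t) => //.
  exists (\sum_i t 0 (lshift k i) *: v i) => //.
  exists (fun i => t 0 (lshift k i)).
    by move=> i; apply: t0; rewrite /= ltn_ord.
  by apply: eq_bigr => i _; rewrite scale1r.
- have dtau i : dot taur (delta_mx 0 i) = tau i by rewrite dotC dot_delta mxE.
  have gAA i j : g (A i) (A j) = ((i == j)%:R - kappa * (tau i * tau j) / sigma) / s.
    rewrite gE dot_delta mxE eqxx/= eq_sym !dtau !dotZl !dotZr eq_sym.
    by rewrite sE; move: (dot xir xir) sE => D E; field; rewrite -E ss sg.
  have gAL i j : g (A i) (L j) = 0.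
    rewrite gE dot0r dotZl dtau !dotZr dot0r !add0r.
    by rewrite sE; move: (dot xir xir) (dot xir _) sE => D y E; field; rewrite -E ss sg.
  have gLL i j : g (L i) (L j) = (i == j)%:R / s.
    rewrite gE !dot0r !add0r.
    have := BSB => /matrixP/(_ i j); rewrite [in X in _ = X -> _]mxE => <-.
    have -> : (B *m rank_one xi (kappa / s) *m B^T) i j =
        (row i B *m rank_one xi (kappa / s) *m (row j B)^T) 0 0.
      by rewrite -row_mul [in LHS]mxE [in RHS]mxE; apply: eq_bigr => l _; rewrite !mxE.
    rewrite rank_one_form.
    have dx y : dot xir y = \sum_j xi j * y 0 j by apply: eq_bigr => l _; rewrite mxE.
    by rewrite !dx /dot; field.
  move=> l l'.
  case: (split_ordP l) (split_ordP l') => [i ->|i ->] [j ->|j ->]; rewrite ?(wl, wr, w'l, w'r) dot_row_mx.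
  + rewrite dot0r add0r vv mu0E (scalar_scale (klein_metric_linear kappa x _)).
    rewrite (scalar_scale (klein_metric_linearl kappa x _)) gAA -rr.
    have [<-|_] := eqVneq i j; rewrite /= ?mulr0n ?mulr1n.
      by field; rewrite rn ti sg.
    by field; rewrite rn !ti sg.
  + rewrite dot0r dot0l addr0 (scalar_scale (klein_metric_linear kappa x _)).
    by rewrite (scalar_scale (klein_metric_linearl kappa x _)) gAL !mulr0.
  + rewrite dot0r dot0l addr0 (scalar_scale (klein_metric_linear kappa x _)).
    rewrite (scalar_scale (klein_metric_linearl kappa x _)) klein_metricC gAL.
    by rewrite !mulr0.
  + rewrite dot0r addr0 dot_delta mxE eqxx/=.
    rewrite (scalar_scale (klein_metric_linear kappa x _)).
    rewrite (scalar_scale (klein_metric_linearl kappa x _)) gLL -rr.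
    by field.
Qed.

End face_cones.

(** * The theorem on boxes *)

Section complex_sqrt.
Context {R : realType}.

Lemma csqrtM (t c : R) : 0 < t -> csqrt (t ^+ 2 * c) = t%:C * csqrt c.
Proof.
move=> t0; rewrite /csqrt pmulr_rge0 ?exprn_gt0//; case: ifP => _.
  by rewrite sqrtrM ?sqr_ge0// sqrtr_sqr gtr0_norm// rmorphM.
rewrite -mulrN sqrtrM ?sqr_ge0// sqrtr_sqr gtr0_norm//.
by simpc.
Qed.

(** For c < 0 both square roots are positive multiples of i, and 1 / i = - i. *)
Lemma csqrtV (c : R) : c != 0 ->
  (csqrt c)^-1 = (if 0 <= c then 1 else -1)%:C * csqrt c^-1.
Proof.
move=> c0; rewrite /csqrt invr_ge0; case: ifPn => [cge|].
  by rewrite mul1r -fmorphV sqrtrV.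
rewrite -ltNge => cn; have s0 : Num.sqrt (- c) != 0.
  by rewrite gt_eqF// sqrtr_gt0 oppr_gt0.
have -> : Num.sqrt (- c^-1) = (Num.sqrt (- c))^-1.
  by rewrite -invrN sqrtrV// oppr_ge0 ltW.
apply: (mulIf (x := 0 +i* Num.sqrt (- c))).
  by rewrite eq_complex /= negb_and s0 orbT.
rewrite mulVf; last by rewrite eq_complex /= negb_and s0 orbT.
by simpc; rewrite mulVf.
Qed.

Lemma g_fun_one p (t : 'I_p -> R) (c : R) : (forall j, 0 < t j) ->
  g_fun c (fun j => t j ^+ 2) (fun=> 1) =
  gaussian_mean (fun z => \prod_j Phi ((t j)%:C * csqrt c^-1 * z%:C)).
Proof.
move=> t0; rewrite /g_fun; apply: (congr1 (@gaussian_mean R)).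
apply/funext => z.
by apply: eq_bigr => j _; rewrite mul1r csqrtM.
Qed.

End complex_sqrt.

(** The ambient dimension is written as a sum, so that row vectors split into the
constrained and the free coordinates. *)
Lemma box_face_cones (R : realType) (p k : nat) (kappa : R)
    (x : 'rV[R]_(p + k)) (tau : 'I_p -> R) :
  kappa != 0 -> 0 < 1 + kappa * dot x x ->
  (forall j, 0 < tau j) -> (forall j, x 0 (lshift k j) = tau j) ->
  let gx := klein_metric kappa x in
  let T := @face_tangent R p k in
  let N := face_normal kappa x in
  let lambda := fun j => tau j ^+ 2 in
  let mu0 := - (1 / kappa) - \sum_j tau j ^+ 2 in
  let one := fun _ : 'I_p => 1 : R in
  [/\ (exists n (C : set 'rV[R]_n),
        orthocentric_cone (1 / kappa) lambda one C) /\
      (forall n (C : set 'rV[R]_n),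
        orthocentric_cone (1 / kappa) lambda one C ->
        isometric gx N (@dot R n) C),
      (solid_angle gx N)%:C = g_fun mu0 lambda one /\
      g_fun mu0 lambda one =
        gaussian_mean (fun z =>
          \prod_j Phi ((tau j)%:C * z%:C / csqrt mu0)),
      (exists n (C : set 'rV[R]_n), orthocentric_cone mu0 lambda one C) /\
      (forall n (C : set 'rV[R]_n),
        orthocentric_cone mu0 lambda one C ->
        isometric gx T (@dot R (k + n))
          (orthogonal_sum [set: 'rV[R]_k] C)) &
      (solid_angle gx T)%:C = g_fun (1 / kappa) lambda one /\
      g_fun (1 / kappa) lambda one =
        gaussian_mean (fun z =>
          \prod_j Phi ((tau j)%:C * csqrt kappa * z%:C))].
Proof.
move=> kappa0 s0 tp xtau gx T N lambda mu0 one.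
have xE : (fun j => x 0 (lshift k j)) = tau by apply/funext => j; rewrite xtau.
have xp j : 0 < x 0 (lshift k j) by rewrite xtau.
have tn j : tau j != 0 by rewrite gt_eqF.
have sg0 := face_sigma_gt0 s0.
have angleN e := face_normal_angle s0 kappa0 (e := e).
have isoN n C := face_normal_isometric s0 xp (n := n) (C := C) kappa0.
have isoT n C := face_tangent_isometric s0 xp (n := n) (C := C) kappa0.
have angleT := @face_tangent_angle R p k kappa x s0.
have sE (f : R -> R) : \sum_j f (x 0 (lshift k j)) = \sum_j f (tau j).
  by apply: eq_bigr => j _; rewrite xtau.
have sqE := sE (fun t => t ^+ 2); rewrite /= in sqE; clear sE.
have lE : (fun j => x 0 (lshift k j) ^+ 2) = lambda by apply/funext => j; rewrite xtau.
rewrite sqE in sg0; rewrite /= sqE -/mu0 in angleN.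
rewrite lE -/N -/one in isoN; rewrite /= sqE lE -/mu0 -/T -/one in isoT.
have mu0E : mu0 = - (1 + kappa * \sum_j tau j ^+ 2) / kappa by rewrite /mu0; field.
have mu00 : mu0 != 0.
  by rewrite mu0E mulf_neq0 ?invr_eq0// oppr_eq0 gt_eqF.
have gN : (solid_angle gx N)%:C = g_fun mu0 lambda one.
  rewrite (angleN 1 (expr1n _ 2)) /lambda (g_fun_one mu0 tp).
  apply: (congr1 (@gaussian_mean R)); apply/funext => z.
  by apply: eq_bigr => j _; rewrite mul1r xtau.
split.
- split; last exact: isoN.
  apply: orthocentric_cone_exists => //; first by rewrite mul1r invr_eq0.
  by rewrite !mul1r invrK.
- split; [exact: gN | rewrite -gN].
  (* the sign by which inversion and the square root fail to commute *)
  pose e : R := if 0 <= mu0 then 1 else -1.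
  have e2 : e ^+ 2 = 1 by rewrite /e; case: ifP; rewrite ?expr1n ?sqrrN ?expr1n.
  have argE j z : (e * tau j)%:C * csqrt mu0^-1 * z = (tau j)%:C * z / csqrt mu0.
    by rewrite csqrtV// -/e rmorphM/=; ring.
  rewrite (angleN e e2); apply: (congr1 (@gaussian_mean R)).
  by apply/funext => z; apply: eq_bigr => j _; rewrite xtau argE.
- split; last exact: isoT.
  apply: orthocentric_cone_exists => //.
  have -> : 1 + 1 / mu0 * \sum_j tau j ^+ 2 = (1 + kappa * \sum_j tau j ^+ 2)^-1.
    rewrite mu0E; move: (\sum_j _) sg0 => S S0; field.
    by rewrite kappa0/= gt_eqF.
  by rewrite invr_gt0.
- have kE : (1 / kappa)^-1 = kappa by rewrite mul1r invrK.
  have gT : g_fun (1 / kappa) lambda one = gaussian_mean (fun z =>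
      \prod_j Phi ((tau j)%:C * csqrt kappa * z%:C)).
    have := g_fun_one (1 / kappa) tp; rewrite kE; exact.
  split; [rewrite gT angleT | exact: gT]; apply: (congr1 (@gaussian_mean R)); apply/funext => z.
  by apply: eq_bigr => j _; rewrite xtau.
Qed.

Theorem theorem3p1 (R : realType) (d : nat) (hd : (2 <= d)%N)
    (kappa : R) (hkappa : kappa != 0)
    (taum taup : 'I_d -> R)
    (htaum : forall i, 0 < taum i) (htaup : forall i, 0 < taup i)
    (hP : box taum taup `<=` closure (@klein_ball R d kappa))
    (m : nat) (a : 'I_m -> 'rV[R]_d) (b : 'I_m -> R)
    (hab : irredundant_representation a b (box taum taup))
    (p : nat) (hp1 : (1 <= p)%N) (hpd : (p <= d)%N)
    (hF : kappa < 0 -> ~ ideal_vertex kappa (box_face taum taup p))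
    (x : 'rV[R]_d) (hxF : relint (box_face taum taup p) x)
    (hxB : klein_ball kappa x) :
  let F := box_face taum taup p in
  let gx := klein_metric kappa x in
  let T := tangent_cone a b F in
  let N := normal_cone kappa a b F x in
  let tau := fun j : 'I_p => taup (widen_ord hpd j) in
  let lambda := fun j : 'I_p => tau j ^+ 2 in
  let mu0 := - (1 / kappa) - \sum_j tau j ^+ 2 in
  let one := fun _ : 'I_p => 1 : R in
  [/\ (exists n (C : set 'rV[R]_n),
        orthocentric_cone (1 / kappa) lambda one C) /\
      (forall n (C : set 'rV[R]_n),
        orthocentric_cone (1 / kappa) lambda one C ->
        isometric gx N (@dot R n) C),
      (solid_angle gx N)%:C = g_fun mu0 lambda one /\
      g_fun mu0 lambda one =
        gaussian_mean (fun z =>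
          \prod_j Phi ((tau j)%:C * z%:C / csqrt mu0)),
      (exists n (C : set 'rV[R]_n), orthocentric_cone mu0 lambda one C) /\
      (forall n (C : set 'rV[R]_n),
        orthocentric_cone mu0 lambda one C ->
        isometric gx T (@dot R (d - p + n))
          (orthogonal_sum [set: 'rV[R]_(d - p)] C)) &
      (solid_angle gx T)%:C = g_fun (1 / kappa) lambda one /\
      g_fun (1 / kappa) lambda one =
        gaussian_mean (fun z =>
          \prod_j Phi ((tau j)%:C * csqrt kappa * z%:C))].
Proof.
move=> F gx T N.
have s0 := klein_ball_gt0 hxB.
(* only the sign conditions of the tangent cone and s > 0 matter from here on *)
have TE := tangent_cone_box_face htaum htaup hxF hab.
have fx : forall i : 'I_d, (i < p)%N -> x 0 i = taup i.
  by case: (relint_face hxF).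
rewrite -/F -/T in TE; rewrite /N /normal_cone -/T.
have t0 j : 0 < taup (widen_ord hpd j) by exact: htaup.
have tx j : x 0 (widen_ord hpd j) = taup (widen_ord hpd j) by rewrite fx/=.
move: (T) TE => {N} {}T ->; rewrite /gx => {gx T F hP hF hxF fx hab hd hxB htaum htaup}.
have [k Ed] : exists k, d = (p + k)%N by exists (d - p)%N; rewrite subnKC.
subst d; rewrite addKn; apply: box_face_cones => // j.
by rewrite -tx; congr (x 0 _); exact: val_inj.
Qed.
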